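(* Let $d, L, r \in \mathbb{N}$ and let $(X,Y), (X_1,Y_1), (X_2,Y_2), \dots$ be independent and identically distributed $\mathbb{R}^d \times \mathbb{R}$-valued random variables such that $\mathrm{supp}(X)$ is bounded, the regression function $m(x)=\mathbf{E}\{Y \mid X=x\}$ is bounded in absolute value, and $$\mathbf{E}\left\{ e^{c_7 \cdot Y^2}\right\} < \infty$$ for some constant $c_7>0$. For $n \geq 2$ let $K_n \in \mathbb{N}$ be such that $$\frac{K_n}{n^\kappa} \rightarrow 0 \quad (n \rightarrow \infty)$$ for some $\kappa>0$, and let $A_n, B_n$ be real numbers with $$1 \leq A_n \leq n \quad \text{and} \quad 1 \leq B_n \leq c_{13} \cdot \log n$$ for some constant $c_{13}>0$. Set $\beta_n = c_{12} \cdot \log n$, where $c_{12}>0$ satisfies $c_7 \cdot c_{12} \geq 3$, let $c_8 > 2L$, $c_9>0$ and $t_{min} \in \mathbb{N}$ be constants, and let $m_n$ be the neural network regression estimate defined in the context, based on the data $(X_1,Y_1),\dots,(X_n,Y_n)$ with parameters $K_n, L, r$, $A=A_n$, $B=B_n$, $\beta_n$, $c_8$, $c_9$, $t_{min}$ and random initial weight vector $\mathbf{w}^{(0)}$. Then for any $\epsilon>0$ there exists a constant $c_{14}>0$, not depending on $n$, such that for all $n \geq 2$ $$\mathbf{E} \int | m_n(x)-m(x)|^2 \, \mathbf{P}_X (dx) \leq c_{14} \cdot \left( \mathbf{E} \left\{ \inf_{\mathbf{w}: \|\mathbf{w}-\mathbf{w}^{(0)}\| \leq \frac{1}{n}} \int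 | f_{\mathbf{w}} (x)-m(x)|^2 \, \mathbf{P}_X (dx) \right\} + \frac{A_n^d \cdot B_n^{(L-1) \cdot d}}{n^{1-\epsilon}} \right).$$
   Context: $\mathbf{P}_X$ is the distribution of $X$, $\log$ is the natural logarithm, $\|\cdot\|$ is the Euclidean norm, $\lceil z \rceil$ is the smallest integer $\geq z$, and $\sigma(x)=1/(1+e^{-x})$ is the logistic squasher. Network topology. For parameters $K_n, L, r \in \mathbb{N}$ and a vector $\mathbf{w}$ of real weights (collecting all weights $w_{k,i,j}^{(l)}$ below), define $f_{\mathbf{w}}:\mathbb{R}^d \to \mathbb{R}$ by $$f_{\mathbf{w}}(x) = \sum_{j=1}^{K_n} w_{j,1,1}^{(L)} \cdot f_{j,1}^{(L)}(x),$$ where $$f_{k,i}^{(l)}(x) = \sigma\left(\sum_{j=1}^{r} w_{k,i,j}^{(l-1)} f_{k,j}^{(l-1)}(x) + w_{k,i,0}^{(l-1)}\right) \quad (l=2,\dots,L), \qquad f_{k,i}^{(1)}(x) = \sigma\left(\sum_{j=1}^{d} w_{k,i,j}^{(0)} x^{(j)} + w_{k,i,0}^{(0)}\right).$$ That is, $f_{\mathbf{w}}$ is a linear combination of the outputs of $K_n$ fully connected networks of depth $L$ and width $r$ computed in parallel. Initialization. For parameters $A,B \geq 0$ the components of the random vector $\mathbf{w}^{(0)}$ are independent (and independent of the data and of $(X,Y)$): $(\mathbf{w}^{(0)})_{k,1,1}^{(L)} = 0$ for $k=1,\dots,K_n$; $(\mathbf{w}^{(0)})_{k,i,j}^{(l)}$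 is uniformly distributed on $[-B,B]$ for $l \in \{1,\dots,L-1\}$; $(\mathbf{w}^{(0)})_{k,i,j}^{(0)}$ is uniformly distributed on $[-A,A]$. Gradient descent. Let $F_n(\mathbf{w}) = \frac{1}{n}\sum_{i=1}^n |f_{\mathbf{w}}(X_i)-Y_i|^2$ be the empirical $L_2$ risk. For a stepsize $\lambda_n>0$ and a number of steps $t_n \in \mathbb{N}$ set $$\mathbf{w}^{(t)} = \mathbf{w}^{(t-1)} - \lambda_n \cdot \nabla_{\mathbf{w}} F_n(\mathbf{w}^{(t-1)}) \quad (t=1,\dots,t_n).$$ Choice of $\lambda_n$ and $t_n$. Let $c_8, c_9>0$ and $t_{min} \in \mathbb{N}$ be constants. For a candidate $\hat{t}_n \in \{2^i \cdot t_{min} : i \in \mathbb{N}_0\}$ put $$\lambda_n = \frac{1}{\hat{t}_n}, \qquad t_n = \min\left\{\hat{t}_n, \lceil (\log n)^{c_8} \cdot K_n^3 \rceil\right\},$$ and run gradient descent from $\mathbf{w}^{(0)}$ with these values. The data-dependent $\hat{t}_n$ actually used is the smallest candidate (candidates are tried successively for $i=0,1,2,\dots$) for which either the following three conditions hold simultaneously: $$\frac{1}{t_n}\sum_{t=0}^{t_n-1} \lambda_n \|\nabla_{\mathbf{w}} F_n(\mathbf{w}^{(t)})\|^2 \leq \frac{c_9}{n}, \qquad F_n(\mathbf{w}^{(t_n)}) \leq \frac{1}{t_n}\sum_{t=0}^{t_n-1} F_n(\mathbf{w}^{(t)}) + \frac{c_9}{n}, \qquad \max_{t=1,\dots,t_n}\|\mathbf{w}^{(0)}-\mathbf{w}^{(t)}\|^2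 \leq \frac{c_9 \log n}{n},$$ or $\hat{t}_n \geq n \cdot (\log n)^{c_8} \cdot K_n^3$. Estimate. With the resulting $\lambda_n, t_n$, $m_n(x) = T_{\beta_n}(f_{\mathbf{w}^{(t_n)}}(x))$, where $T_\beta z = \max\{\min\{z,\beta\},-\beta\}$. *)

(* Defs.v *)
From HB Require Import structures.
From mathcomp Require Import all_boot all_order all_algebra.
From mathcomp Require Import finmap.
From mathcomp Require Import all_classical all_reals all_analysis.

Set Implicit Arguments.
Unset Strict Implicit.
Unset Printing Implicit Defensive.

Import Order.TTheory GRing.Theory Num.Theory.
Import numFieldNormedType.Exports.

Local Open Scope classical_set_scope.
Local Open Scope ring_scope.

(* The library norm on row vectors is the maximum norm. *)
Definition enorm (R : realType) (I : finType) (v : I -> R) : R :=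
  Num.sqrt (\sum_i v i ^+ 2).

Definition sigmoid (R : realType) (x : R) : R := (1 + expR (- x))^-1.

Definition truncate (R : realType) (b z : R) : R :=
  Num.max (Num.min z b) (- b).

(** Networks *)

(* Index set of the weights w_{k,i,j}^{(l)} of K parallel networks of depth L
   and width r on R^d:
   - [outer k] is the position (k,1,1) of level L;
   - [inner k i j] is the position (k,i,j) of level 0, with j = 0 for the bias
     and j = 1..d for the inputs;
   - [hidden l k i j] is the position (k,i,j) of level l + 1, so that l in
     'I_(L-1) runs over the levels 1..L-1, with j = 0 for the bias.
   In k and i, ordinals count from 0 instead of 1. *)
Definition widx (d L r K : nat) : finType :=
  ('I_K + ('I_K * 'I_r * 'I_d.+1 + 'I_(L.-1) * 'I_K * 'I_r * 'I_r.+1))%type.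

Definition outer {d L r K : nat} (k : 'I_K) : widx d L r K := inl k.

Definition inner {d L r K : nat} (k : 'I_K) (i : 'I_r) (j : 'I_d.+1) :
  widx d L r K := inr (inl (k, i, j)).

Definition hidden {d L r K : nat} (l : 'I_(L.-1)) (k : 'I_K) (i : 'I_r)
  (j : 'I_r.+1) : widx d L r K := inr (inr (l, k, i, j)).

Notation wvec R d L r K := 'rV[R]_#|{: widx d L r K}|.

Section network.
Context {R : realType} {d L r K : nat}.
Implicit Types (w : wvec R d L r K) (x : d.-tuple R) (k : 'I_K).

Definition wt w (a : widx d L r K) : R := w 0 (enum_rank a).

(* The value 0 outside of the range of levels is never used below. *)
Definition whid w (l : nat) k (i : 'I_r) (j : 'I_r.+1) : R :=
  if insub l is Some l' then wt w (hidden l' k i j) else 0.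

(* [neuron w x k l i] is f_{k,i}^{(l+1)}(x). *)
Fixpoint neuron w x k (l : nat) (i : 'I_r) : R :=
  match l with
  | 0 => sigmoid (\sum_(j < d) wt w (inner k i (lift ord0 j)) * tnth x j
                  + wt w (inner k i ord0))
  | l'.+1 => sigmoid (\sum_(j < r) whid w l' k i (lift ord0 j)
                                   * neuron w x k l' j
                      + whid w l' k i ord0)
  end.

Definition network (r_gt0 : (0 < r)%N) w x : R :=
  \sum_(k < K) wt w (outer k) * neuron w x k L.-1 (Ordinal r_gt0).

End network.

(** Gradient descent *)

Section descent.
Context {R : realType}.

Definition grad N (F : 'rV[R]_N -> R) (w : 'rV[R]_N) : 'rV[R]_N :=
  \row_i 'D_(delta_mx 0 i) F w.

Fixpoint descent N (F : 'rV[R]_N -> R) (lam : R) (w0 : 'rV[R]_N) (t : nat) :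
    'rV[R]_N :=
  match t with
  | 0 => w0
  | t'.+1 => let w := descent F lam w0 t' in w - lam *: grad F w
  end.

End descent.

Section estimate.
Context {R : realType} {d L r K : nat} (r_gt0 : (0 < r)%N).
(* The data points are x i, y i for i = 1..n. *)
Variables (n : nat) (x : nat -> d.-tuple R) (y : nat -> R).
Variables (c8 c9 : R) (tmin : nat) (w0 : wvec R d L r K).

Definition emp_risk (w : wvec R d L r K) : R :=
  n%:R^-1 * \sum_(1 <= i < n.+1) `|network r_gt0 w (x i) - y i| ^+ 2.

Definition tcand (i : nat) : nat := (2 ^ i * tmin)%N.

Definition stepsize (i : nat) : R := (tcand i)%:R^-1.

Definition nsteps (i : nat) : nat :=
  minn (tcand i) `|Num.ceil ((ln (n%:R : R)) `^ c8 * K%:R ^+ 3)|%N.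

Definition iterate (i t : nat) : wvec R d L r K :=
  descent emp_risk (stepsize i) w0 t.

Definition stop (i : nat) : Prop :=
  let t_n := nsteps i in
  [/\ t_n%:R^-1 * (\sum_(0 <= t < t_n)
          stepsize i * enorm (grad emp_risk (iterate i t) 0) ^+ 2) <= c9 / n%:R,
      emp_risk (iterate i t_n) <=
        t_n%:R^-1 * (\sum_(0 <= t < t_n) emp_risk (iterate i t)) + c9 / n%:R
    & \big[Num.max/0]_(1 <= t < t_n.+1) enorm ((w0 - iterate i t) 0) ^+ 2
        <= c9 * ln n%:R / n%:R]
  \/ n%:R * (ln n%:R) `^ c8 * K%:R ^+ 3 <= (tcand i)%:R.

(* The default 0 is irrelevant: see [stop_ex]. *)
Definition stop_index : nat :=
  xget 0%N [set i | stop i /\ forall j, (j < i)%N -> ~ stop j].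

Definition final_weights : wvec R d L r K :=
  iterate stop_index (nsteps stop_index).

Definition estimator (beta : R) (z : d.-tuple R) : R :=
  truncate beta (network r_gt0 final_weights z).

Lemma stop_ex : (0 < tmin)%N ->
  stop stop_index /\ forall j, (j < stop_index)%N -> ~ stop j.
Proof.
move=> t0; suff [i si] : exists i, stop i.
  have ex : exists j, `[< stop j >] by exists i; exact/asboolP.
  apply: (@xgetPex _ 0%N [set i | stop i /\ forall j, (j < i)%N -> ~ stop j]).
  exists (ex_minn ex); case: ex_minnP => m /asboolP sm mmin; split => // j jm.
  by move=> /asboolP /mmin; rewrite leqNgt jm.
set b := n%:R * (ln n%:R) `^ c8 * K%:R ^+ 3 : R.
have b0 : 0 <= b by rewrite !mulr_ge0 ?exprn_ge0 ?powR_ge0.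
exists (Num.bound b); right; rewrite -/b.
apply: (le_trans (ltW (archi_boundP b0))); rewrite ler_nat /tcand.
by rewrite (leq_trans (ltnW (ltn_expl _ (ltnSn 1))))// leq_pmulr.
Qed.

End estimate.

(** Probability *)

Section probability.
Context {R : realType} {disp : measure_display} {T : measurableType disp}.
Variable P : probability T R.

(* G is a family of set systems indexed by J; the product rule is required for
   every finite subfamily. *)
Definition mutually_independent (J : choiceType) (G : J -> set_system T) :
    Prop :=
  forall (S : {fset J}) (E : J -> set T),
    (forall j, j \in S -> G j (E j)) ->
    P (\bigcap_(j in [set` S]) E j) = (\prod_(j <- S) P (E j))%E.

Definition uniformly_distributed (a b : R) (X : {RV P >-> R}) : Prop :=
  exists ab : a < b,
    forall S, measurable S -> distribution P X S = uniform_prob ab S.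

Definition identically_distributed disp' (U : measurableType disp')
    (Z Z' : T -> U) : Prop :=
  forall S, measurable S -> P (Z @^-1` S) = P (Z' @^-1` S).

Definition rv_support d (X : {RV P >-> d.-tuple R}) : set (d.-tuple R) :=
  [set x | forall e : R, 0 < e ->
     (0 < distribution P X
            [set y | (enorm (fun j => tnth y j - tnth x j) < e)%R])%E].

Definition bounded_tuples d (S : set (d.-tuple R)) : Prop :=
  exists M : R, forall x, S x -> enorm (tnth x) <= M.

(* m is a version of x |-> E(Y | X = x). *)
Definition regression_function d (X : {RV P >-> d.-tuple R})
    (Y : {RV P >-> R}) (m : d.-tuple R -> R) : Prop :=
  [/\ measurable_fun setT m,
      (distribution P X).-integrable setT (EFin \o m)
    & forall S, measurable S ->
        (\int[distribution P X]_(x in S) (m x)%:E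
         = \int[P]_(t in X @^-1` S) (Y t)%:E)%E].

(* Set systems generated by the pairs (X i, Y i), i in nat, and by the
   individual random weights W a. *)
Definition data_and_weights_systems d (X : nat -> {RV P >-> d.-tuple R})
    (Y : nat -> {RV P >-> R}) (A : finType) (W : A -> {RV P >-> R})
    (j : nat + A) : set_system T :=
  match j with
  | inl i => preimage_set_system setT (fun t => (X i t, Y i t)) measurable
  | inr a => preimage_set_system setT (W a) measurable
  end.

Definition random_wvec d L r K (W : widx d L r K -> {RV P >-> R}) (t : T) :
    wvec R d L r K := \row_i W (enum_val i) t.

Definition initial_distribution d L r K (A B : R)
    (W : widx d L r K -> {RV P >-> R}) : Prop :=
  [/\ forall k t, W (outer k) t = 0,
      forall l k i j, uniformly_distributed (- B) B (W (hidden l k i j))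
    & forall k i j, uniformly_distributed (- A) A (W (inner k i j))].

(* Integrated squared distance with respect to the distribution of X. *)
Definition L2_risk d (X : {RV P >-> d.-tuple R}) (f m : d.-tuple R -> R) :
    \bar R :=
  (\int[distribution P X]_x (`|f x - m x| ^+ 2)%:E)%E.

End probability.

(* Main.v *)
(* The empirical risk is convex in the outer weights, and the inner weights
   hardly move: either the three stopping conditions hold, or the stepsize is at
   most 1 / (n (log n)^c8 K^3) and the whole path is short. In both cases the
   empirical risk of the final network exceeds that of any network with weights
   within 2/n of the initial ones by at most a polylogarithmic factor over n.

   Empirical and true risk are compared by a union bound with exponential
   moments, in which the variance of the excess risk is controlled by its mean,
   over a finite class that is 1/n-close to all truncated networks with bounded
   weights. On cubes of side of order 1 / (A B^(L-1) n^a), with a > 0 small, the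
   Taylor expansion of sigma turns such a network into a polynomial of fixed
   degree, so the logarithm of the cardinality is of order
   A^d B^((L-1)d) n^(a(d+1)).

   The near minimizer around the random initial weights is chosen as one fixed
   weight vector on each cell of a finite partition of the weight space; it is
   thus independent of the data, and its cross term with the noise vanishes in
   expectation. *)

Require Import Defs.
From HB Require Import structures.
From mathcomp Require Import all_boot all_order all_algebra.
From mathcomp Require Import finmap ring lra.
From mathcomp Require Import all_classical all_reals all_analysis measurable_realfun.

Set Implicit Arguments.
Unset Strict Implicit.
Unset Printing Implicit Defensive.

Import Order.TTheory GRing.Theory Num.Theory.
Import numFieldNormedType.Exports.

Local Open Scope classical_set_scope.
Local Open Scope ring_scope.

(** * Taylor expansion of the logistic function *)

(** [K] may grow like any power of [n], so a cover counted in weights would be far too large. The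
    cover is therefore counted in cells of the input space, and the network size enters only through
    the range of the coefficients, hence under a logarithm. The order [p] of the expansion depends
    on the power of [n] that bounds [K], so that [K] times the Taylor remainder stays below [1/n].

    All constants and logarithms are dominated by one quantity [x = n^a]. The remainder is at most a
    constant times [A^d B^((L-1)d) x^(d+8) / n], and [a] is so small that [x^(d+8) <= n^eps].

    The responses are unbounded. Losses are cut off at [|Y| <= beta]; the exponential moment makes
    the tail so small that even an error of order [n] off this event costs only order [1/n].

    Neither the estimate nor the infimum over weights is shown to be measurable. Both are handled by
    monotonicity of the integral of arbitrary nonnegative functions: the risk lies below a
    measurable bound valid for every outcome, and the infimum lies above a function that is constant
    on each cell of the weight space. *)

Section sigmoid_theory.
Context {R : realType}.
Implicit Types (x v s : R) (q : {poly R}).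

Lemma sigmoid_gt0 x : 0 < sigmoid x.
Proof. by rewrite /sigmoid invr_gt0 ltr_pwDl// expR_ge0. Qed.

Lemma sigmoid_lt1 x : sigmoid x < 1.
Proof.
by rewrite /sigmoid invf_lt1 ?ltrDl ?expR_gt0// ltr_pwDl// expR_ge0.
Qed.

Lemma norm_sigmoid_le1 x : `|sigmoid x| <= 1.
Proof. by rewrite ger0_norm ?ltW ?sigmoid_gt0 ?sigmoid_lt1. Qed.

Lemma is_derive_sigmoid x :
  is_derive x 1 (@sigmoid R) (sigmoid x * (1 - sigmoid x)).
Proof.
have e0 : 1 + expR (- x) != 0 by rewrite gt_eqF// ltr_pwDl// expR_ge0.
have D0 : is_derive x 1 (expR \o -%R : R -> R) (expR (- x) * (-1)).
  exact: is_derive1_comp.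
have D1 : is_derive x 1 (cst 1 + (expR \o -%R) : R -> R) (- expR (- x)).
  by apply: is_derive_eq; rewrite add0r mulrN1.
have -> : @sigmoid R = (fun y => ((cst 1 + (expR \o -%R)) y)^-1).
  by apply/funext => y.
have [d1 _] := D1.
apply: DeriveDef; first exact: derivableV.
rewrite deriveV//.
rewrite derive_val /GRing.scale/= !fctE/= /sigmoid; field.
by rewrite e0.
Qed.

Lemma is_derive_horner_sigmoid q x :
  is_derive x 1 (horner q \o @sigmoid R) ((q^`() * ('X - 'X^2)).[sigmoid x]).
Proof.
have Ds := is_derive_sigmoid x.
apply: is_derive_eq.
by rewrite !hornerE /=; ring.
Qed.

(* By induction on [p], since the derivative of [q.[sigmoid x]] is again a
   polynomial in [sigmoid x]. *)
Lemma taylor_horner_sigmoid p q : exists C, 0 <= C /\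
  forall v, exists a : nat -> R,
    [/\ a 0%N = if p is 0 then 0 else q.[sigmoid v],
        forall k, `|a k| <= C
      & forall s, `|q.[sigmoid (v + s)] - \sum_(k < p) a k * s ^+ k|
                  <= C * `|s| ^+ p].
Proof.
have hor_le q' y : `|q'.[sigmoid y]| <= \sum_(i < size q') `|q'`_i|.
  rewrite horner_coef (le_trans (ler_norm_sum _ _ _))//.
  apply: ler_sum => i _; rewrite normrM ler_piMr// normrX exprn_ile1//.
  exact: norm_sigmoid_le1.
elim: p q => [|p IH] q.
  exists (\sum_(i < size q) `|q`_i|); split; first exact: sumr_ge0.
  move=> v; exists (fun=> 0); split => // [k|s].
    by rewrite normr0 sumr_ge0.
  by rewrite big_ord0 subr0 expr0 mulr1.
have [C [C0 HC]] := IH (q^`() * ('X - 'X^2)).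
set C' := C + \sum_(i < size q) `|q`_i|.
have S0 : 0 <= \sum_(i < size q) `|q`_i| by exact: sumr_ge0.
exists C'; split; first exact: addr_ge0.
move=> v; have [a [a0 aC aT]] := HC v.
(* Termwise integration: the induction hypothesis expands the derivative of [q.[sigmoid (v + s)]] in
   [s], so its coefficients are divided by [k + 1], and the constant term is the value at
   [s = 0]. *)
pose b k := if k is k'.+1 then a k' / k'.+1%:R else q.[sigmoid v].
exists b; split => //= [[|k]|s] /=.
- by rewrite /C' (le_trans (hor_le _ _))// lerDr.
- rewrite normrM normfV normr_nat ler_pdivrMr ?ltr0n//.
  rewrite (le_trans (aC k))// /C' (@le_trans _ _ (C * k.+1%:R))//.
    by rewrite ler_peMr// ler1n.
  by rewrite ler_wpM2r ?ler0n// lerDl.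
pose B : {poly R} := \poly_(k < p.+1) b k.
(* [h] is the remainder. It vanishes at 0 and its derivative is the remainder of order [p], so the
   mean value theorem adds one power of [|s|]. *)
pose h : R -> R := (horner q \o @sigmoid R) \o (cst v + id) - horner B.
have BE (x : R) : B.[x] = \sum_(k < p.+1) b k * x ^+ k by rewrite horner_poly.
have B'E (x : R) : B^`().[x] = \sum_(k < p) a k * x ^+ k.
  rewrite (@horner_coef_wide _ p).
    apply: eq_bigr => i _; rewrite coef_deriv coef_poly ltnS ltn_ord /=.
    by congr (_ * _); rewrite -[X in X = _]mulr_natr divfK// pnatr_eq0.
  apply/leq_sizeP => j pj.
  by rewrite coef_deriv coef_poly ltnS ltnNge pj mul0rn.
have dh x : is_derive x 1 h
    ((q^`() * ('X - 'X^2)).[sigmoid (v + x)] - B^`().[x]).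
  have D2 := is_derive_horner_sigmoid q (v + x).
  have D3 : is_derive x 1 (cst v + id : R -> R) 1.
    by apply: is_derive_eq; rewrite add0r.
  have D4 : is_derive x 1 ((horner q \o @sigmoid R) \o (cst v + id) : R -> R)
     ((q^`() * ('X - 'X^2)).[sigmoid (v + x)] * 1).
    exact: is_derive1_comp.
  by apply: is_derive_eq; rewrite mulr1.
have dh_le x : `|(q^`() * ('X - 'X^2)).[sigmoid (v + x)] - B^`().[x]|
    <= C * `|x| ^+ p by rewrite B'E; exact: aT.
have ch (x y : R) : {within `[x, y], continuous h}.
  apply: derivable_within_continuous => z _.
  by have [] := dh z.
have h0 : h 0 = 0.
  rewrite /h !fctE /= addr0 BE big_ord_recl /= expr0 mulr1 big1 ?addr0 ?subrr//.
  by move=> i _; rewrite /bump/= exprS mul0r mulr0.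
suff : `|h s| <= C * `|s| ^+ p.+1.
  rewrite -BE /h !fctE /= => /le_trans; apply.
  by rewrite ler_wpM2r ?exprn_ge0// lerDl.
have [s0|s0] := leP 0 s.
  have [c cs] := MVT_segment s0 (fun x _ => dh x) (ch _ _).
  rewrite h0 !subr0 => ->; rewrite normrM [in leRHS]exprSr mulrA ler_wpM2r//.
  rewrite (le_trans (dh_le c))// ler_wpM2l// lerXn2r ?nnegrE//.
  by rewrite in_itv /= in cs; case/andP: cs => c0 cs; rewrite !ger0_norm.
have [c cs] := MVT_segment (ltW s0) (fun x _ => dh x) (ch _ _).
rewrite h0 !sub0r => /(congr1 Num.norm); rewrite normrN => ->.
rewrite normrM normrN [in leRHS]exprSr mulrA ler_wpM2r//.
rewrite (le_trans (dh_le c))// ler_wpM2l// lerXn2r ?nnegrE//.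
rewrite in_itv /= in cs; case/andP: cs => c0 cs.
by rewrite (ler0_norm cs) (ler0_norm (ltW s0)) lerN2.
Qed.

(** The constant depends on [p] only and not on the expansion point [v], since the coefficients are
    fixed polynomials evaluated at [sigmoid v], which lies between 0 and 1. It is enlarged to be at
    least 1 so that later products with it never shrink. *)
Lemma taylor_sigmoid p : exists C, 1 <= C /\
  forall v, exists a : nat -> R,
    [/\ a 0%N = sigmoid v, forall k, `|a k| <= C
      & forall s, `|sigmoid (v + s) - \sum_(k < p.+1) a k * s ^+ k|
                  <= C * `|s| ^+ p.+1].
Proof.
have [C [C0 HC]] := taylor_horner_sigmoid p.+1 'X.
exists (1 + C); split; first by rewrite lerDl.
move=> v; have [a []] := HC v; rewrite hornerX => a0 aC aT.
exists a; split => // [k|s]; first by rewrite (le_trans (aC k))// lerDr.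
have := aT s; rewrite hornerX => /le_trans; apply.
by rewrite ler_wpM2r ?exprn_ge0// lerDr.
Qed.

Lemma sigmoid_lipschitz x y : `|sigmoid x - sigmoid y| <= `|x - y|.
Proof.
wlog xy : x y / x <= y.
  move=> H; have [/H//|/ltW/H] := leP x y.
  by rewrite distrC => /le_trans; apply; rewrite distrC.
have ch : {within `[x, y], continuous (@sigmoid R)}.
  apply: derivable_within_continuous => z _.
  by have [] := is_derive_sigmoid z.
have [c _ H] := MVT_segment xy (fun z _ => is_derive_sigmoid z) ch.
rewrite distrC H normrM distrC ler_piMl// ger0_norm.
  have := sigmoid_gt0 c; have := sigmoid_lt1 c; nra.
have := sigmoid_gt0 c; have := sigmoid_lt1 c; nra.
Qed.

Lemma measurable_sigmoid : measurable_fun setT (@sigmoid R).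
Proof.
apply: continuous_measurable_fun => x.
apply: differentiable_continuous; apply/derivable1_diffP.
by have [] := is_derive_sigmoid x.
Qed.

End sigmoid_theory.

(** * Local polynomial approximation of networks *)

Section word_polynomials.
Context {R : realType} {d : nat}.
Implicit Types (u : 'I_d -> R) (s : seq (R * seq 'I_d)) (f g : ('I_d -> R) -> R).

(* Polynomials in [d] variables as formal sums of (repeated, non-commutative)
   words, which makes products a mere concatenation. *)
Definition weval s u : R := \sum_(m <- s) m.1 * \prod_(i <- m.2) u i.

(** [c] bounds the l1 norm of the coefficients. This norm is subadditive and submultiplicative, and
    it dominates every single coefficient as well as the supremum over the cube where all
    [|u i| <= 1]. *)
Definition wpoly (D : nat) (c : R) f : Prop :=
  exists s, [/\ all (fun m => size m.2 <= D)%N s, \sum_(m <- s) `|m.1| <= c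
            & forall u, f u = weval s u].

Lemma wpoly_ge0 D c f : wpoly D c f -> 0 <= c.
Proof. by move=> [s [_ + _]]; apply: le_trans; exact: sumr_ge0. Qed.

Lemma wpoly_le D D' c c' f : (D <= D')%N -> c <= c' ->
  wpoly D c f -> wpoly D' c' f.
Proof.
move=> DD cc [s [sD sc sE]]; exists s; split => //; last exact: le_trans cc.
by apply: sub_all sD => m /leq_trans; apply.
Qed.

Lemma wpoly_cst D a : wpoly D `|a| (fun=> a).
Proof.
exists [:: (a, [::])]; split => //=; first by rewrite big_seq1.
by move=> u; rewrite /weval big_seq1 big_nil mulr1.
Qed.

Lemma wpoly_var i : wpoly 1 1 (fun u => u i).
Proof.
exists [:: (1, [:: i])]; split => //=; first by rewrite big_seq1 normr1.
by move=> u; rewrite /weval big_seq1 big_seq1 mul1r.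
Qed.

Lemma wpolyD D c c' f g :
  wpoly D c f -> wpoly D c' g -> wpoly D (c + c') (fun u => f u + g u).
Proof.
move=> [s [sD sc sE]] [t [tD tc tE]]; exists (s ++ t); split.
- by rewrite all_cat sD tD.
- by rewrite big_cat /= lerD.
- by move=> u; rewrite /weval big_cat /= sE tE.
Qed.

Lemma wpolyZ D c f a : wpoly D c f -> wpoly D (`|a| * c) (fun u => a * f u).
Proof.
move=> [s [sD sc sE]]; exists [seq (a * m.1, m.2) | m <- s]; split.
- by rewrite all_map.
- rewrite big_map /=; under eq_bigr do rewrite normrM.
  by rewrite -mulr_sumr ler_wpM2l.
- move=> u; rewrite /weval big_map /= sE mulr_sumr.
  by apply: eq_bigr => m _; rewrite mulrA.
Qed.

Lemma wpolyM D D' c c' f g : wpoly D c f -> wpoly D' c' g ->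
  wpoly (D + D') (c * c') (fun u => f u * g u).
Proof.
move=> [s [sD sc sE]] [t [tD tc tE]].
exists [seq (m.1 * m'.1, m.2 ++ m'.2) | m <- s, m' <- t]; split.
- apply/allP => m /allpairsP[[m1 m2] /= [/(allP sD) h1 /(allP tD) h2 ->]] /=.
  by rewrite size_cat leq_add.
- rewrite big_allpairs_dep /=.
  under eq_bigr do under eq_bigr do rewrite normrM.
  under eq_bigr do rewrite -mulr_sumr.
  by rewrite -mulr_suml ler_pM// sumr_ge0.
- move=> u; rewrite sE tE /weval big_allpairs_dep mulr_suml /=.
  apply: eq_bigr => m _; rewrite mulr_sumr; apply: eq_bigr => m' _.
  by rewrite big_cat /= mulrACA.
Qed.

Lemma wpolyX D c f n : wpoly D c f -> wpoly (n * D) (c ^+ n) (fun u => f u ^+ n).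
Proof.
move=> fD; elim: n => [|n IH].
  by have := wpoly_cst (0 * D) 1; rewrite normr1 expr0.
rewrite mulSn exprS.
have [s [sD sc sE]] := wpolyM fD IH.
by exists s; split => // u; rewrite exprS sE.
Qed.

Lemma wpoly_sum (I : Type) (r : seq I) (P : pred I) D (c : I -> R)
    (F : I -> ('I_d -> R) -> R) : (forall i, P i -> wpoly D (c i) (F i)) ->
  wpoly D (\sum_(i <- r | P i) c i) (fun u => \sum_(i <- r | P i) F i u).
Proof.
move=> H; elim: r => [|i r IH].
  exists [::]; rewrite !big_nil; split => // u.
  by rewrite /weval !big_nil.
rewrite big_cons; case: ifPn => Pi; last first.
  have [s [sD sc sE]] := IH.
  by exists s; split => // u; rewrite big_cons (negbTE Pi).
have [s [sD sc sE]] := wpolyD (H _ Pi) IH.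
by exists s; split => // u; rewrite big_cons Pi.
Qed.

Lemma wpoly_norm_le D c f u : (forall i, `|u i| <= 1) -> wpoly D c f ->
  `|f u| <= c.
Proof.
move=> u1 [s [_ sc ->]]; rewrite (le_trans (ler_norm_sum _ _ _))//.
rewrite (le_trans _ sc)//; apply: ler_sum => m _.
rewrite normrM ler_piMr// normr_prod; apply: prodr_ile1 => i _.
by rewrite normr_ge0 u1.
Qed.

(* The constant term is left out so that the size of the increment is kept. *)
Lemma wpoly_comp_increment D c f p (a : nat -> R) C : c <= 1 ->
  (forall k, `|a k| <= C) -> wpoly D c f ->
  wpoly (p * D) (p%:R * C * c) (fun u => \sum_(k < p) a k.+1 * f u ^+ k.+1).
Proof.
move=> c1 aC fD; have c0 := wpoly_ge0 fD.
have C0 : 0 <= C by rewrite (le_trans _ (aC 0%N)).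
have -> : p%:R * C * c = \sum_(k < p) C * c.
  by rewrite sumr_const card_ord -[RHS]mulr_natl mulrA.
apply: wpoly_sum => k _.
apply: (@wpoly_le (k.+1 * D)%N _ (`|a k.+1| * c ^+ k.+1)).
- by rewrite leq_mul2r ltn_ord orbT.
- rewrite ler_pM// ?exprn_ge0// exprS ler_piMr// exprn_ile1//.
- by apply: wpolyZ; exact: wpolyX.
Qed.

(* Collecting equal words. *)
Lemma wpoly_bseq D c f : wpoly D c f ->
  exists a : {bseq D of 'I_d} -> R, (forall b, `|a b| <= c) /\
    forall u, f u = \sum_b a b * \prod_(i <- b) u i.
Proof.
move=> [s [sD sc sE]].
exists (fun b : {bseq D of 'I_d} => \sum_(m <- s | m.2 == b :> seq _) m.1); split.
  move=> b; rewrite (le_trans (ler_norm_sum _ _ _))// (le_trans _ sc)//.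
  rewrite big_mkcond /=; apply: ler_sum => m _; case: ifP => //.
move=> u; rewrite sE /weval.
under [RHS]eq_bigr do rewrite mulr_suml big_mkcond /=.
rewrite exchange_big /= big_seq [RHS]big_seq; apply: eq_bigr => m ms.
have mD := allP sD _ ms.
rewrite (bigD1 (Bseq mD))//= eqxx [X in _ = _ + X]big1 ?addr0// => b bm.
by rewrite ifN// eq_sym.
Qed.

End word_polynomials.

Section neuron_local.
Context {R : realType} {d L r K : nat}.
Implicit Types (w : wvec R d L r K) (x y : d.-tuple R).

Definition inner_le (A : R) w := forall k i j, `|wt w (inner k i j)| <= A.
Definition hidden_le (B : R) w := forall l k i j, `|wt w (hidden l k i j)| <= B.

Lemma norm_neuron_le1 w x k l i : `|neuron w x k l i| <= 1.
Proof. by case: l => [|l] /=; exact: norm_sigmoid_le1. Qed.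

Lemma norm_whid_le B w : 0 <= B -> hidden_le B w ->
  forall l k i j, `|whid w l k i j| <= B.
Proof.
move=> B0 wB l k i j; rewrite /whid; case: insub => [l'|]; first exact: wB.
by rewrite normr0.
Qed.

Variables (p : nat) (C : R).
Hypothesis C1 : 1 <= C.
Hypothesis taylorC : forall v, exists a : nat -> R,
    [/\ a 0%N = sigmoid v, forall k, `|a k| <= C
      & forall s, `|sigmoid (v + s) - \sum_(k < p.+1) a k * s ^+ k|
                  <= C * `|s| ^+ p.+1].

(** Induction over the levels on the increment of a neuron from its value at [x0]. Up to the
    accumulated error, the weighted increments of the previous level form a polynomial [s] of size
    at most [eta]; expanding the next [sigmoid] around its argument at [x0] costs [C * eta ^+ p.+1],
    and leaving out the constant term keeps the new increment small. Each level multiplies the size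
    by [r * B * p * C] and the error by at most [1 + r * B]. *)
Lemma neuron_local (A B h eta : R) w x0 k l i :
  0 <= A -> 1 <= B -> inner_le A w -> hidden_le B w -> 0 <= h ->
  (0 < p)%N -> (0 < r)%N -> eta <= 1 ->
  (r%:R * B * (p%:R * C)) ^+ l * (d%:R * A * h) <= eta ->
  exists Q, wpoly (p ^ l.+1)
     (p%:R * C * ((r%:R * B * (p%:R * C)) ^+ l * (d%:R * A * h))) Q /\
    forall u x, (forall j, `|u j| <= 1) ->
      (forall j, tnth x j = tnth x0 j + h * u j) ->
      `|neuron w x k l i - neuron w x0 k l i - Q u|
        <= C * (1 + r%:R * B) ^+ l * eta ^+ p.+1.
Proof.
move=> A0 B1 wA wB h0 p0 r0 eta1.
have C0 : 0 <= C by rewrite (le_trans _ C1).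
have B0 : 0 <= B by rewrite (le_trans _ B1).
have rB1 : 1 <= r%:R * B by rewrite mulr_ege1// ler1n.
have g1 : 1 <= r%:R * B * (p%:R * C).
  by rewrite !mulr_ege1// ler1n.
set g := _ * _ * (_ * _) in g1 *.
have s0 : 0 <= d%:R * A * h by rewrite !mulr_ge0.
elim: l i => [|l IH] i; rewrite ?expr0 ?mul1r => le_eta.
  set v := \sum_(j < d) wt w (inner k i (lift ord0 j)) * tnth x0 j
           + wt w (inner k i ord0).
  have [a [a0 aC aT]] := taylorC v.
  pose s u := \sum_(j < d) (wt w (inner k i (lift ord0 j)) * h) * u j.
  have sP : wpoly 1 (d%:R * A * h) s.
    have -> : d%:R * A * h = \sum_(j < d) A * h.
      by rewrite sumr_const card_ord -[RHS]mulr_natl mulrA.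
    apply: wpoly_sum => j _.
    apply: (@wpoly_le _ _ 1 1 (`|wt w (inner k i (lift ord0 j)) * h| * 1)) => //.
      by rewrite mulr1 normrM (ger0_norm h0) ler_wpM2r.
    by apply: wpolyZ; exact: wpoly_var.
  exists (fun u => \sum_(k < p) a k.+1 * s u ^+ k.+1); split.
    rewrite expn1 -[X in wpoly X]muln1.
    apply: wpoly_comp_increment => //; exact: le_trans eta1.
  move=> u x u1 xE.
  have sE : \sum_(j < d) wt w (inner k i (lift ord0 j)) * tnth x j
           + wt w (inner k i ord0) = v + s u.
    rewrite /v /s addrAC -big_split /=; congr (_ + _); apply: eq_bigr => j _.
    by rewrite xE mulrDr mulrA.
  rewrite /= sE -/v -a0; have := aT (s u).
  rewrite big_ord_recl /= expr0 mulr1 mulr1 opprD addrA => /le_trans; apply.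
  rewrite ler_wpM2l// lerXn2r ?nnegrE//; first exact: le_trans le_eta.
  by rewrite (le_trans _ le_eta)// (wpoly_norm_le u1 sP).
have ge0 : 0 <= eta by rewrite (le_trans _ le_eta)// mulr_ge0// exprn_ge0// (le_trans _ g1).
have le_eta' : g ^+ l * (d%:R * A * h) <= eta.
  by rewrite (le_trans _ le_eta)// ler_wpM2r// exprS ler_peMl// exprn_ge0// (le_trans _ g1).
pose c := p%:R * C * (g ^+ l * (d%:R * A * h)).
have /choice[Q HQ] : forall j, exists Q, wpoly (p ^ l.+1) c Q /\
    forall u x, (forall j, `|u j| <= 1) ->
      (forall j, tnth x j = tnth x0 j + h * u j) ->
      `|neuron w x k l j - neuron w x0 k l j - Q u|
        <= C * (1 + r%:R * B) ^+ l * eta ^+ p.+1.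
  by move=> j; exact: IH.
set v := \sum_(j < r) whid w l k i (lift ord0 j) * neuron w x0 k l j
         + whid w l k i ord0.
have [a [a0 aC aT]] := taylorC v.
pose s u := \sum_(j < r) whid w l k i (lift ord0 j) * Q j u.
have wB' := norm_whid_le B0 wB.
have cE : g ^+ l.+1 * (d%:R * A * h) = r%:R * B * c.
  by rewrite exprS /c /g; ring.
have c0 : 0 <= c by exact: (wpoly_ge0 (HQ i).1).
have sP : wpoly (p ^ l.+1) (g ^+ l.+1 * (d%:R * A * h)) s.
  have -> : g ^+ l.+1 * (d%:R * A * h) = \sum_(j < r) B * c.
    by rewrite cE sumr_const card_ord -[RHS]mulr_natl mulrA.
  apply: wpoly_sum => j _.
  apply: (@wpoly_le _ _ (p ^ l.+1) _ (`|whid w l k i (lift ord0 j)| * c)) => //.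
    by rewrite ler_wpM2r.
  by apply: wpolyZ; have [] := HQ j.
exists (fun u => \sum_(k < p) a k.+1 * s u ^+ k.+1); split.
  by rewrite expnS; apply: wpoly_comp_increment => //; exact: le_trans eta1.
move=> u x u1 xE /=.
set E := C * (1 + r%:R * B) ^+ l * eta ^+ p.+1 in HQ *.
set v' := \sum_(j < r) whid w l k i (lift ord0 j) * neuron w x k l j
         + whid w l k i ord0.
have vv : `|v' - (v + s u)| <= r%:R * B * E.
  have -> : v' - (v + s u) = \sum_(j < r) whid w l k i (lift ord0 j) *
      (neuron w x k l j - neuron w x0 k l j - Q j u).
    under eq_bigr do rewrite !mulrBr.
    by rewrite !sumrB /v' /v /s; ring.
  rewrite (le_trans (ler_norm_sum _ _ _))//.
  have -> : r%:R * B * E = \sum_(j < r) B * E.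
    by rewrite sumr_const card_ord -[RHS]mulr_natl mulrA.
  apply: ler_sum => j _; rewrite normrM ler_pM//.
  by have [_ H] := HQ j; exact: H.
rewrite -/v.
set S := \sum_(k < p) _.
have -> : sigmoid v' - sigmoid v - S =
  (sigmoid v' - sigmoid (v + s u)) +
  (sigmoid (v + s u) - \sum_(k < p.+1) a k * s u ^+ k).
  by rewrite big_ord_recl /= expr0 mulr1 a0 /S; ring.
rewrite (le_trans (ler_normD _ _))//.
rewrite (@le_trans _ _ (r%:R * B * E + C * eta ^+ p.+1))//.
  rewrite lerD//; first exact: le_trans (sigmoid_lipschitz _ _) _.
  apply: (le_trans (aT _)); rewrite ler_wpM2l// lerXn2r ?nnegrE//.
  by rewrite (le_trans _ le_eta)// (wpoly_norm_le u1 sP).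
have -> : C * (1 + r%:R * B) ^+ l.+1 * eta ^+ p.+1 = r%:R * B * E + E.
  by rewrite /E exprS; ring.
rewrite lerD2l /E -mulrA ler_wpM2l// ler_peMl ?exprn_ge0//.
by rewrite exprn_ege1// lerDl (le_trans _ rB1).
Qed.

Lemma network_local (A B h eta : R) w x0 (r0 : (0 < r)%N) :
  0 <= A -> 1 <= B -> inner_le A w -> hidden_le B w -> 0 <= h ->
  (0 < p)%N -> eta <= 1 ->
  (r%:R * B * (p%:R * C)) ^+ L.-1 * (d%:R * A * h) <= eta ->
  exists Q, wpoly (p ^ L.-1.+1)
     ((\sum_k `|wt w (outer k)|) * (1 + p%:R * C)) Q /\
    forall u x, (forall j, `|u j| <= 1) ->
      (forall j, tnth x j = tnth x0 j + h * u j) ->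
      `|network r0 w x - Q u| <= (\sum_k `|wt w (outer k)|) *
           (C * (1 + r%:R * B) ^+ L.-1 * eta ^+ p.+1).
Proof.
move=> A0 B1 wA wB h0 p0 eta1 le_eta.
have C0 : 0 <= C by rewrite (le_trans _ C1).
have /choice[Q HQ] := fun k => neuron_local x0 k (Ordinal r0) A0 B1 wA wB h0 p0 r0
  eta1 le_eta.
exists (fun u => \sum_k wt w (outer k) *
  (neuron w x0 k L.-1 (Ordinal r0) + Q k u)); split.
  rewrite mulr_suml; apply: wpoly_sum => k _; apply: wpolyZ; apply: wpolyD.
    apply: wpoly_le; last exact: wpoly_cst.
      exact: leqnn.
    exact: norm_neuron_le1.
  have [+ _] := HQ k; apply: wpoly_le => //.
  by rewrite ler_piMr ?mulr_ge0// (le_trans le_eta).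
move=> u x u1 xE; rewrite /network -sumrB (le_trans (ler_norm_sum _ _ _))//.
rewrite mulr_suml; apply: ler_sum => k _.
rewrite -mulrBr normrM ler_wpM2l// opprD addrA.
by have [_ H] := HQ k; exact: H.
Qed.

End neuron_local.

Section truncate_theory.
Context {R : realType}.
Implicit Types b y z : R.

Lemma truncate_le b z : 0 <= b -> `|truncate b z| <= b.
Proof.
move=> b0; rewrite /truncate ler_norml le_max lexx orbT /= ge_max.
by rewrite ge_min lexx orbT /= lerNl (le_trans _ b0)// oppr_le0.
Qed.

Lemma truncate_id b z : `|z| <= b -> truncate b z = z.
Proof.
by rewrite ler_norml => /andP[bz zb]; rewrite /truncate (min_idPl zb) (max_idPl bz).
Qed.

Lemma truncate_lipschitz b y z : `|truncate b y - truncate b z| <= `|y - z|.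
Proof.
wlog yz : y z / y <= z.
  move=> H; have [/H//|/ltW/H] := leP y z.
  by rewrite distrC => /le_trans; apply; rewrite distrC.
rewrite distrC (distrC y) [leRHS]ger0_norm ?subr_ge0// ger0_norm.
  rewrite /truncate /Order.max /Order.min.
  by case: ifP; case: ifP; case: ifP; case: ifP => // *; lra.
rewrite /truncate /Order.max /Order.min.
by case: ifP; case: ifP; case: ifP; case: ifP => // *; lra.
Qed.

Lemma measurable_truncate b : measurable_fun setT (@truncate R b).
Proof.
apply: measurable_maxr => //; exact: measurable_minr.
Qed.

End truncate_theory.

Section measurable_network.
Context {R : realType} {d L r K : nat}.
Implicit Types (w : wvec R d L r K) (x y : d.-tuple R).

Lemma measurable_neuron w k l i :
  measurable_fun setT (fun x => neuron w x k l i).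
Proof.
elim: l i => [|l IH] i /=; apply: (measurableT_comp measurable_sigmoid).
  apply: measurable_funD => //; apply: measurable_sum => j.
  by apply: measurable_funM => //; exact: measurable_tnth.
apply: measurable_funD => //; apply: measurable_sum => j.
exact: measurable_funM.
Qed.

Lemma measurable_network (r0 : (0 < r)%N) w :
  measurable_fun setT (network r0 w).
Proof.
apply: measurable_sum => k; apply: measurable_funM => //.
exact: measurable_neuron.
Qed.

End measurable_network.

(** * A finite cover of the truncated networks *)

Section network_cover.
Context {R : realType} {d L r : nat} (r0 : (0 < r)%N).
Implicit Types (x y : d.-tuple R).

Variables (p : nat) (C : R).
Hypothesis p0 : (0 < p)%N.
Hypothesis C1 : 1 <= C.
Hypothesis taylorC : forall v : R, exists a : nat -> R,
    [/\ a 0%N = sigmoid v, forall k, `|a k| <= C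
      & forall s, `|sigmoid (v + s) - \sum_(k < p.+1) a k * s ^+ k|
                  <= C * `|s| ^+ p.+1].

Lemma rounding (J : nat) (tol c : R) : 0 < tol -> `|c| <= tol * J%:R ->
  exists z : 'I_(J.*2.+1), `|c - tol * (z%:R - J%:R)| <= tol.
Proof.
move=> t0 cJ.
have cJ0 : 0 <= (c + tol * J%:R) / tol.
  by rewrite divr_ge0 ?(ltW t0)// -lerBlDr sub0r; case/ler_normlP: cJ; lra.
have /andP[] := Num.Theory.truncn_itv cJ0; set z := Num.truncn _ => z1 z2.
rewrite ler_pdivlMr// in z1; rewrite ltr_pdivrMr// in z2.
have zJ : (z < J.*2.+1)%N.
  rewrite ltnS -(ler_nat R) -(ler_pM2r t0) -addnn natrD.
  by case/ler_normlP: cJ; lra.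
exists (Ordinal zJ) => /=; rewrite -natr1 in z2.
by rewrite ler_norml; apply/andP; split; lra.
Qed.

Section cells.
Variables (rho h : R) (H : nat).
Hypothesis h0 : 0 < h.

(** Half-open, so that a point lies in at most one of these intervals. They subdivide the input
    space here and, coordinate by coordinate, the space of initial weights later. *)
Definition cell (i : nat) : set R :=
  `[- rho + h * 2 * i%:R, - rho + h * 2 * i.+1%:R[%classic.

Definition cell_center (i : nat) : R := - rho + h * (2 * i%:R + 1).

Lemma cell_dist i (y : R) : cell i y -> `|(y - cell_center i) / h| <= 1.
Proof.
rewrite /cell /= in_itv /= -natr1 => /andP[y1 y2].
rewrite normrM normfV (gtr0_norm h0) ler_pdivrMr// mul1r ler_norml /cell_center.
by apply/andP; split; lra.
Qed.

Lemma cell_inj i j (y : R) : cell i y -> cell j y -> i = j.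
Proof.
rewrite /cell /= !in_itv /= => /andP[i1 i2] /andP[j1 j2].
have h2 : 0 < h * 2 by rewrite mulr_gt0.
have le m m' : h * 2 * m%:R < h * 2 * m'.+1%:R -> (m <= m')%N.
  by rewrite ltr_pM2l// ltr_nat.
by apply/eqP; rewrite eqn_leq; apply/andP; split; apply: le; lra.
Qed.

Lemma cell_ex (y : R) : rho < h * H%:R -> `|y| <= rho -> exists i : 'I_H, cell i y.
Proof.
move=> rH yr; have h2 : 0 < h * 2 by rewrite mulr_gt0.
have y0 : 0 <= (y + rho) / (h * 2).
  by rewrite divr_ge0 ?(ltW h2)//; case/ler_normlP: yr; lra.
have /andP[] := Num.Theory.truncn_itv y0; set z := Num.truncn _ => z1 z2.
rewrite ler_pdivlMr// in z1; rewrite ltr_pdivrMr// in z2.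
have zJ : (z < H)%N.
  by rewrite -(ltr_nat R) -(ltr_pM2r h2); case/ler_normlP: yr; lra.
by exists (Ordinal zJ); rewrite /cell /= in_itv /=; apply/andP; split; lra.
Qed.

Lemma measurable_cell i : measurable (cell i).
Proof. exact: measurable_itv. Qed.

End cells.

Let q := #|{: {bseq (p ^ L.-1.+1) of 'I_d}}|.

(* A network is, on each cell, close to a polynomial of fixed degree; the cover
   consists of the truncated piecewise polynomials with rounded coefficients. *)
Lemma network_cover (A B h eta S beta rho tol : R) (H J : nat) :
  0 <= A -> 1 <= B -> 0 < h -> eta <= 1 -> 0 <= beta -> 0 < tol ->
  (r%:R * B * (p%:R * C)) ^+ L.-1 * (d%:R * A * h) <= eta ->
  rho < h * H%:R -> S * (1 + p%:R * C) <= tol * J%:R ->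
  exists (I : finType) (G : I -> d.-tuple R -> R),
    [/\ #|I| = (J.*2.+1 ^ (q * H ^ d))%N,
        forall i, measurable_fun setT (G i),
        forall i x, `|G i x| <= beta
      & forall K (w : wvec R d L r K), inner_le A w -> hidden_le B w ->
        \sum_k `|wt w (outer k)| <= S ->
        exists i, forall x, (forall j, `|tnth x j| <= rho) ->
          `|truncate beta (network r0 w x) - G i x| <=
          S * (C * (1 + r%:R * B) ^+ L.-1 * eta ^+ p.+1) + q%:R * tol].
Proof.
move=> A0 B1 h0 eta1 beta0 tol0 le_eta rH SJ.
have C0 : 0 <= C by rewrite (le_trans _ C1).
have B0 : 0 <= B by rewrite (le_trans _ B1).
have eta0 : 0 <= eta.
  by rewrite (le_trans _ le_eta)// mulr_ge0 ?exprn_ge0 ?mulr_ge0// ltW.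
pose cells := {ffun 'I_d -> 'I_H}; pose words := {bseq (p ^ L.-1.+1) of 'I_d}.
(* One integer for each cell and each word: neither [K] nor the weights enter, and the network size
   is felt only in the range [J] of the integers. *)
pose I := {ffun cells * words -> 'I_(J.*2.+1)}.
pose ind (c : cells) x : R := \prod_(j < d) \1_(cell rho h (c j)) (tnth x j).
pose ctr (c : cells) : d.-tuple R := [tuple cell_center rho h (c j) | j < d].
pose u (c : cells) x j := (tnth x j - cell_center rho h (c j)) / h.
pose G (i : I) x := truncate beta (\sum_c ind c x *
  (\sum_(b : words) tol * ((i (c, b))%:R - J%:R) * \prod_(j <- b) u c x j)).
exists I, G; split => [|i|i x|K w wA wB wS].
- by rewrite card_ffun card_prod card_ord card_ffun !card_ord mulnC.
- apply: (measurableT_comp (measurable_truncate _)).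
  apply: measurable_sum => c; apply: measurable_funM.
    apply: measurable_prod => j _.
    apply: measurableT_comp; last exact: measurable_tnth.
    by apply: measurable_indic; exact: measurable_cell.
  apply: measurable_sum => b; apply: measurable_funM => //.
  apply: measurable_prod => j _; apply: measurable_funM => //.
  by apply: measurable_funB => //; exact: measurable_tnth.
- exact: truncate_le.
have S0 : 0 <= S by rewrite (le_trans _ wS)// sumr_ge0.
have /choice[Q HQ] := fun c => network_local C1 taylorC (ctr c) r0
  A0 B1 wA wB (ltW h0) p0 eta1 le_eta.
have /choice[a Ha] := fun c => wpoly_bseq (HQ c).1.
have aJ c b : `|a c b| <= tol * J%:R.
  rewrite (le_trans ((Ha c).1 b))// (le_trans _ SJ)// ler_wpM2r//.
  by rewrite addr_ge0// mulr_ge0.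
have /choice[z Hz] := fun cb : cells * words => rounding tol0 (aJ cb.1 cb.2).
exists (finfun z) => x xr.
rewrite (le_trans (truncate_lipschitz _ _ _))//.
have /choice[c0 Hc0] := fun j => cell_ex h0 rH (xr j).
pose c : cells := finfun c0.
have cx j : cell rho h (c j) (tnth x j) by rewrite ffunE.
rewrite (bigD1 c)//= [X in _ - (_ + X)]big1 => [|c' cc']; last first.
  suff [j cj] : exists j, c j != c' j.
    rewrite /ind (bigD1 j)//= indicE memNset ?mul0r// => c'x.
    by move: cj; apply/negP/negPn/eqP/val_inj/(cell_inj h0 (cx j) c'x).
  apply/existsP; apply: contra_neqT cc'; rewrite negb_exists => /forallP ccc.
  by apply/ffunP => j; move: (ccc j); rewrite negbK => /eqP.
have -> : ind c x = 1.
  by rewrite /ind big1// => j _; rewrite indicE mem_set//; exact: cx.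
rewrite mul1r addr0.
have u1 j : `|u c x j| <= 1 by apply: cell_dist => //; exact: cx.
have xE j : tnth x j = tnth (ctr c) j + h * u c x j.
  by rewrite tnth_mktuple /u mulrCA divff ?gt_eqF// mulr1 addrC subrK.
have [QP QE] := HQ c; have [aP aE] := Ha c.
rewrite -(subrKA (Q c (u c x))) (le_trans (ler_normD _ _))// lerD//.
  rewrite (le_trans (QE _ _ u1 xE))// ler_wpM2r// mulr_ge0 ?exprn_ge0//.
  by rewrite mulr_ge0// exprn_ge0// addr_ge0// mulr_ge0.
rewrite aE -sumrB (le_trans (ler_norm_sum _ _ _))//.
have -> : q%:R * tol = \sum_(b : words) tol by rewrite sumr_const -[RHS]mulr_natl.
apply: ler_sum => b _; rewrite -mulrBl normrM ffunE.
rewrite (le_trans _ (Hz (c, b)))// ler_piMr// normr_prod prodr_ile1// => j _.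
by rewrite normr_ge0 u1.
Qed.

End network_cover.

(** * Dependence of a network on the weights below the output level *)

Definition nidx (d L r : nat) : finType :=
  ('I_r * 'I_d.+1 + 'I_(L.-1) * 'I_r * 'I_r.+1)%type.

Definition below {d L r K : nat} (k : 'I_K) (s : nidx d L r) : widx d L r K :=
  match s with
  | inl (i, j) => inner k i j
  | inr (l, i, j) => hidden l k i j
  end.

Section inner_lipschitz.
Context {R : realType} {d L r K : nat}.
Implicit Types (w : wvec R d L r K) (x y : d.-tuple R) (k : 'I_K).

Lemma sum_widx (F : widx d L r K -> R) :
  \sum_a F a = \sum_k F (outer k) + \sum_k \sum_s F (below k s).
Proof.
rewrite !big_sumType /=; congr (_ + _).
under [RHS]eq_bigr do rewrite big_sumType /=.
rewrite big_split /=; congr (_ + _).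
  rewrite [RHS]pair_big /= (reindex (fun a : 'I_K * ('I_r * 'I_d.+1) =>
    (a.1, a.2.1, a.2.2))) /=.
    by apply: eq_bigr => -[k [i j]].
  exists (fun a => (a.1.1, (a.1.2, a.2))) => [[k [i j]]|[[k i] j]] //.
rewrite [RHS]pair_big /= (reindex (fun a : 'I_K * ('I_(L.-1) * 'I_r * 'I_r.+1) =>
  (a.2.1.1, a.1, a.2.1.2, a.2.2))) /=.
  by apply: eq_bigr => -[k [[l i] j]].
by exists (fun a => (a.1.1.2, (a.1.1.1, a.1.2, a.2))) =>
  [[k [[l i] j]]|[[[l k] i] j]].
Qed.

Definition inner_dist w w' k : R :=
  \sum_s `|wt w (below k s) - wt w' (below k s)|.

Lemma inner_dist_ge0 w w' k : 0 <= inner_dist w w' k.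
Proof. exact: sumr_ge0. Qed.

(** Summing over the neurons of a level closes the induction: each neuron of the next level sees [B]
    times the sum of the previous differences, and there are [r] of them, while the weights of that
    level contribute at most [inner_dist]. Writing [a s - b t] as [(a - b) s + b (s - t)] with
    [|s| <= 1] makes a bound on the hidden weights of [w'] alone sufficient. *)
Lemma neuron_lipschitz_sum (B rho : R) w w' x k l :
  1 <= rho -> 0 <= B -> hidden_le B w' -> (forall j, `|tnth x j| <= rho) ->
  \sum_i `|neuron w x k l i - neuron w' x k l i|
    <= (1 + r%:R * B) ^+ l * rho * inner_dist w w' k.
Proof.
move=> rho1 B0 wB xr; have D0 := inner_dist_ge0 w w' k.
have rho0 : 0 <= rho by rewrite (le_trans _ rho1).
have rB0 : 0 <= r%:R * B by rewrite mulr_ge0.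
elim: l => [|l IH] /=.
  rewrite expr0 mul1r.
  apply: (@le_trans _ _ (\sum_i \sum_(j < d.+1)
      rho * `|wt w (inner k i j) - wt w' (inner k i j)|)).
    apply: ler_sum => i _; rewrite (le_trans (sigmoid_lipschitz _ _))//.
    rewrite big_ord_recl /= opprD addrACA -sumrB addrC.
    rewrite (le_trans (ler_normD _ _))// lerD//; first by rewrite ler_peMl.
    rewrite (le_trans (ler_norm_sum _ _ _))//; apply: ler_sum => j _.
    by rewrite -mulrBl normrM mulrC ler_wpM2r.
  rewrite /inner_dist big_sumType /= pair_big /= -mulr_sumr ler_wpM2l//.
  rewrite -[leLHS]addr0 lerD ?sumr_ge0//.
  by rewrite [leRHS](eq_bigr (fun p =>
     `|wt w (inner k p.1 p.2) - wt w' (inner k p.1 p.2)|)) => [|[]].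
apply: (@le_trans _ _ (\sum_i (\sum_(j < r.+1)
      `|whid w l k i j - whid w' l k i j| +
      B * \sum_j `|neuron w x k l j - neuron w' x k l j|))).
  apply: ler_sum => i _; rewrite (le_trans (sigmoid_lipschitz _ _))//.
  rewrite big_ord_recl /= opprD addrACA -sumrB addrC -[leRHS]addrA.
  rewrite (le_trans (ler_normD _ _))// lerD//.
  rewrite (le_trans (ler_norm_sum _ _ _))// mulr_sumr -big_split /=.
  apply: ler_sum => j _.
  set a := whid w _ _ _ _; set b := whid w' _ _ _ _.
  set s := neuron w _ _ _ _; set t := neuron w' _ _ _ _.
  have -> : a * s - b * t = (a - b) * s + b * (s - t) by ring.
  rewrite (le_trans (ler_normD _ _))// !normrM lerD//.
    by rewrite ler_piMr// norm_neuron_le1.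
  by rewrite ler_wpM2r// (norm_whid_le B0 wB).
rewrite big_split /= sumr_const card_ord -[X in _ + X <= _]mulr_natl mulrA.
have le1 : \sum_i \sum_(j < r.+1) `|whid w l k i j - whid w' l k i j|
    <= inner_dist w w' k.
  rewrite /whid; case: insubP => [l' _ _|_]; last first.
    by rewrite big1// => i _; rewrite big1// => j _; rewrite subrr normr0.
  pose G l i j := `|wt w (hidden l k i j) - wt w' (hidden l k i j)|.
  rewrite /inner_dist big_sumType /= -[leLHS]add0r lerD ?sumr_ge0//.
  rewrite [leRHS](eq_bigr (fun p => G p.1.1 p.1.2 p.2)) ; last by case=> [[]].
  rewrite -(pair_bigA _ (fun q j => G q.1 q.2 j)) /=.
  rewrite -(pair_bigA _ (fun l i => \sum_j G l i j)) /=.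
  rewrite (bigD1 l')//= lerDl sumr_ge0// => l'' _.
  by do 2 (apply: sumr_ge0 => ? _); rewrite /G normr_ge0.
rewrite (@le_trans _ _ (inner_dist w w' k + r%:R * B *
  ((1 + r%:R * B) ^+ l * rho * inner_dist w w' k)))//.
  by rewrite lerD// ler_wpM2l.
have X1 : 1 <= (1 + r%:R * B) ^+ l * rho.
  by rewrite mulr_ege1// exprn_ege1// lerDl.
rewrite exprS; nra.
Qed.

Lemma neuron_lipschitz (B rho : R) w w' x k l i :
  1 <= rho -> 0 <= B -> hidden_le B w' -> (forall j, `|tnth x j| <= rho) ->
  `|neuron w x k l i - neuron w' x k l i|
    <= (1 + r%:R * B) ^+ l * rho * inner_dist w w' k.
Proof.
move=> rho1 B0 wB xr; apply: le_trans (neuron_lipschitz_sum w k l rho1 B0 wB xr).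
by rewrite (bigD1 i)//= lerDl sumr_ge0.
Qed.

Lemma eq_neuron w w' x k l i :
  (forall k s, wt w (below k s) = wt w' (below k s)) ->
  neuron w x k l i = neuron w' x k l i.
Proof.
move=> ww; have wh l' i' j' : whid w l' k i' j' = whid w' l' k i' j'.
  by rewrite /whid; case: insub => // a; exact: (ww k (inr (a, i', j'))).
elim: l i => [|l IH] i /=; congr sigmoid.
  congr (_ + _); last exact: (ww k (inl (i, ord0))).
  by apply: eq_bigr => j _; rewrite (ww k (inl (i, lift ord0 j))).
by rewrite wh; congr (_ + _); apply: eq_bigr => j _; rewrite IH wh.
Qed.

End inner_lipschitz.

(** * Gradient descent *)

Section averages.
Context {R : realType}.
Implicit Types (F G f y : nat -> R) (n : nat).

Definition avg n F : R := n%:R^-1 * \sum_(1 <= i < n.+1) F i.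

Lemma eq_avg n F G : (forall i, F i = G i) -> avg n F = avg n G.
Proof. by move=> FG; rewrite /avg (eq_bigr G). Qed.

Lemma avgD n F G : avg n (fun i => F i + G i) = avg n F + avg n G.
Proof. by rewrite /avg big_split mulrDr. Qed.

Lemma avgZ n a F : avg n (fun i => a * F i) = a * avg n F.
Proof. by rewrite /avg -mulr_sumr mulrCA. Qed.

Lemma avgB n F G : avg n (fun i => F i - G i) = avg n F - avg n G.
Proof. by rewrite /avg sumrB mulrBr. Qed.

Lemma avg_sum n (I : finType) (H : I -> nat -> R) :
  avg n (fun i => \sum_k H k i) = \sum_k avg n (H k).
Proof. by rewrite /avg exchange_big /= mulr_sumr. Qed.

Lemma ler_avg n F G : (forall i, (1 <= i <= n)%N -> F i <= G i) ->
  avg n F <= avg n G.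
Proof.
move=> FG; rewrite /avg ler_wpM2l ?invr_ge0// big_nat [leRHS]big_nat.
by apply: ler_sum => i; rewrite ltnS; exact: FG.
Qed.

Lemma avg_cst n a : (0 < n)%N -> avg n (fun=> a) = a.
Proof.
move=> n0; rewrite /avg sumr_const_nat subSS subn0 -[X in _ * X]mulr_natl mulKf//.
by rewrite pnatr_eq0 -lt0n.
Qed.

Lemma avg_ge0 n F : (forall i, 0 <= F i) -> 0 <= avg n F.
Proof. by move=> F0; rewrite /avg mulr_ge0 ?invr_ge0 ?sumr_ge0. Qed.

Lemma sqr_sum_le (I : finType) (a : I -> R) :
  (\sum_k a k) ^+ 2 <= #|I|%:R * \sum_k a k ^+ 2.
Proof.
rewrite expr2 mulr_suml.
apply: (@le_trans _ _ (\sum_k \sum_l (a k ^+ 2 + a l ^+ 2) / 2)).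
  apply: ler_sum => k _; rewrite mulr_sumr; apply: ler_sum => l _.
  by have := sqr_ge0 (a k - a l); nra.
under eq_bigr do rewrite -mulr_suml big_split /= sumr_const.
rewrite -mulr_suml big_split /= sumr_const sumrMnl -mulr2n.
by rewrite -[X in X / 2]mulr_natr mulfK ?pnatr_eq0// -[X in X <= _]mulr_natl.
Qed.

Lemma sqr_sum_nat_le (t : nat) (a : nat -> R) :
  (\sum_(0 <= s < t) a s) ^+ 2 <= t%:R * \sum_(0 <= s < t) a s ^+ 2.
Proof.
by rewrite !big_mkord; have := sqr_sum_le (fun s : 'I_t => a s); rewrite card_ord.
Qed.

End averages.

(** * Least squares in the outer weights *)

Section least_squares.
Context {R : realType} {K : nat}.
Variables (n : nat) (y : nat -> R).
Hypothesis n0 : (0 < n)%N.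
Implicit Types (f : nat -> R) (o : 'I_K -> R) (N : 'I_K -> nat -> R).

Definition lsq f : R := avg n (fun i => (f i - y i) ^+ 2).

Definition comb o N (i : nat) : R := \sum_k o k * N k i.

(* The gradient of [fun o => lsq (comb o N)]. *)
Definition lsq_grad o N k : R := 2 * avg n (fun i => (comb o N i - y i) * N k i).

Lemma lsq_ge0 f : 0 <= lsq f.
Proof. by apply: avg_ge0 => i; exact: sqr_ge0. Qed.

Lemma combB o o' N i : comb o N i - comb o' N i = \sum_k (o k - o' k) * N k i.
Proof. by rewrite /comb -sumrB; apply: eq_bigr => k _; rewrite mulrBl. Qed.

Lemma lsq_grad_dot o N v : \sum_k lsq_grad o N k * v k =
  avg n (fun i => 2 * (comb o N i - y i) * comb v N i).
Proof.
rewrite /lsq_grad; under eq_bigr do rewrite mulrC -avgZ -avgZ.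
rewrite -avg_sum; apply: eq_avg => i; rewrite /comb mulr_sumr.
by apply: eq_bigr => k _; ring.
Qed.

Lemma lsq_convex o o' N :
  lsq (comb o N) - lsq (comb o' N) <= \sum_k lsq_grad o N k * (o k - o' k).
Proof.
rewrite lsq_grad_dot /lsq -avgB; apply: ler_avg => i _.
have -> : comb (fun k => o k - o' k) N i = comb o N i - comb o' N i.
  by rewrite combB.
set a := comb o N i; set b := comb o' N i.
by have := sqr_ge0 (a - b); nra.
Qed.

Lemma norm_lsq_grad_le o N k : (forall k i, `|N k i| <= 1) ->
  `|lsq_grad o N k| <= lsq (comb o N) + 1.
Proof.
move=> N1; have -> : lsq (comb o N) + 1 = avg n (fun i => (comb o N i - y i) ^+ 2 + 1).
  by rewrite avgD avg_cst.
rewrite /lsq_grad -avgZ ler_norml -[X in X <= _ <= _]mulN1r -avgZ; apply/andP.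
split; apply: ler_avg => i _; have /ler_normlP[] := N1 k i;
  set a := comb o N i - y i; set b := N k i => b1 b2;
  have : 0 <= (1 - b) * (1 + b) by rewrite mulr_ge0; lra.
- by move=> _; have := sqr_ge0 (a + b); rewrite !expr2; nra.
- by move=> _; have := sqr_ge0 (a - b); rewrite !expr2; nra.
Qed.

(** Since the features are bounded by 1, the curvature of the loss along its gradient [g] is at most
    of order [K |g|^2]; with [lam * K <= 1/2] the second-order term takes back at most half of the
    first-order decrease [lam |g|^2]. *)
Lemma lsq_step o N lam : (forall k i, `|N k i| <= 1) -> 0 <= lam ->
  lam * K%:R <= 2^-1 ->
  lsq (comb (fun k => o k - lam * lsq_grad o N k) N) <=
    lsq (comb o N) - lam / 2 * \sum_k lsq_grad o N k ^+ 2.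
Proof.
move=> N1 lam0 lamK; set g := lsq_grad o N; set o' := fun k => _.
have S : \sum_k g k ^+ 2 = avg n (fun i => 2 * (comb o N i - y i) * comb g N i).
  by rewrite -lsq_grad_dot; apply: eq_bigr => k _; rewrite expr2.
have E i : comb o' N i = comb o N i - lam * comb g N i.
  rewrite /comb mulr_sumr -sumrB; apply: eq_bigr => k _.
  by rewrite mulrBl -mulrA.
have gK i : (comb g N i) ^+ 2 <= K%:R * \sum_k g k ^+ 2.
  rewrite (le_trans (sqr_sum_le _))// card_ord ler_wpM2l//.
  apply: ler_sum => k _; rewrite exprMn ler_piMr ?sqr_ge0//.
  by rewrite -real_normK ?num_real// exprn_ile1.
have : lsq (comb o' N) <= lsq (comb o N) - lam * \sum_k g k ^+ 2
   + lam ^+ 2 * (K%:R * \sum_k g k ^+ 2).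
  rewrite {1}S -avgZ /lsq -(avg_cst (lam ^+ 2 * _) n0) -avgB -avgD.
  apply: ler_avg => i _; rewrite E; have := gK i.
  set c := K%:R * _; set a := comb o N i; set b := comb g N i => bc.
  have : lam ^+ 2 * b ^+ 2 <= lam ^+ 2 * c by rewrite ler_wpM2l ?sqr_ge0.
  by rewrite !expr2; nra.
have : 0 <= \sum_k g k ^+ 2 by apply: sumr_ge0 => k _; exact: sqr_ge0.
move: lamK lam0; rewrite expr2; set s := \sum_k _; set A := lsq _; set B := lsq _.
move=> lamK lam0 s0 AB; apply: (le_trans AB).
have : lam * (lam * K%:R) <= lam * 2^-1 by rewrite ler_wpM2l.
by nra.
Qed.

(** A residual [a] moved by [c] with [|c| <= e] changes its square by [2 a c + c^2], and
    [|2 a c| <= e (a^2 + 1)]. The loss itself thus takes the place of a uniform bound on the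
    residuals. *)
Lemma lsq_perturb f f' e : (forall i, (1 <= i <= n)%N -> `|f' i - f i| <= e) ->
  `|lsq f' - lsq f| <= e ^+ 2 + e * (lsq f + 1).
Proof.
move=> fe; have e0 : 0 <= e by rewrite (le_trans _ (fe 1%N _)) ?n0.
have S : avg n (fun i => e ^+ 2 + e * ((f i - y i) ^+ 2 + 1)) =
    e ^+ 2 + e * (lsq f + 1).
  rewrite avgD (avgZ n e (fun i => (f i - y i) ^+ 2 + 1)) !avgD.
  by rewrite !avg_cst.
rewrite -S -avgB ler_norml -[X in X <= _ <= _]mulN1r -avgZ; apply/andP.
split; apply: ler_avg => i /fe /ler_normlP[] ;
  set a := f i - y i; set b := f' i;
  have -> : b - y i = a + (b - f i) by rewrite /a; ring.
- move=> h1 h2; set c := b - f i in h1 h2 *.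
  have : 0 <= (e - c) * (e + c) by rewrite mulr_ge0; lra.
  have : - e * (a ^+ 2 + 1) <= 2 * a * c.
    have := mulr_ge0 e0 (sqr_ge0 (a - 1)); have := mulr_ge0 e0 (sqr_ge0 (a + 1)).
    have [a0|a0] := leP 0 a; nra.
  by have := sqr_ge0 c; rewrite !expr2; nra.
- move=> h1 h2; set c := b - f i in h1 h2 *.
  have : 0 <= (e - c) * (e + c) by rewrite mulr_ge0; lra.
  have : 2 * a * c <= e * (a ^+ 2 + 1).
    have := mulr_ge0 e0 (sqr_ge0 (a - 1)); have := mulr_ge0 e0 (sqr_ge0 (a + 1)).
    have [a0|a0] := leP 0 a; nra.
  by rewrite !expr2; nra.
Qed.

End least_squares.

(** A local Lipschitz bound controls the difference quotients and passes to their limit. If they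
    diverge, the limit is by convention the default point 0, which satisfies the bound as well. *)
Lemma norm_derive_le {R : realType} {V : normedModType R} (f : V -> R) a v M :
  0 <= M ->
  (\forall h \near 0^', `|f (h *: v + a) - f a| <= M * `|h|) ->
  `|'D_v f a| <= M.
Proof.
move=> M0 H; rewrite /derive; set q := fun h => _.
have H' : \forall h \near 0^', `|q h| <= M.
  near=> h; have h0 : h != 0 by near: h; exact: nbhs_dnbhs_neq.
  rewrite /q /= /GRing.scale /= normrM normfV mulrC ler_pdivrMr ?normr_gt0//.
  by near: h.
have [cq|/dvgP ->] := pselect (cvg (q h @[h --> 0^'])); last first.
  by rewrite (_ : point = 0) ?normr0.
rewrite ler_norml; apply/andP; split; [apply: limr_ge => //|apply: limr_le => //];
  by apply: filterS H' => h; rewrite ler_norml => /andP[].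
Unshelve. all: by end_near. Qed.

Section descent_analysis.
Context {R : realType} {d L r K : nat} (r0 : (0 < r)%N).
Variables (n : nat) (x : nat -> d.-tuple R) (y : nat -> R).
Hypothesis n0 : (0 < n)%N.
Implicit Types (w : wvec R d L r K) (k : 'I_K) (o : 'I_K -> R).

Local Notation F := (emp_risk r0 n x y).
Local Notation q := (#|{: nidx d L r}|%:R : R).

Definition outw w k : R := wt w (outer k).
Definition feat w k i : R := neuron w (x i) k L.-1 (Ordinal r0).

Lemma norm_feat_le1 w k i : `|feat w k i| <= 1.
Proof. exact: norm_neuron_le1. Qed.

Lemma emp_riskE w : F w = lsq n y (comb (outw w) (feat w)).
Proof.
rewrite /emp_risk /lsq /avg; congr (_ * _); apply: eq_bigr => i _.
by rewrite real_normK ?num_real.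
Qed.

Lemma emp_risk_ge0 w : 0 <= F w.
Proof. by rewrite emp_riskE lsq_ge0. Qed.

Lemma wt_shift w h a b :
  wt (h *: delta_mx 0 (enum_rank b) + w) a = wt w a + h * (a == b)%:R.
Proof.
by rewrite /wt !mxE eqxx /= (inj_eq enum_rank_inj) addrC.
Qed.

Lemma below_neq_outer k k' (s : nidx d L r) : (below k s == outer k') = false.
Proof. by case: s => [[i j]|[[l i] j]]. Qed.

Lemma below_inj k k' (s s' : nidx d L r) :
  (below k s == below k' s' :> widx d L r K) = (k == k') && (s == s').
Proof.
apply/eqP/andP => [|[/eqP-> /eqP->]]//.
by case: s => [[i j]|[[l i] j]]; case: s' => [[i' j']|[[l' i'] j']] //= [] *;
  subst; rewrite !eqxx.
Qed.

Lemma grad_outer w k :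
  grad F w 0 (enum_rank (outer k)) = lsq_grad n y (outw w) (feat w) k.
Proof.
rewrite mxE; apply: cvg_lim => //.
pose c := avg n (fun i => feat w k i ^+ 2).
(* The risk is quadratic in a single outer weight, so for [h != 0] the difference quotient equals
   this affine function of [h]. *)
pose q h := lsq_grad n y (outw w) (feat w) k + h * c.
have qE : {near 0^', q =1 (fun h => h^-1 *: ((F \o shift w)
    (h *: delta_mx 0 (enum_rank (outer k))) - F w))}.
  near=> h; have h0 : h != 0 by near: h; exact: nbhs_dnbhs_neq.
  rewrite /= !emp_riskE /lsq -avgB.
  rewrite (@eq_avg _ _ _ (fun i => h * ((2 * ((comb (outw w) (feat w) i - y i) *
     feat w k i)) + h * feat w k i ^+ 2))); last first.
    move=> i; set w' := _ + w.
    have -> : comb (outw w') (feat w') i = comb (outw w) (feat w) i + h * feat w k i.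
      rewrite /comb (eq_bigr (fun k' => outw w k' * feat w k' i +
          h * (k' == k)%:R * feat w k i)).
        rewrite big_split /=; congr (_ + _); rewrite (bigD1 k)//= eqxx mulr1 big1 ?addr0//.
        by move=> k' /negbTE ->; rewrite mulr0 mul0r.
      move=> k' _; rewrite /outw wt_shift /feat (@eq_neuron _ _ _ _ _ w' w).
        have -> : (outer k' == outer k :> widx d L r K) = (k' == k) by [].
        by rewrite mulrDl; case: eqVneq => [->//|_]; rewrite mulr0 !mul0r.
      by move=> k'' s; rewrite wt_shift below_neq_outer mulr0 addr0.
    ring.
  by rewrite avgZ /GRing.scale /= mulKf// avgD !avgZ.
apply: (cvg_trans (near_eq_cvg qE)).
have : q h @[h --> (0 : R)] --> q 0.
  by apply: cvgD; [exact: cvg_cst|apply: cvgM; [exact: cvg_id|exact: cvg_cst]].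
rewrite /q mul0r addr0; apply: cvg_trans.
by apply: cvg_app; exact: nbhs_dnbhs.
Unshelve. all: by end_near. Qed.

Variables (B rho : R).
Hypotheses (rho1 : 1 <= rho) (B0 : 0 <= B).
Hypothesis xrho : forall i, (1 <= i <= n)%N -> forall j, `|tnth (x i) j| <= rho.

Definition lipc : R := (1 + r%:R * B) ^+ L.-1 * rho.
Local Notation Lam := lipc.

Lemma lipc_ge1 : 1 <= Lam.
Proof. by rewrite /lipc mulr_ege1// exprn_ege1// lerDl mulr_ge0. Qed.

Lemma comb_feat_lipschitz o w w' i : hidden_le B w' -> (1 <= i <= n)%N ->
  `|comb o (feat w) i - comb o (feat w') i|
    <= Lam * \sum_k `|o k| * inner_dist w w' k.
Proof.
move=> wB /xrho xr; rewrite /comb -sumrB (le_trans (ler_norm_sum _ _ _))//.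
rewrite mulr_sumr; apply: ler_sum => k _; rewrite -mulrBr normrM mulrCA.
by rewrite ler_wpM2l//; exact: neuron_lipschitz.
Qed.

(** The factor [|outw w k|] is the point: the outer weights start at 0, so the lower weights hardly
    move while the outer ones stay small. Changing one lower weight by [h] moves the outputs by at
    most [e = |outw w k| * Lam * |h|], and [lsq_perturb] with [e <= 1] gives the bound. *)
Lemma norm_grad_below w k s : hidden_le B w ->
  `|grad F w 0 (enum_rank (below k s))| <= `|outw w k| * Lam * (F w + 2).
Proof.
move=> wB; have L1 := lipc_ge1; have F0 := emp_risk_ge0 w.
have L0 : 0 <= Lam by rewrite (le_trans _ L1).
have M0 : 0 <= `|outw w k| * Lam by rewrite mulr_ge0.
rewrite mxE; apply: norm_derive_le; first by rewrite mulr_ge0// addr_ge0.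
near=> h; set w' := _ + w; set e := `|outw w k| * Lam * `|h|.
have e0 : 0 <= e by rewrite mulr_ge0.
have e1 : e <= 1.
  rewrite /e (@le_trans _ _ ((`|outw w k| * Lam + 1) * `|h|))//.
    by rewrite ler_wpM2r// lerDl.
  rewrite -ler_pdivlMl ?ltr_wpDl// mulr1.
  by near: h; apply: dnbhs0_le; rewrite invr_gt0 ltr_wpDl.
have oE : outw w' =1 outw w.
  by move=> k'; rewrite /outw wt_shift eq_sym below_neq_outer mulr0 addr0.
have fe i : (1 <= i <= n)%N ->
    `|comb (outw w) (feat w') i - comb (outw w) (feat w) i| <= e.
  move=> /(comb_feat_lipschitz (outw w) w' wB) /le_trans; apply.
  rewrite (bigD1 k)//= big1 ?addr0 => [|k' k'k]; last first.
    rewrite /inner_dist big1 ?mulr0// => s' _; rewrite wt_shift below_inj.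
    by rewrite (negbTE k'k) mulr0 addr0 subrr normr0.
  rewrite /inner_dist (bigD1 s)//= wt_shift eqxx mulr1 addrAC subrr add0r.
  rewrite big1 ?addr0 /e => [|s' s's]; first by rewrite mulrCA mulrA.
  by rewrite wt_shift below_inj eqxx (negbTE s's) mulr0 addr0 subrr normr0.
have := lsq_perturb y n0 fe.
rewrite (_ : comb (outw w) (feat w') = comb (outw w') (feat w')); last first.
  by apply/funext => i; apply: eq_bigr => k' _; rewrite oE.
rewrite -!emp_riskE => /le_trans; apply.
rewrite [leRHS](_ : _ = e * (F w + 2)); last by rewrite /e; ring.
by rewrite expr2 -mulrDr ler_wpM2l//; lra.
Unshelve. all: by end_near. Qed.

End descent_analysis.

Section step_bounds.
Context {R : realType}.
Implicit Types F mid s g v b c : R.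

Lemma increment_sum_le F mid s g v b : F + s <= b + v -> v <= 1 ->
  mid <= F - g -> 0 <= mid -> s + g <= b + 1.
Proof. lra. Qed.

Lemma energy_step F F' mid s g v b c : F + s <= b + v -> mid <= F - g ->
  F' <= mid + c -> F' + (s + g) <= b + (v + c).
Proof. lra. Qed.

Lemma perturbed_step F' mid b c e : 0 <= e -> 0 <= b -> e * (b + 2) = c ->
  c <= 1 -> mid <= b -> F' - mid <= e ^+ 2 + e * (mid + 1) -> F' <= mid + c.
Proof.
move=> e0 b0 <- c1 mb H.
have e1 : e <= 1 by nra.
have ee : e ^+ 2 <= e by rewrite expr2; nra.
have : e * (mid + 1) <= e * (b + 1) by rewrite ler_wpM2l// lerD2r.
lra.
Qed.

Lemma double_le_mul_sqr b q G : 1 <= q -> 0 <= b -> b + 2 <= G ->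
  2 * b <= q * G ^+ 2.
Proof.
move=> q1 b0 bG; have G2 : 0 <= G ^+ 2 by exact: sqr_ge0.
by apply: le_trans (ler_peMl G2 q1); rewrite expr2; nra.
Qed.

End step_bounds.

(** * The path of gradient descent *)

Section descent_path.
Context {R : realType} {d L r K : nat} (r0 : (0 < r)%N).
Variables (n : nat) (x : nat -> d.-tuple R) (y : nat -> R).
Hypothesis n0 : (0 < n)%N.
Implicit Types (w : wvec R d L r K) (k : 'I_K) (o : 'I_K -> R).

Local Notation F := (emp_risk r0 n x y).
Local Notation q := (#|{: nidx d L r}|%:R : R).
Local Notation feat := (feat r0 x).

Variables (lam : R) (w0 : wvec R d L r K).
Hypothesis lam0 : 0 < lam.
Local Notation W t := (descent F lam w0 t).
Let g t k := lsq_grad n y (outw (W t)) (feat (W t)) k.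

Lemma wt_descentS t a :
  wt (W t.+1) a = wt (W t) a - lam * grad F (W t) 0 (enum_rank a).
Proof. by rewrite /wt /= !mxE. Qed.

Lemma outw_descentS t k : outw (W t.+1) k = outw (W t) k - lam * g t k.
Proof. by rewrite /outw wt_descentS grad_outer. Qed.

(** Regret bound of online gradient descent in the outer weights: the comparator [o] is fixed, while
    the features at each step are those of the current iterate. The potential [D], a multiple of the
    squared distance of the outer weights to [o], telescopes. *)
Lemma descent_regret o T :
  \sum_(0 <= t < T) (F (W t) - lsq n y (comb o (feat (W t)))) <=
  (\sum_k (outw w0 k - o k) ^+ 2) / (2 * lam) +
  lam / 2 * \sum_(0 <= t < T) \sum_k g t k ^+ 2.
Proof.
set D := fun t => (\sum_k (outw (W t) k - o k) ^+ 2) / (2 * lam).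
rewrite -/(D 0%N).
suff : \sum_(0 <= t < T) (F (W t) - lsq n y (comb o (feat (W t)))) + D T <=
    D 0%N + lam / 2 * \sum_(0 <= t < T) \sum_k g t k ^+ 2.
  apply: le_trans; rewrite lerDl divr_ge0 ?sumr_ge0//.
    by move=> k _; exact: sqr_ge0.
  by rewrite mulr_ge0// ltW.
elim: T => [|T IH]; first by rewrite !big_geq// mulr0 addr0 add0r.
rewrite !big_nat_recr//= mulrDr addrA.
have := lsq_convex n y (outw (W T)) o (feat (W T)); rewrite -emp_riskE => cvx.
have -> : D T.+1 = D T - \sum_k g T k * (outw (W T) k - o k) +
   lam / 2 * \sum_k g T k ^+ 2.
  rewrite /D (eq_bigr (fun k => (outw (W T) k - o k) ^+ 2 -
     2 * lam * (g T k * (outw (W T) k - o k)) + lam ^+ 2 * g T k ^+ 2)).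
    rewrite big_split /= sumrB -!mulr_sumr; field.
    by rewrite gt_eqF.
  by move=> k _; rewrite outw_descentS; ring.
move: cvx IH; rewrite -/(g T); set c := \sum_(k < K) _ * _; lra.
Qed.

Variables (b A beta rho : R).
Hypotheses (rho1 : 1 <= rho) (b0 : 0 <= b).
Hypothesis xrho : forall i, (1 <= i <= n)%N -> forall j, `|tnth (x i) j| <= rho.
Hypothesis ybeta : forall i, (1 <= i <= n)%N -> `|y i| <= beta.
Hypothesis w0_out : forall k, outw w0 k = 0.
Hypothesis w0_hidden : hidden_le b w0.
Hypothesis w0_inner : inner_le A w0.
Local Notation Lam := (@lipc R L r (b + 1) rho).
Local Notation Fb := (beta ^+ 2 + 1).
Local Notation Q := (q * Lam ^+ 2 * (Fb + 2) ^+ 2).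

(* [e] bounds how far the path from [w0] up to time [T] is from being a
   monotone gradient flow that leaves the weights below the output level
   unchanged. *)
Definition good_path (e : R) T : Prop :=
  [/\ F (W T) <= T%:R^-1 * (\sum_(0 <= t < T) F (W t)) + e,
      T%:R^-1 * (\sum_(0 <= t < T) lam * \sum_k g t k ^+ 2) <= e,
      forall t o, (t <= T)%N -> \sum_k o k ^+ 2 <= (2 / n%:R) ^+ 2 ->
        \sum_k `|o k| * inner_dist (W t) w0 k <= e
    & forall t, (t <= T)%N -> [/\ inner_le (A + 1) (W t),
        hidden_le (b + 1) (W t) & \sum_k outw (W t) k ^+ 2 <= 1]].

Lemma outw_descent t k : outw (W t) k = - lam * \sum_(0 <= s < t) g s k.
Proof.
elim: t => [|t IH]; first by rewrite big_geq// mulr0 w0_out.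
by rewrite outw_descentS IH big_nat_recr//=; ring.
Qed.

Lemma emp_risk0 : F w0 <= beta ^+ 2.
Proof.
rewrite emp_riskE /lsq -(avg_cst (beta ^+ 2) n0); apply: ler_avg => i /ybeta yb.
rewrite /comb big1 ?sub0r ?sqrrN => [|k _]; last by rewrite w0_out mul0r.
rewrite -real_normK ?num_real// lerXn2r ?nnegrE//.
exact: le_trans yb.
Qed.

Lemma sum_mul_le1 (o v : 'I_K -> R) : \sum_k o k ^+ 2 <= 1 ->
  \sum_k v k ^+ 2 <= 1 -> \sum_k `|o k| * `|v k| <= 1.
Proof.
move=> o1 v1.
have : \sum_k (`|o k| * `|v k|) *+ 2 <= \sum_k o k ^+ 2 + \sum_k v k ^+ 2.
  rewrite -big_split /=; apply: ler_sum => k _.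
  rewrite -(real_normK (num_real (o k))) -(real_normK (num_real (v k))).
  by have := sqr_ge0 (`|o k| - `|v k|); rewrite -mulr_natr; nra.
by rewrite sumrMnl -mulr_natr; lra.
Qed.

Lemma below_bounds t c : c <= 1 ->
  (forall k s, `|wt (W t) (below k s) - wt w0 (below k s)| <= c) ->
  inner_le (A + 1) (W t) /\ hidden_le (b + 1) (W t).
Proof.
move=> c1 H; split => [k i j|l k i j].
  have := H k (inl (i, j)) => /= /le_trans /(_ c1) h.
  rewrite -(subrK (wt w0 (inner k i j)) (wt (W t) _)).
  by rewrite (le_trans (ler_normD _ _))// addrC lerD.
have := H k (inr (l, i, j)) => /= /le_trans /(_ c1) h.
rewrite -(subrK (wt w0 (hidden l k i j)) (wt (W t) _)).
by rewrite (le_trans (ler_normD _ _))// addrC lerD.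
Qed.

(** Bootstrap along the path. As long as the risk is below [Fb] and the outer weights are in the
    unit ball, each lower weight drifts by at most [lam * G] per step, which raises the risk by at
    most [lam * Z], in total by at most 1. The outer part of a step only lowers the risk, and the
    resulting bound on the sum of squared outer gradients keeps the outer weights in the unit
    ball. *)
Lemma small_step_path (e : R) T : (0 < T)%N ->
  lam * K%:R <= 2^-1 -> lam * T%:R * Q <= 1 ->
  lam * T%:R * Q <= e -> lam * (K%:R * (Fb + 1) ^+ 2) <= e ->
  (2 / n%:R) ^+ 2 <= 1 :> R ->
  good_path e T.
Proof.
move=> T0 lamK tQ1 tQe lKe n21.
have B0 : 0 <= b + 1 by rewrite addr_ge0.
have L1 : 1 <= Lam by exact: lipc_ge1.
have F1 : 1 <= Fb by rewrite lerDr sqr_ge0.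
have F20 : 0 <= Fb + 2 by lra.
have Lam0 : 0 <= Lam by lra.
have lam0' := ltW lam0.
have T1 : 1 <= T%:R :> R by rewrite ler1n.
have q1 : 1 <= q.
  rewrite ler1n; apply/card_gt0P.
  by exists (inl (Ordinal r0, ord0)).
pose G := Lam * (Fb + 2).
have G0 : 0 <= G by rewrite mulr_ge0.
have GE : G = Lam * (Fb + 2) by [].
have [Z ZE] : exists Z, Z = Q by exists Q.
have QE : Z = q * G ^+ 2 by rewrite ZE /G; ring.
rewrite -ZE in tQ1 tQe; clear ZE; clearbody G.
have G2 : 1 <= G by rewrite GE mulr_ege1//; lra.
have qG : q * G <= Z by rewrite QE expr2 mulrA ler_peMr// mulr_ge0.
have Q1 : 1 <= Z by rewrite (le_trans _ qG)// mulr_ege1.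
have Q0 : 0 <= Z by lra.
pose Inv t := [/\ F (W t) + lam / 2 * \sum_(0 <= s < t) \sum_k g s k ^+ 2 <=
     beta ^+ 2 + t%:R * (lam * Z),
   \sum_k outw (W t) k ^+ 2 <= 1,
   forall k s, `|wt (W t) (below k s) - wt w0 (below k s)| <= t%:R * (lam * G)
   & forall o, \sum_k o k ^+ 2 <= 1 ->
       \sum_k `|o k| * inner_dist (W t) w0 k <= t%:R * (lam * (q * G))].
have tle t c : (t <= T)%N -> 0 <= c -> c <= Z -> t%:R * (lam * c) <= lam * T%:R * Z.
  move=> tT c0 cQ; rewrite mulrA (mulrC _ lam) ler_pM ?mulr_ge0//.
  by rewrite ler_wpM2l// ler_nat.
have F0 : 0 <= Fb by exact: le_trans F1.
have F20' : 0 <= 2 * Fb by exact: mulr_ge0.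
have FZ : 2 * Fb <= Z.
  by rewrite QE; apply: double_le_mul_sqr => //; rewrite GE ler_peMl.
have tle1 t : (t <= T)%N -> t%:R * (lam * Z) <= 1.
  by move=> tT; rewrite (le_trans (tle t Z tT Q0 (lexx _))).
have lG1 : lam * Z <= 1 by have := tle1 1%N T0; rewrite mul1r.
have GQ : G <= Z by rewrite (le_trans _ qG)// ler_peMl.
have IF t : (t <= T)%N -> Inv t -> F (W t) <= Fb.
  move=> tT [+ _ _ _]; have := tle t Z tT Q0 (lexx _).
  have : 0 <= lam / 2 * \sum_(0 <= s < t) \sum_k g s k ^+ 2.
    rewrite mulr_ge0 ?divr_ge0// sumr_ge0// => s _; rewrite sumr_ge0// => k _.
    exact: sqr_ge0.
  by lra.
have IB t : (t <= T)%N -> Inv t ->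
    inner_le (A + 1) (W t) /\ hidden_le (b + 1) (W t).
  move=> tT [_ _ H _]; apply: (@below_bounds _ (t%:R * (lam * G))) => //.
  by rewrite (le_trans (tle t G tT G0 GQ)).
have step t : (t < T)%N -> Inv t ->
    Inv t.+1 /\ F (W t.+1) <= F (W t) + lam * Z.
  move=> tT It; have tT' := ltnW tT.
  have FB := IF _ tT' It; have [_ hB] := IB _ tT' It; have [Ia Ib Ic Id] := It.
  have gr k s : `|wt (W t.+1) (below k s) - wt (W t) (below k s)|
      <= lam * (`|outw (W t) k| * G).
    rewrite wt_descentS addrAC subrr add0r normrN normrM (gtr0_norm lam0).
    rewrite ler_wpM2l// (le_trans (norm_grad_below r0 y n0 rho1 B0 xrho k s hB))//.
    rewrite GE [leRHS]mulrA ler_wpM2l ?lerD2r//; exact: mulr_ge0.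
  have gi k : inner_dist (W t.+1) (W t) k <= `|outw (W t) k| * (lam * (q * G)).
    have -> : `|outw (W t) k| * (lam * (q * G)) =
        \sum_(s : nidx d L r) lam * (`|outw (W t) k| * G).
      by rewrite sumr_const -[RHS]mulr_natl; ring.
    by apply: ler_sum => s _; exact: gr.
  have gv o : \sum_k o k ^+ 2 <= 1 ->
      \sum_k `|o k| * inner_dist (W t.+1) (W t) k <= lam * (q * G).
    move=> o1; have lqG : 0 <= lam * (q * G) by rewrite mulr_ge0// mulr_ge0.
    apply: (@le_trans _ _ (\sum_k `|o k| * `|outw (W t) k| * (lam * (q * G)))).
      by apply: ler_sum => k _; rewrite -mulrA ler_wpM2l.
    rewrite -mulr_suml ler_piMl//; exact: sum_mul_le1.
  (* Splits the step in two: the outer weights move first, with the features frozen, so that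
     [lsq_step] applies; then the features move, which [lsq_perturb] controls. *)
  pose mid := lsq n y (comb (outw (W t.+1)) (feat (W t))).
  have mid_le : mid <= F (W t) - lam / 2 * \sum_k g t k ^+ 2.
    have := @lsq_step _ _ n y n0 (outw (W t)) (feat (W t)) lam
      (norm_feat_le1 r0 x (W t)) lam0' lamK.
    rewrite -emp_riskE -/(g t); apply: le_trans.
    rewrite /mid (_ : outw (W t.+1) = fun k => outw (W t) k - lam * g t k)//.
    by apply/funext => k; exact: outw_descentS.
  have mid0 : 0 <= mid by exact: lsq_ge0.
  have S0 : 0 <= \sum_k g t k ^+ 2 by apply: sumr_ge0 => k _; exact: sqr_ge0.
  (* Cauchy-Schwarz in time, as the outer weights are [- lam] times the sum of their gradients. The
     gradient of step [t] is included by means of [mid >= 0], before anything is known about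
     [F (W t.+1)]. *)
  have Ib' : \sum_k outw (W t.+1) k ^+ 2 <= 1.
    have -> : \sum_k outw (W t.+1) k ^+ 2 =
        lam ^+ 2 * \sum_k (\sum_(0 <= s < t.+1) g s k) ^+ 2.
      rewrite mulr_sumr; apply: eq_bigr => k _.
      by rewrite outw_descent exprMn sqrrN.
    apply: (@le_trans _ _ (lam ^+ 2 * \sum_k (t.+1%:R *
       \sum_(0 <= s < t.+1) g s k ^+ 2))).
      rewrite ler_wpM2l ?sqr_ge0//; apply: ler_sum => k _; exact: sqr_sum_nat_le.
    rewrite -mulr_sumr exchange_big /=.
    have h1 : lam / 2 * \sum_(0 <= s < t.+1) \sum_k g s k ^+ 2 <= Fb.
      rewrite big_nat_recr//= mulrDr.
      exact: increment_sum_le Ia (tle1 t tT') mid_le mid0.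
    have h2 : t.+1%:R * lam * (2 * Fb) <= 1.
      by rewrite -mulrA (le_trans (tle t.+1 _ tT F20' FZ)).
    have tl0 : 0 <= t.+1%:R * lam by rewrite mulr_ge0.
    have -> z : lam ^+ 2 * (t.+1%:R * z) = (t.+1%:R * lam) * (2 * (lam / 2 * z)).
      by field.
    by rewrite (le_trans _ h2)// ler_wpM2l// ler_wpM2l.
  have lS0 : 0 <= lam / 2 * \sum_k g t k ^+ 2 by rewrite mulr_ge0// divr_ge0.
  have midg : mid <= F (W t) by rewrite (le_trans mid_le)// gerBl.
  have midF := le_trans midg FB.
  have FS : F (W t.+1) <= mid + lam * Z.
    pose e1 := Lam * (lam * (q * G)).
    have e10 : 0 <= e1 by rewrite mulr_ge0// mulr_ge0// mulr_ge0.
    have e1Q : e1 * (Fb + 2) = lam * Z by rewrite QE /e1 GE; ring.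
    have pert i : (1 <= i <= n)%N ->
        `|comb (outw (W t.+1)) (feat (W t.+1)) i -
          comb (outw (W t.+1)) (feat (W t)) i| <= e1.
      move=> ni.
      rewrite (le_trans (comb_feat_lipschitz r0 rho1 B0 xrho _ (W t.+1) hB ni))//.
      by rewrite ler_wpM2l// gv.
    have := lsq_perturb y n0 pert; rewrite -emp_riskE -/mid.
    by move=> /ler_normlP[_ H]; exact: perturbed_step e10 F0 e1Q lG1 midF H.
  split; last by rewrite (le_trans FS)// lerD2r.
  split => //.
  - rewrite big_nat_recr//= mulrDr -[t.+1%:R]natr1 mulrDl mul1r.
    exact: energy_step Ia mid_le FS.
  - move=> k s; rewrite -(subrKA (wt (W t) (below k s))).
    rewrite (le_trans (ler_normD _ _))// -[t.+1%:R]natr1 mulrDl mul1r addrC lerD//.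
    rewrite (le_trans (gr k s))// ler_wpM2l// ler_piMl//.
    rewrite -(@expr_le1 _ 2)// real_normK ?num_real// (le_trans _ Ib)//.
    by rewrite (bigD1 k)//= lerDl sumr_ge0// => ? _; exact: sqr_ge0.
  - move=> o o1; rewrite -[t.+1%:R]natr1 mulrDl mul1r.
    rewrite (le_trans _ (lerD (Id o o1) (gv o o1)))// -big_split /=.
    apply: ler_sum => k _; rewrite -mulrDr ler_wpM2l// -big_split /=.
    apply: ler_sum => s _; rewrite addrC.
    by rewrite -(subrKA (wt (W t) (below k s))) ler_normD.
have IT t : (t <= T)%N -> Inv t.
  elim: t => [_|t IH tT]; last exact: (step _ tT (IH (ltnW tT))).1.
  split.
  - by rewrite big_geq// mulr0 addr0 mul0r addr0 emp_risk0.
  - by rewrite big1// => k _; rewrite /= w0_out expr0n.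
  - by move=> k s; rewrite /= subrr normr0 mul0r.
  - move=> o _; rewrite mul0r big1// => k _; rewrite /inner_dist big1 ?mulr0//.
    by move=> s _; rewrite /= subrr normr0.
have FT t : (t <= T)%N -> F (W T) <= F (W t) + lam * T%:R * Z.
  move=> tT; suff H j : (t + j <= T)%N -> F (W (t + j)) <= F (W t) + j%:R * (lam * Z).
    have := H (T - t)%N; rewrite subnKC// => /(_ (leqnn _)) /le_trans; apply.
    by rewrite lerD2l tle// leq_subr.
  elim: j => [_|j IH tj]; first by rewrite addn0 mul0r addr0.
  rewrite addnS in tj *; have [_] := step _ tj (IT _ (ltnW tj)).
  have := IH (ltnW tj); rewrite -[j.+1%:R]natr1; lra.
have avgT (f : nat -> R) c : (forall t, (t < T)%N -> f t <= c) ->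
    T%:R^-1 * (\sum_(0 <= t < T) f t) <= c.
  move=> fc; rewrite mulrC ler_pdivrMr ?ltr0n//.
  apply: (@le_trans _ _ (\sum_(0 <= t < T) c)); last first.
    by rewrite sumr_const_nat subn0 mulr_natr.
  by rewrite big_nat [leRHS]big_nat; apply: ler_sum => t /andP[_]; exact: fc.
split.
- have : T%:R^-1 * (\sum_(0 <= t < T) (F (W T) - F (W t))) <= e.
    by apply: avgT => t tT; have := FT t (ltnW tT); lra.
  rewrite sumrB sumr_const_nat subn0 mulrBr -[X in _ * X - _]mulr_natl.
  by rewrite mulKf ?pnatr_eq0 -?lt0n//; lra.
- apply: avgT => t tT; rewrite (le_trans _ lKe)// ler_wpM2l//.
  have gk k : g t k ^+ 2 <= (Fb + 1) ^+ 2.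
    rewrite -real_normK ?num_real// lerXn2r ?nnegrE//; first lra.
    rewrite (le_trans (@norm_lsq_grad_le _ _ _ y n0 _ _ k (norm_feat_le1 r0 x (W t))))//.
    by rewrite -emp_riskE lerD2r IF// ?(ltnW tT)//; exact: IT (ltnW tT).
  apply: (@le_trans _ _ (\sum_(k < K) (Fb + 1) ^+ 2)); first exact: ler_sum.
  by rewrite sumr_const card_ord mulr_natl.
- move=> t o tT o4; have [_ _ _ H] := IT _ tT.
  rewrite (le_trans (H o _))//; first exact: le_trans n21.
  by rewrite (le_trans (tle _ _ tT _ qG))// mulr_ge0.
- move=> t tT; have It := IT _ tT.
  by have [? ?] := IB _ tT It; case: It.
Qed.

End descent_path.

(** * Oracle inequality for the final weights *)

Section descent_oracle.
Context {R : realType} {d L r K : nat} (r0 : (0 < r)%N).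
Implicit Types (w : wvec R d L r K) (k : 'I_K) (o : 'I_K -> R).

Local Notation q := (#|{: nidx d L r}|%:R : R).

Definition sqdist w w' : R := \sum_a (wt w a - wt w' a) ^+ 2.

Lemma enorm_sq (v : wvec R d L r K) :
  enorm (v 0) ^+ 2 = \sum_a (v 0 (enum_rank a)) ^+ 2.
Proof.
rewrite /enorm sqr_sqrtr ?sumr_ge0// => [|i _]; last exact: sqr_ge0.
by rewrite (reindex enum_rank)//; exact/onW_bij/enum_rank_bij.
Qed.

Lemma enormB_sq w w' : enorm ((w - w') 0) ^+ 2 = sqdist w w'.
Proof. by rewrite enorm_sq; apply: eq_bigr => a _; rewrite !mxE. Qed.

Lemma sqdistC w w' : sqdist w w' = sqdist w' w.
Proof. by apply: eq_bigr => a _; rewrite -opprB sqrrN. Qed.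

Lemma sqdist_coord w w' a : (wt w a - wt w' a) ^+ 2 <= sqdist w w'.
Proof.
by rewrite /sqdist (bigD1 a)//= lerDl sumr_ge0// => ? _; exact: sqr_ge0.
Qed.

Lemma sqdist_outw w w' : (forall k, outw w' k = 0) ->
  \sum_k outw w k ^+ 2 <= sqdist w w'.
Proof.
move=> w0; rewrite /sqdist sum_widx (eq_bigr (fun k =>
   (wt w (outer k) - wt w' (outer k)) ^+ 2)).
  by rewrite lerDl !sumr_ge0// => k _; rewrite sumr_ge0// => s _; exact: sqr_ge0.
by move=> k _; have := w0 k; rewrite /outw => ->; rewrite subr0.
Qed.

Lemma sum_inner_dist_le o w w' : \sum_k `|o k| * inner_dist w w' k <=
  (q * \sum_k o k ^+ 2 + sqdist w w') / 2.
Proof.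
rewrite /sqdist sum_widx.
apply: (@le_trans _ _ ((q * \sum_k o k ^+ 2 + \sum_k \sum_s
    (wt w (below k s) - wt w' (below k s)) ^+ 2) / 2)); last first.
  rewrite ler_pM2r// lerD2l lerDr sumr_ge0// => k _; exact: sqr_ge0.
rewrite mulr_sumr -big_split /= mulr_suml; apply: ler_sum => k _.
have -> : q * o k ^+ 2 = \sum_(s : nidx d L r) o k ^+ 2.
  by rewrite sumr_const -[RHS]mulr_natl.
rewrite -big_split /= mulr_suml /inner_dist mulr_sumr; apply: ler_sum => s _.
set a := wt w _ - _; rewrite -(real_normK (num_real (o k))).
rewrite -(real_normK (num_real a)).
by have := sqr_ge0 (`|o k| - `|a|); nra.
Qed.

Section path.
Variables (n : nat) (x : nat -> d.-tuple R) (y : nat -> R).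
Hypothesis n0 : (0 < n)%N.
Local Notation F := (emp_risk r0 n x y).
Local Notation feat := (feat r0 x).
Variables (lam : R) (w0 : wvec R d L r K).
Hypothesis lam0 : 0 < lam.
Local Notation W t := (descent F lam w0 t).
Variables (b A beta rho : R).
Hypotheses (rho1 : 1 <= rho) (b0 : 0 <= b).
Hypothesis xrho : forall i, (1 <= i <= n)%N -> forall j, `|tnth (x i) j| <= rho.
Hypothesis w0_out : forall k, outw w0 k = 0.
Hypothesis w0_hidden : hidden_le b w0.
Hypothesis w0_inner : inner_le A w0.
Local Notation Lam := (@lipc R L r (b + 1) rho).

(** The outer weights [o] of [w] serve as comparator. Replacing the features of [w] by those of an
    iterate moves the output by at most [dl], which is small because the changes are weighted by
    [|o k|]. The loss of [w] is expanded around [mm]: this leaves a cross term with [mm i - y i], of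
    mean zero once [mm] is the regression function. The factor 2 in front of the square comes from
    [(u + v)^2 <= 2 u^2 + 2 v^2]. *)
Lemma good_path_oracle e T w (mm : nat -> R) D (dl := Lam * (e +
    (q + 1) * (2 / n%:R) ^+ 2 / 2)) : (0 < T)%N ->
  good_path r0 n x y lam w0 b A e T -> sqdist w w0 <= (2 / n%:R) ^+ 2 ->
  (forall i, (1 <= i <= n)%N -> `|mm i - y i| <= D) ->
  F (W T) <= lsq n y mm +
   avg n (fun i => 2 * (network r0 w (x i) - mm i) ^+ 2 +
                   2 * ((network r0 w (x i) - mm i) * (mm i - y i))) +
   (2 * e + (2 / n%:R) ^+ 2 / (2 * lam * T%:R) + 2 * dl ^+ 2 + 2 * dl * D).
Proof.
move=> T0 [G1 G2 G3 G4] ww0 mD.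
have B0 : 0 <= b + 1 by rewrite addr_ge0.
have L1 : 1 <= Lam by exact: lipc_ge1.
have L0 : 0 <= Lam by rewrite (le_trans _ L1).
have hB0 : hidden_le (b + 1) w0.
  by move=> l k i j; rewrite (le_trans (w0_hidden l k i j))// lerDl.
set o := outw w.
have o2 : \sum_k o k ^+ 2 <= (2 / n%:R) ^+ 2.
  by rewrite (le_trans _ ww0)// sqdist_outw.
have ndl t i : (t <= T)%N -> (1 <= i <= n)%N ->
    `|comb o (feat (W t)) i - network r0 w (x i)| <= dl.
  move=> tT ni; rewrite -(subrKA (comb o (feat w0) i)).
  rewrite (le_trans (ler_normD _ _))// /dl mulrDr lerD//.
    rewrite (le_trans (comb_feat_lipschitz r0 rho1 B0 xrho o (W t) hB0 ni))//.
    by rewrite ler_wpM2l// G3.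
  rewrite distrC.
  rewrite (le_trans (comb_feat_lipschitz r0 rho1 B0 xrho o w hB0 ni))//.
  rewrite ler_wpM2l// (le_trans (sum_inner_dist_le _ _ _))//.
  by rewrite ler_pM2r// mulrDl mul1r lerD// ler_wpM2l.
set V := avg n _.
have avgD' : 0 <= D by rewrite (le_trans _ (mD 1%N _))// n0.
have H t : (t <= T)%N -> lsq n y (comb o (feat (W t))) <=
    lsq n y mm + V + (2 * dl ^+ 2 + 2 * dl * D).
  move=> tT; rewrite /lsq /V -avgD -[X in _ + X](avg_cst _ n0) -avgD.
  apply: ler_avg => i ni; have := ndl t i tT ni; have := mD i ni.
  set a := comb _ _ _; set f := network _ _ _.
  have -> : a - y i = (a - f) + (f - mm i) + (mm i - y i) by ring.
  set u := a - f; set v := f - mm i; set z := mm i - y i => zD ud.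
  have dl0 : 0 <= dl by rewrite (le_trans _ ud).
  have u2 : u ^+ 2 <= dl ^+ 2.
    by rewrite -real_normK ?num_real// lerXn2r ?nnegrE.
  have uz : u * z <= dl * D.
    by rewrite (le_trans (ler_norm _))// normrM ler_pM.
  have := sqr_ge0 (u - v); rewrite -/z; nra.
have reg := descent_regret r0 n x y w0 lam0 o T.
have T1 : 0 < T%:R :> R by rewrite ltr0n.
have : \sum_(0 <= t < T) F (W t) <= T%:R * (lsq n y mm + V +
   (2 * dl ^+ 2 + 2 * dl * D)) + (2 / n%:R) ^+ 2 / (2 * lam) + T%:R * (e / 2).
  move: reg; rewrite sumrB lerBlDl => /le_trans; apply; rewrite -addrA.
  apply: lerD.
    apply: (@le_trans _ _ (\sum_(0 <= t < T) (lsq n y mm + V +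
      (2 * dl ^+ 2 + 2 * dl * D)))).
      by rewrite big_nat [leRHS]big_nat; apply: ler_sum => t /andP[_ /ltnW]; exact: H.
    by rewrite sumr_const_nat subn0 [leRHS]mulr_natl.
  apply: lerD.
    rewrite ler_pM2r ?invr_gt0 ?mulr_gt0//; apply: le_trans o2.
    by apply: ler_sum => k _; rewrite w0_out sub0r sqrrN.
  move: G2; rewrite -mulr_sumr mulrC ler_pdivrMr//.
  set S := \sum_(0 <= t < T) _; lra.
set U := lsq n y mm + V + _; set c := (2 / n%:R) ^+ 2 => SF.
have : T%:R^-1 * (\sum_(0 <= t < T) F (W t)) <= U + c / (2 * lam * T%:R) + e / 2.
  rewrite mulrC ler_pdivrMr// (le_trans SF)// le_eqVlt; apply/orP; left; apply/eqP.
  by field; rewrite !gt_eqF.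
have e0 : 0 <= e.
  apply: le_trans G2; rewrite mulr_ge0 ?invr_ge0// sumr_ge0// => t _.
  rewrite mulr_ge0 ?(ltW lam0)// sumr_ge0// => k _; exact: sqr_ge0.
move: G1; rewrite /U; lra.
Qed.

End path.

Section stopping.
Variables (n : nat) (x : nat -> d.-tuple R) (y : nat -> R).
Variables (c8 c9 : R) (tmin : nat) (w0 : wvec R d L r K).
Local Notation F := (emp_risk r0 n x y).
Variables (b A beta rho : R).
Hypotheses (n1 : (1 < n)%N) (K0 : (0 < K)%N) (tmin0 : (0 < tmin)%N) (c90 : 0 < c9).
Hypotheses (rho1 : 1 <= rho) (b0 : 0 <= b).
Hypothesis xrho : forall i, (1 <= i <= n)%N -> forall j, `|tnth (x i) j| <= rho.
Hypothesis ybeta : forall i, (1 <= i <= n)%N -> `|y i| <= beta.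
Hypothesis w0_out : forall k, outw w0 k = 0.
Hypothesis w0_hidden : hidden_le b w0.
Hypothesis w0_inner : inner_le A w0.
Hypothesis c80 : 0 <= c8.
Hypothesis ln1 : 1 <= ln (n%:R : R).
Local Notation Lam := (@lipc R L r (b + 1) rho).
Local Notation Fb := (beta ^+ 2 + 1).
Local Notation Q := (q * Lam ^+ 2 * (Fb + 2) ^+ 2).
Hypothesis Qn : 2 / n%:R * Q <= 1.
Hypothesis c9n : c9 * ln n%:R / n%:R <= 1.

(** The summands are the costs of [good_path] in the two cases: the first two when the three
    stopping conditions hold, the last two when the stepsize is so small that [small_step_path]
    applies. *)
Definition path_err : R := c9 / n%:R + (q * (2 / n%:R) ^+ 2 + c9 * ln n%:R / n%:R) +
  2 / n%:R * Q + (Fb + 1) ^+ 2 / n%:R.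

Local Notation idx := (stop_index r0 n x y c8 c9 tmin w0).
Local Notation T := (nsteps (K := K) n c8 tmin idx).
Local Notation lam := (stepsize tmin idx : R).
Let M : R := ln n%:R `^ c8 * K%:R ^+ 3.

Let n0 : (0 < n)%N. Proof. exact: ltnW. Qed.

Lemma M_ge : K%:R <= M /\ 1 <= M.
Proof.
have l1 : 1 <= ln n%:R `^ c8 :> R by rewrite -[leLHS](powRr0 (ln n%:R)) ler_powR.
have K1 : 1 <= K%:R :> R by rewrite ler1n.
have K3 : K%:R <= K%:R ^+ 3 :> R by rewrite -[leLHS]expr1 ler_weXn2l.
have K3M : K%:R ^+ 3 <= M by rewrite /M ler_peMl// exprn_ge0.
by split; [exact: le_trans K3M|rewrite (le_trans K1)// (le_trans K3)].
Qed.

Lemma ceilM_natE : `|Num.ceil M|%:R = (Num.ceil M)%:~R :> R.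
Proof.
have [_ M1] := M_ge; rewrite natr_absz ger0_norm// ceil_ge0.
by rewrite (lt_le_trans _ M1).
Qed.

Lemma nsteps_gt0 : (0 < T)%N.
Proof.
have [_ M1] := M_ge; rewrite /nsteps leq_min; apply/andP; split.
  by rewrite /tcand muln_gt0 expn_gt0 tmin0.
rewrite absz_gt0 gt_eqF// ceil_gt0 -/M; lra.
Qed.

Lemma nsteps_le : T%:R <= 2 * M.
Proof.
have [_ M1] := M_ge; apply: (@le_trans _ _ `|Num.ceil M|%:R).
  by rewrite ler_nat geq_minr.
rewrite ceilM_natE; have := ceilB1_lt M; rewrite intrB; lra.
Qed.

Lemma tcand_gt0 i : (0 < tcand tmin i)%N.
Proof. by rewrite /tcand muln_gt0 expn_gt0 tmin0. Qed.

(** The quotient of the two sides bounds [1 / (lam * T)], the weight of the initial distance in the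
    regret. If the minimum defining [T] is the candidate itself, the claim is immediate. Otherwise
    [T >= M], and either the candidate is [tmin], or the previous one, half as large, failed to
    reach [n * M]. *)
Lemma tcand_le : (tcand tmin idx)%:R <= (2 * n%:R + tmin%:R) * T%:R :> R.
Proof.
have [_ minT] := stop_ex r0 n x y c8 c9 w0 tmin0; have [_ M1] := M_ge.
have T1 : 1 <= T%:R :> R by rewrite ler1n nsteps_gt0.
have n1' : 1 <= n%:R :> R by rewrite ler1n.
have t0 : 1 <= tmin%:R :> R by rewrite ler1n.
have TE : T = minn (tcand tmin idx) `|Num.ceil M| by [].
have [tc|tc] := leqP (tcand tmin idx) `|Num.ceil M|.
  by move: T1; rewrite TE (minn_idPl tc) => T1; rewrite ler_peMl//; nra.
have TM : M <= T%:R by rewrite TE (minn_idPr (ltnW tc)) ceilM_natE ceil_ge.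
case idxE: idx minT => [|i] minT.
  rewrite idxE in T1; rewrite /tcand expn0 mul1n.
  by rewrite (@le_trans _ _ (2 * n%:R + tmin%:R))// ?ler_peMr//; lra.
have := minT i (leqnn _); rewrite /stop => /not_orP[_ /negP].
rewrite -ltNge -mulrA -/M => ti.
have -> : (tcand tmin i.+1)%:R = 2 * (tcand tmin i)%:R :> R.
  by rewrite /tcand expnS -mulnA natrM.
rewrite idxE in TM T1 *; nra.
Qed.

Lemma stepsize_gt0 : 0 < lam.
Proof. by rewrite invr_gt0 ltr0n tcand_gt0. Qed.

Lemma path_err_ge0 : 0 <= path_err.
Proof.
rewrite /path_err; have ni : 0 <= n%:R^-1 :> R by rewrite invr_ge0.
have q2 : 0 <= q * (2 / n%:R) ^+ 2 by rewrite mulr_ge0// sqr_ge0.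
have Q0 : 0 <= Q by rewrite mulr_ge0 ?sqr_ge0// mulr_ge0// sqr_ge0.
have c1 : 0 <= c9 / n%:R by rewrite mulr_ge0// ltW.
have c2 : 0 <= c9 * ln n%:R / n%:R by rewrite mulr_ge0// mulr_ge0 ?(ltW c90)// (le_trans _ ln1).
have Q1 : 0 <= 2 / n%:R * Q by rewrite mulr_ge0// mulr_ge0.
have : 0 <= (Fb + 1) ^+ 2 / n%:R by rewrite mulr_ge0// sqr_ge0.
lra.
Qed.

Lemma final_path_good : good_path r0 n x y lam w0 b A path_err T.
Proof.
have [st _] := stop_ex r0 n x y c8 c9 w0 tmin0; have [KM M1] := M_ge.
have lam0 := stepsize_gt0.
have B0 : 0 <= b + 1 by rewrite addr_ge0.
have L1 : 1 <= Lam by exact: lipc_ge1.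
have n1' : 1 <= n%:R :> R by rewrite ler1n.
have n0' : 0 < n%:R :> R by rewrite ltr0n.
have ni0 : 0 <= n%:R^-1 :> R by rewrite invr_ge0.
have Q0 : 0 <= Q by rewrite mulr_ge0 ?sqr_ge0// mulr_ge0// sqr_ge0.
have n21 : (2 / n%:R) ^+ 2 <= 1 :> R.
  rewrite exprn_ile1//.
  by rewrite ler_pdivrMr// mul1r ler_nat.
have e1 : 0 <= c9 / n%:R by rewrite mulr_ge0// ltW.
have e2 : 0 <= q * (2 / n%:R) ^+ 2 by rewrite mulr_ge0// sqr_ge0.
have e3 : 0 <= c9 * ln n%:R / n%:R by rewrite mulr_ge0// mulr_ge0 ?(ltW c90)// (le_trans _ ln1).
have e4 : 0 <= 2 / n%:R * Q by rewrite mulr_ge0// mulr_ge0.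
have e5 : 0 <= (Fb + 1) ^+ 2 / n%:R by rewrite mulr_ge0// sqr_ge0.
case: st => [[s1 s2 s3]|s].
  have dist t : (t <= T)%N ->
      sqdist (descent F lam w0 t) w0 <= c9 * ln n%:R / n%:R.
    case: t => [|t] tT.
      by rewrite /sqdist big1// => a _; rewrite /= subrr expr0n.
    rewrite sqdistC -enormB_sq; apply: le_trans s3.
    apply: (le_bigmax_seq 0 t.+1 xpredT
      (fun t => enorm ((w0 - iterate r0 n x y tmin w0 idx t) 0) ^+ 2)) => //.
    by rewrite mem_index_iota.
  split.
  - rewrite (le_trans s2)// lerD2l /path_err; lra.
  - apply: (@le_trans _ _ (c9 / n%:R)); last by rewrite /path_err; lra.
    apply: le_trans s1; rewrite ler_wpM2l ?invr_ge0//; apply: ler_sum => t _.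
    rewrite ler_wpM2l ?(ltW lam0)// enorm_sq sum_widx.
    rewrite (eq_bigr (fun k => grad F (descent F lam w0 t) 0
       (enum_rank (outer k)) ^+ 2)).
      rewrite lerDl !sumr_ge0// => k _; rewrite sumr_ge0// => ? _; exact: sqr_ge0.
    by move=> k _; rewrite grad_outer.
  - move=> t o tT o4; rewrite (le_trans (sum_inner_dist_le _ _ _))//.
    have := dist t tT; have : q * \sum_k o k ^+ 2 <= q * (2 / n%:R) ^+ 2.
      by rewrite ler_wpM2l.
    rewrite /path_err; lra.
  - move=> t tT; have dt : sqdist (descent F lam w0 t) w0 <= 1.
      by rewrite (le_trans (dist t tT)).
    have cd a : `|wt (descent F lam w0 t) a - wt w0 a| <= 1.
      rewrite -(@expr_le1 _ 2)// real_normK ?num_real//.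
      by rewrite (le_trans _ dt)// sqdist_coord.
    have [h1 h2] := @below_bounds _ _ _ _ _ r0 n x y lam w0 b A w0_hidden
      w0_inner t 1 (lexx _) (fun k s => cd (below k s)).
    by split => //; rewrite (le_trans (sqdist_outw _ w0_out)).
(* The search ended with a candidate of at least [n * M]. As [T <= 2 * M], the total time [lam * T]
   of the path is at most [2 / n]. *)
have lamM : lam * (n%:R * M) <= 1.
  rewrite mulrC ler_pdivrMr ?ltr0n ?tcand_gt0// mul1r.
  by rewrite mulrA.
have lamT : lam * T%:R <= 2 / n%:R.
  rewrite ler_pdivlMr// (@le_trans _ _ (lam * (2 * M) * n%:R))//.
    by rewrite ler_pM2r// ler_pM2l// nsteps_le.
  by rewrite (_ : _ * _ = 2 * (lam * (n%:R * M))); [lra|ring].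
have lamK : lam * K%:R <= n%:R^-1.
  rewrite -[leRHS]mul1r ler_pdivlMr// -mulrA (mulrC K%:R).
  by rewrite (le_trans _ lamM)// ler_pM2l// ler_pM2l.
have TQ : lam * T%:R * Q <= 2 / n%:R * Q by rewrite ler_wpM2r.
apply: (@small_step_path _ _ _ _ _ r0 n x y n0 lam w0 lam0 b A beta rho) => //.
- exact: nsteps_gt0.
- by rewrite (le_trans lamK)// lef_pV2 ?posrE// ler_nat.
- exact: le_trans Qn.
- by rewrite (le_trans TQ)// /path_err; lra.
- rewrite mulrA; have : lam * K%:R * (Fb + 1) ^+ 2 <= n%:R^-1 * (Fb + 1) ^+ 2.
    by rewrite ler_wpM2r// sqr_ge0.
  rewrite /path_err; lra.
Qed.

(* Either the three stopping conditions hold, or the stepsize is so small that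
   the whole path stays near its start; both give a [good_path]. *)
Lemma final_weights_oracle (w' := final_weights r0 n x y c8 c9 tmin w0) :
  [/\ inner_le (A + 1) w', hidden_le (b + 1) w', \sum_k outw w' k ^+ 2 <= 1
    & forall w (mm : nat -> R) D (dl := Lam * (path_err +
         (q + 1) * (2 / n%:R) ^+ 2 / 2)),
      sqdist w w0 <= (2 / n%:R) ^+ 2 ->
      (forall i, (1 <= i <= n)%N -> `|mm i - y i| <= D) ->
      F w' <= lsq n y mm +
        avg n (fun i => 2 * (network r0 w (x i) - mm i) ^+ 2 +
                   2 * ((network r0 w (x i) - mm i) * (mm i - y i))) +
        (2 * path_err + (2 * n%:R + tmin%:R) * 2 / n%:R ^+ 2 +
          2 * dl ^+ 2 + 2 * dl * D)].
Proof.
have G := final_path_good; have [_ _ _ /(_ T (leqnn _)) [h1 h2 h3]] := G.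
split=> // w mm D dl ww0 mD; have T0 := nsteps_gt0.
have := good_path_oracle n0 stepsize_gt0 rho1 b0 xrho w0_out w0_hidden T0 G ww0 mD.
move=> /le_trans; apply; rewrite lerD2l -/dl !lerD2r lerD2l.
have n0' : 0 < n%:R :> R by rewrite ltr0n.
have T0' : 0 < T%:R :> R by rewrite ltr0n.
have t0' : 0 < (tcand tmin idx)%:R :> R by rewrite ltr0n tcand_gt0.
rewrite [leLHS](_ : _ = 2 / n%:R ^+ 2 * ((tcand tmin idx)%:R / T%:R)); last first.
  by rewrite /stepsize; field; rewrite !gt_eqF.
rewrite [leRHS](_ : _ = 2 / n%:R ^+ 2 * (2 * n%:R + tmin%:R)); last by ring.
rewrite ler_wpM2l ?divr_ge0 ?exprn_ge0// ler_pdivrMr//.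
exact: tcand_le.
Qed.

End stopping.

End descent_oracle.

(** * Independence and regression functions *)

Section weight_ext.
Context {R : realType} {dT dS : measure_display}.
Context {T : measurableType dT} {S : measurableType dS}.
Variables (mu : {measure set T -> \bar R}) (X : T -> S).
Hypothesis mX : measurable_fun setT X.
Implicit Types (U V : T -> R) (g : S -> R).

Import HBNNSimple.

Lemma integral_weight_approx g U (mg : measurable_fun setT (EFin \o g)) :
  measurable_fun setT U -> (forall t, 0 <= U t) -> (forall s, 0 <= g s) ->
  (\int[mu]_t (g (X t) * U t)%:E = limn (fun n =>
     \sum_(y \in range (nnsfun_approx measurableT mg n))
       (\int[mu]_t (y * (\1_(nnsfun_approx measurableT mg n @^-1` [set y]) (X t)
          * U t))%:E)))%E.
Proof.
move=> mU U0 g0; set h := nnsfun_approx measurableT mg.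
have hg s : (EFin \o h ^~ s) @ \oo --> (g s)%:E.
  by apply: (@cvg_nnsfun_approx _ _ _ _ measurableT _ mg) => // ?; rewrite lee_fin.
have -> : (\int[mu]_t (g (X t) * U t)%:E =
    limn (fun n => \int[mu]_t (h n (X t) * U t)%:E))%E.
  have gE t : ((g (X t) * U t)%:E = limn (fun n => (h n (X t) * U t)%:E))%E.
    apply/esym/cvg_lim => //.
    rewrite (_ : (fun _ => _) = (fun n => (h n (X t))%:E * (U t)%:E)%E).
      by rewrite EFinM; apply: cvgeZr => //; exact: hg.
    by apply/funext => n; rewrite EFinM.
  under eq_integral do rewrite gE.
  apply: monotone_convergence => //.
  - move=> n; apply/measurable_EFinP; apply: measurable_funM => //.
    exact: measurableT_comp.
  - by move=> n t _; rewrite lee_fin mulr_ge0.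
  - move=> t _ a b ab; rewrite lee_fin ler_wpM2r//.
    exact/lefP/nd_nnsfun_approx.
congr (limn _); apply/funext => n.
rewrite -ge0_integral_fsum//.
- apply: eq_integral => t _; rewrite fsumEFin//; congr (_%:E).
  rewrite (fimfunE (h n) (X t)) mulr_fsuml.
  by apply: eq_fsbigr => y _; rewrite mulrA.
- move=> y; apply/measurable_EFinP; apply: measurable_funM => //.
  apply: measurable_funM => //; apply: measurableT_comp => //.
- move=> y t _; rewrite lee_fin mulrA mulr_ge0//.
  have := nnfun_muleindic_ge0 (h n) y (X t); by rewrite lee_fin.
Qed.

(** [U] and [V] act as densities whose images under [X] agree on sets, hence on nonnegative
    functions. A constant [V] yields factorization under independence; a random [V] yields the
    orthogonality of the regression residual. *)
Lemma integral_weight_ext U V : measurable_fun setT U -> measurable_fun setT V ->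
  (forall t, 0 <= U t) -> (forall t, 0 <= V t) ->
  (forall A, measurable A ->
     \int[mu]_t (\1_A (X t) * U t)%:E = \int[mu]_t (\1_A (X t) * V t)%:E)%E ->
  forall g, measurable_fun setT g -> (forall s, 0 <= g s) ->
  (\int[mu]_t (g (X t) * U t)%:E = \int[mu]_t (g (X t) * V t)%:E)%E.
Proof.
move=> mU mV U0 V0 UV g mg g0.
have mg' : measurable_fun setT (EFin \o g) by exact/measurable_EFinP.
rewrite !(integral_weight_approx mg')//; congr (limn _); apply/funext => n.
apply: eq_fsbigr => y _.
set h := nnsfun_approx _ _ _.
have mh : measurable (h @^-1` [set y]) by exact: measurable_funPTI.
have [y0|y0] := leP 0 y.
  have M (W : T -> R) : measurable_fun setT W ->
      measurable_fun setT (fun t => (\1_(h @^-1` [set y]) (X t) * W t)%:E).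
    move=> mW; apply/measurable_EFinP; apply: measurable_funM => //.
    exact: measurableT_comp.
  under eq_integral do rewrite EFinM.
  under [RHS]eq_integral do rewrite EFinM.
  rewrite !ge0_integralZl_EFin//; try exact: M;
    try (by move=> t _; rewrite lee_fin mulr_ge0).
  by rewrite UV.
have -> : h @^-1` [set y] = set0.
  by rewrite preimage10// => -[s _] hs; move: y0; rewrite -hs ltNge fun_ge0.
by under eq_integral do rewrite indic0 mul0r mulr0;
   under [RHS]eq_integral do rewrite indic0 mul0r mulr0.
Qed.

End weight_ext.

Section independence.
Context {R : realType} {dT : measure_display} {T : measurableType dT}.
Variable P : probability T R.

Lemma mutually_independent_seq (J : choiceType) (G : J -> set_system T) :
  mutually_independent P G -> forall (s : seq J) (E : J -> set T), uniq s ->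
  (forall j, j \in s -> G j (E j)) ->
  (P (\bigcap_(j in [set` s]) E j) = \prod_(j <- s) P (E j))%E.
Proof.
move=> ind s E us GE.
have := ind [fset j in s]%fset E.
rewrite (_ : [set` [fset j in s]%fset] = [set` s]); last first.
  by apply/seteqP; split => j /=; rewrite inE.
move=> ->; last by move=> j; rewrite inE; exact: GE.
apply: perm_big; apply: uniq_perm => // j.
by rewrite inE.
Qed.

Context {dS : measure_display} {S : measurableType dS} {I : choiceType}.
Variables (Z : I -> T -> S).
Hypothesis mZ : forall i, measurable_fun setT (Z i).

(** As some [E i] may be the whole space, the product rule along [s] contains the rule for every
    subsequence of [s]. *)
Definition independent_along (s : seq I) : Prop :=
  forall E : I -> set S, (forall i, measurable (E i)) ->
  (P (\bigcap_(i in [set` s]) Z i @^-1` E i) =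
     \prod_(i <- s) P (Z i @^-1` E i))%E.

Lemma independent_along_perm (s s' : seq I) :
  perm_eq s s' -> independent_along s -> independent_along s'.
Proof.
move=> ss ind E mE; rewrite -(perm_big _ ss) /= -ind//; congr (P _).
by apply/seteqP; split => t H i /= ii; apply: H => /=;
  rewrite ?(perm_mem ss)// -(perm_mem ss).
Qed.

Lemma integral_prod_independent (s : seq I) (h : I -> S -> R) (e : I -> R) :
  uniq s -> independent_along s ->
  (forall i, measurable_fun setT (h i)) -> (forall i z, 0 <= h i z) ->
  (forall i, \int[P]_t (h i (Z i t))%:E = (e i)%:E)%E ->
  (\int[P]_t (\prod_(i <- s) h i (Z i t))%:E = (\prod_(i <- s) e i)%:E)%E.
Proof.
move=> us ind mh h0 he.
have e0 i : 0 <= e i.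
  by rewrite -lee_fin -he integral_ge0// => t _; rewrite lee_fin.
(* Indicators are turned into functions one factor at a time: [a] lists the indices that carry
   [h i], [b] those that still carry an indicator. *)
suff H (a b : seq I) (E : I -> set S) : (forall i, measurable (E i)) ->
    uniq (a ++ b) -> independent_along (a ++ b) ->
    (\int[P]_t (\prod_(i <- a) h i (Z i t) *
       \prod_(i <- b) \1_(E i) (Z i t))%:E =
     (\prod_(i <- a) e i)%:E * \prod_(i <- b) P (Z i @^-1` E i))%E.
  have := H s [::] (fun=> setT) (fun=> measurableT).
  rewrite cats0 !big_nil mule1 => <- //.
  by apply: eq_integral => t _; rewrite big_nil mulr1.
elim: a b E => [|i a IH] b E mE uab iab.
  have mB : measurable (\bigcap_(i in [set` b]) Z i @^-1` E i).
    apply: fin_bigcap_measurable => // i _; rewrite -[X in measurable X]setTI.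
    exact: mZ.
  rewrite big_nil mul1e -(iab E mE) -[X in P X]setIT -integral_indic//.
  apply: eq_integral => t _; rewrite big_nil mul1r indicE; congr (_%:E).
  have [tb|tb] := boolP (t \in _).
    rewrite big_seq big1// => i ib; rewrite indicE mem_set//.
    by move/set_mem: tb => /(_ i ib).
  have [i ib Ei] : exists2 i, i \in b & ~ E i (Z i t).
    move: tb; rewrite notin_setE => tb; apply: contrapT => H; apply: tb => i ib.
    by apply: contrapT => Ei; apply: H; exists i.
  by rewrite (big_rem i)//= indicE memNset// mul0r.
pose c := (\prod_(j <- a) e j) * fine (\prod_(j <- b) P (Z j @^-1` E j)).
have prodE : (\prod_(j <- b) P (Z j @^-1` E j))%E \is a fin_num.
  elim/big_ind: _ => // [u v|j _]; first exact: fin_numM.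
  by apply: fin_num_measure; rewrite -[X in measurable X]setTI; exact: mZ.
have c0 : 0 <= c.
  by rewrite mulr_ge0 ?prodr_ge0// fine_ge0// prode_ge0.
have mprodh (r : seq I) : measurable_fun setT (fun t => \prod_(j <- r) h j (Z j t)).
  apply: measurable_prod => j _; exact: measurableT_comp.
have mprod1 (r : seq I) E' : (forall j, measurable (E' j)) ->
    measurable_fun setT (fun t => \prod_(j <- r) \1_(E' j) (Z j t) : R).
  move=> mE'; apply: measurable_prod => j _; exact: measurableT_comp.
have ia : i \notin a ++ b by move: uab; rewrite /= => /andP[].
have := @integral_weight_ext _ _ _ _ _ P (Z i) (mZ i)
  (fun t => \prod_(j <- a) h j (Z j t) * \prod_(j <- b) \1_(E j) (Z j t))
  (fun=> c) _ _ _ _ _ (h i) (mh i) (h0 i).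
move=> ext; transitivity (\int[P]_t (h i (Z i t) * c)%:E)%E.
  rewrite -ext.
  - by apply: eq_integral => t _; rewrite big_cons mulrA.
  - by apply: measurable_funM; [exact: mprodh|exact: mprod1].
  - exact: measurable_cst.
  - by move=> t; rewrite mulr_ge0// prodr_ge0// => j _; rewrite ?h0 ?indicE.
  - by [].
  move=> A mA.
  pose E' j := if j == i then A else E j.
  have mE' j : measurable (E' j) by rewrite /E'; case: ifP.
  have := IH (i :: b) E' mE'.
  have pe : perm_eq (i :: a ++ b) (a ++ i :: b) by rewrite -cat1s perm_catCA.
  rewrite -(perm_uniq pe) => /(_ uab (independent_along_perm pe iab)).
  have E'E j : j \in b -> E' j = E j.
    rewrite /E'; case: eqP => // -> ib.
    by move: ia; rewrite mem_cat ib orbT.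
  rewrite !big_cons; under [in X in X = _ -> _]eq_integral do rewrite big_cons.
  have -> : (\prod_(j <- b) P (Z j @^-1` E' j) = \prod_(j <- b) P (Z j @^-1` E j))%E.
    by rewrite big_seq [RHS]big_seq; apply: eq_bigr => j jb; rewrite E'E.
  have EE t : \prod_(j <- b) \1_(E' j) (Z j t) = \prod_(j <- b) \1_(E j) (Z j t) :> R.
    by rewrite big_seq [RHS]big_seq; apply: eq_bigr => j jb; rewrite E'E.
  rewrite {1 3}/E' eqxx => H.
  transitivity ((\prod_(j <- a) e j)%:E *
    (P (Z i @^-1` A) * \prod_(j <- b) P (Z j @^-1` E j)))%E.
    by rewrite -H; apply: eq_integral => t _; rewrite EE; congr (_%:E); ring.
  have mA' : measurable (Z i @^-1` A) by rewrite -[X in measurable X]setTI; exact: mZ.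
  under eq_integral do rewrite mulrC EFinM.
  rewrite ge0_integralZl_EFin//.
  - rewrite (_ : (fun t => _) = EFin \o \1_(Z i @^-1` A)); last by [].
    rewrite integral_indic// setIT /c EFinM fineK// -!muleA.
    by congr (_ * _)%E; rewrite muleC.
  - apply/measurable_EFinP; exact: measurableT_comp.
under eq_integral do rewrite mulrC EFinM.
rewrite ge0_integralZl_EFin//.
- by rewrite he /c big_cons !EFinM fineK// muleC muleA.
- by move=> t _; rewrite lee_fin.
- apply/measurable_EFinP; exact: measurableT_comp.
Qed.

End independence.

Section integral_tools.
Context {R : realType} {dT : measure_display} {T : measurableType dT}.
Variable P : probability T R.
Implicit Types f g : T -> R.

(** The integral of a nonnegative function is a supremum over simple functions below it, hence
    monotone for arbitrary functions. This is how the estimate and the infimum over weights are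
    compared with measurable functions. *)
Lemma ge0_le_integralT (f g : T -> \bar R) :
  (forall t, 0 <= f t)%E -> (forall t, f t <= g t)%E ->
  (\int[P]_t f t <= \int[P]_t g t)%E.
Proof.
move=> f0 fg; have g0 t : (0 <= g t)%E by exact: le_trans (fg t).
rewrite !ge0_integralTE//; apply: le_ereal_sup => _ [h hf <-].
by exists h => // t; exact: le_trans (fg t).
Qed.

Lemma bounded_integrable f c : measurable_fun setT f -> (forall t, `|f t| <= c) ->
  P.-integrable setT (EFin \o f).
Proof.
move=> mf fc; apply: (@le_integrable _ _ _ _ _ measurableT _ (EFin \o cst c)).
- exact/measurable_EFinP.
- by move=> t _ /=; rewrite lee_fin (le_trans (fc t))// ler_norm.
- exact: finite_measure_integrable_cst.
Qed.

Lemma ge0_integrable_lty f : measurable_fun setT f -> (forall t, 0 <= f t) ->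
  (\int[P]_t (f t)%:E < +oo)%E -> P.-integrable setT (EFin \o f).
Proof.
move=> mf f0 foo; apply/integrableP; split; first exact/measurable_EFinP.
by under eq_integral do rewrite /= ger0_norm//.
Qed.

Lemma dominated_integrable f g : measurable_fun setT f ->
  (forall t, `|f t| <= g t) -> P.-integrable setT (EFin \o g) ->
  P.-integrable setT (EFin \o f).
Proof.
move=> mf fg; apply: le_integrable => //; first exact/measurable_EFinP.
by move=> t _ /=; rewrite lee_fin (le_trans (fg t))// ler_norm.
Qed.

Lemma EFin_Rintegral f : P.-integrable setT (EFin \o f) ->
  (\int[P]_t (f t)%:E = (\int[P]_t f t)%R%:E)%E.
Proof. by move=> fi; rewrite fineK// integrable_fin_num. Qed.

Lemma integral_cstT (c : R) : (\int[P]_t c%:E = c%:E)%E.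
Proof.
rewrite integral_cst//; transitivity (c%:E * 1)%E; last by rewrite mule1.
by congr (_ * _)%E; exact: probability_setT.
Qed.

Lemma Rintegral_cstT c : (\int[P]_t c = c)%R.
Proof.
rewrite Rintegral_cst// (_ : fine _ = 1) ?mulr1//.
exact: (congr1 fine (probability_setT P)).
Qed.

End integral_tools.

(** * Identically distributed data and the regression function *)

Section sample.
Context {R : realType} {dT : measure_display} {T : measurableType dT}.
Variable P : probability T R.
Context {d : nat}.
Variables (X : nat -> {RV P >-> d.-tuple R}) (Y : nat -> {RV P >-> R}).
Hypothesis XY_ident : forall i, identically_distributed P
  (fun t => (X i t, Y i t)) (fun t => (X 0%N t, Y 0%N t)).
Local Notation S := (d.-tuple R * R)%type.

Definition pair_rv (i : nat) (t : T) : S := (X i t, Y i t).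

Lemma measurable_pair_rv i : measurable_fun setT (pair_rv i).
Proof. exact: measurable_fun_pair. Qed.

Lemma ge0_integral_ident (h : S -> R) i : measurable_fun setT h ->
  (forall z, 0 <= h z) ->
  (\int[P]_t (h (pair_rv i t))%:E = \int[P]_t (h (pair_rv 0 t))%:E)%E.
Proof.
move=> mh h0.
have mh' : measurable_fun setT (EFin \o h) by exact/measurable_EFinP.
pose Z j : {mfun T >-> S} := HB.pack (pair_rv j)
  (isMeasurableFun.Build _ _ _ _ _ (measurable_pair_rv j)).
have H j : (\int[P]_t (h (pair_rv j t))%:E =
    \int[distribution P (Z j)]_z (EFin \o h) z)%E.
  by rewrite ge0_integral_distribution// => z; rewrite lee_fin.
rewrite !H.
apply: eq_measure_integral => A mA _; exact: XY_ident.
Qed.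

Variable (m : d.-tuple R -> R) (M : R).
Hypothesis m_regression : regression_function (X 0%N) (Y 0%N) m.
Hypothesis mM : forall x, `|m x| <= M.
Hypothesis Y_int : P.-integrable setT (EFin \o Y 0%N).

Lemma measurable_regression : measurable_fun setT m.
Proof. by case: m_regression. Qed.

Lemma bounded_mul_integrable (f : d.-tuple R -> R) (U : T -> R) c :
  measurable_fun setT f -> (forall x, `|f x| <= c) ->
  P.-integrable setT (EFin \o U) ->
  P.-integrable setT (EFin \o (fun t => f (X 0%N t) * U t)).
Proof.
move=> mf fc Ui; have mU : measurable_fun setT U.
  by apply/measurable_EFinP; exact: measurable_int Ui.
have cUi : P.-integrable setT (EFin \o (fun t => c * `|U t|)).
  rewrite (_ : _ \o _ = (fun t => c%:E * (EFin \o (fun t => `|U t|%R)) t)%E)//.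
  by apply: integrableZl => //; exact: integrable_norm.
apply: dominated_integrable cUi.
  by apply: measurable_funM => //; exact: measurableT_comp.
by move=> t; rewrite normrM ler_wpM2r.
Qed.

Let mX := [the {mfun T >-> d.-tuple R} of X 0%N].

(** [integral_weight_ext] handles nonnegative functions and weights only. So [f] is first shifted by
    its bound, the shift being an instance of the claim itself, and the residual [Y - m(X)] is
    written as a difference [U - V] of nonnegative weights; for indicators the equality is the
    definition of [m]. *)
Lemma regression_orthogonal (f : d.-tuple R -> R) c : measurable_fun setT f ->
  (forall x, `|f x| <= c) ->
  (\int[P]_t (f (X 0%N t) * (m (X 0%N t) - Y 0%N t)) = 0)%R.
Proof.
have mm := measurable_regression.
have M0 : 0 <= M by rewrite (le_trans _ (mM [tuple 0 | _ < d])).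
have mXi : P.-integrable setT (EFin \o (fun t => m (X 0%N t))).
  by apply: (@bounded_integrable _ _ _ _ _ M) => //; exact: measurableT_comp.
have Dint : P.-integrable setT (EFin \o (fun t => m (X 0%N t) - Y 0%N t)).
  by rewrite (_ : _ \o _ = (EFin \o (fun t => m (X 0%N t))) \- (EFin \o Y 0%N))%E//;
     apply: integrableB.
wlog f0 : f c / forall x, 0 <= f x.
  move=> H mf fc.
  have h1 : (\int[P]_t ((f (X 0%N t) + c) * (m (X 0%N t) - Y 0%N t)) = 0)%R.
    apply: (H (fun x => f x + c) (c + c)) => [x||x].
    - by have /ler_normlP[] := fc x; lra.
    - exact: measurable_funD.
    - have /ler_normlP[? ?] := fc x; rewrite ger0_norm; lra.
  have c0 : 0 <= c by rewrite (le_trans _ (fc [tuple 0 | _ < d])).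
  have h2 : (\int[P]_t (c * (m (X 0%N t) - Y 0%N t)) = 0)%R.
    by apply: (H (fun=> c) c) => // x; rewrite ger0_norm.
  rewrite -[RHS](subrr 0) -{1}h1 -h2 -RintegralB//.
  - by apply: eq_Rintegral => t _; ring.
  - apply: (@bounded_mul_integrable (fun x => f x + c) _ (c + c)) => //.
      exact: measurable_funD.
    by move=> x; have /ler_normlP[? ?] := fc x; rewrite ger0_norm; lra.
  - apply: (@bounded_mul_integrable (fun x => c) _ c) => //.
    by move=> x; rewrite ger0_norm.
move=> mf fc.
pose U t := Num.max (Y 0%N t) 0 + (M - m (X 0%N t)).
pose V t := Num.max (- Y 0%N t) 0 + M.
have mU : measurable_fun setT U.
  apply: measurable_funD; first exact: measurable_maxr.
  by apply: measurable_funB => //; exact: measurableT_comp.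
have mV : measurable_fun setT V.
  apply: measurable_funD => //; apply: measurable_maxr => //.
  exact: measurableT_comp.
have U0 t : 0 <= U t.
  rewrite addr_ge0 ?subr_ge0//; first by rewrite le_max lexx orbT.
  exact: le_trans (ler_norm _) (mM _).
have V0 t : 0 <= V t by rewrite addr_ge0// le_max lexx orbT.
have UV t : U t - V t = Y 0%N t - m (X 0%N t).
  by rewrite /U /V /Order.max; case: ifP; case: ifP; lra.
have nY : P.-integrable setT (EFin \o (fun t => `|Y 0%N t| + (M + M))).
  rewrite (_ : _ \o _ = (EFin \o (fun t => `|Y 0%N t|%R)) \+ (EFin \o cst (M + M)%R))%E//.
  apply: integrableD => //; first exact: integrable_norm.
  exact: finite_measure_integrable_cst.
have Ui : P.-integrable setT (EFin \o U).
  apply: dominated_integrable nY => // t; rewrite ger0_norm// lerD//.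
    by rewrite ge_max ler_norm normr_ge0.
  by rewrite lerD2l; have /ler_normlP[? ?] := mM (X 0%N t).
have Vi : P.-integrable setT (EFin \o V).
  apply: dominated_integrable nY => // t; rewrite ger0_norm// lerD//.
    by rewrite ge_max -normrN ler_norm normr_ge0.
  by rewrite lerDl.
have fUi := bounded_mul_integrable mf fc Ui.
have fVi := bounded_mul_integrable mf fc Vi.
have : (\int[P]_t (f (X 0%N t) * U t)%:E = \int[P]_t (f (X 0%N t) * V t)%:E)%E.
  apply: integral_weight_ext => // A mA.
  have mA' : measurable_fun setT (\1_A : _ -> R) by exact: measurable_indic.
  have A1 x : `|\1_A x| <= 1 :> R by rewrite indicE; case: (_ \in _); rewrite ?normr1 ?normr0.
  have AUi := bounded_mul_integrable mA' A1 Ui.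
  have AVi := bounded_mul_integrable mA' A1 Vi.
  have AYi := bounded_mul_integrable mA' A1 Y_int.
  have Ami := bounded_mul_integrable mA' A1 mXi.
  rewrite !EFin_Rintegral//; congr (_%:E); apply/eqP.
  rewrite -subr_eq0 -RintegralB//.
  rewrite (@eq_Rintegral _ _ _ P setT (fun t => \1_A (X 0%N t) * Y 0%N t - \1_A (X 0%N t) * m (X 0%N t))).
    rewrite RintegralB// subr_eq0; apply/eqP.
    apply: EFin_inj; rewrite -!EFin_Rintegral//.
    have [_ _ /(_ A mA)] := m_regression.
    have indE (mu : {measure set T -> \bar R}) B (f' : T -> R) :
        (\int[mu]_(t in B) (f' t)%:E = \int[mu]_t (\1_B t * f' t)%:E)%E.
      rewrite integral_mkcond; apply: eq_integral => t _.
      by rewrite patchE indicE; case: ifPn => _; rewrite ?mul1r ?mul0r.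
    have indE' (mu : {measure set (d.-tuple R) -> \bar R}) B (f' : d.-tuple R -> R) :
        (\int[mu]_(t in B) (f' t)%:E = \int[mu]_t (\1_B t * f' t)%:E)%E.
      rewrite integral_mkcond; apply: eq_integral => t _.
      by rewrite patchE indicE; case: ifPn => _; rewrite ?mul1r ?mul0r.
    rewrite indE' indE => <-.
    rewrite integral_distribution//.
    by apply/measurable_EFinP; exact: measurable_funM.
  by move=> t _; rewrite -!mulrBr UV.
rewrite !EFin_Rintegral// => -[] UVE.
rewrite (@eq_Rintegral _ _ _ P setT (fun t => f (X 0%N t) * V t - f (X 0%N t) * U t)).
  by rewrite RintegralB// UVE subrr.
by move=> t _; rewrite -mulrBr -[V t - _]opprB UV opprB.
Qed.

End sample.

(** * A deviation inequality for the excess risk *)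

Section exponential_inequalities.
Context {R : realType}.
Implicit Types x : R.

Lemma expR_le_quadratic x : x <= 2^-1 -> expR x <= 1 + x + 2 * x ^+ 2.
Proof.
move=> x2; have h : 1 - x <= expR (- x) by exact: expR_ge1Dx.
have x1 : 0 < 1 - x by lra.
have -> : expR x = (expR (- x))^-1 by rewrite expRN invrK.
rewrite (@le_trans _ _ (1 - x)^-1)//; first by rewrite lef_pV2 ?posrE ?expR_gt0.
rewrite -[leLHS]mul1r ler_pdivrMr// expr2.
by have := sqr_ge0 x; rewrite expr2; nra.
Qed.

Lemma le_expR x : x <= expR x.
Proof. by have := @expR_ge1Dx R x; lra. Qed.

Lemma sqr_le_expR x : 0 <= x -> x ^+ 2 <= 4 * expR x.
Proof.
move=> x0; have h := le_expR (x / 2).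
have -> : expR x = expR (x / 2) ^+ 2.
  by rewrite expr2 -expRD; congr expR; lra.
rewrite !expr2; nra.
Qed.

End exponential_inequalities.

Section deviation.
Context {R : realType} {dT : measure_display} {T : measurableType dT}.
Variable P : probability T R.
Context {d : nat}.
Variables (X : nat -> {RV P >-> d.-tuple R}) (Y : nat -> {RV P >-> R}).
Hypothesis XY_ident : forall i, identically_distributed P
  (fun t => (X i t, Y i t)) (fun t => (X 0%N t, Y 0%N t)).
Local Notation S := (d.-tuple R * R)%type.
Local Notation Z := (pair_rv X Y).
Variables (m : d.-tuple R -> R) (M : R).
Hypothesis m_regression : regression_function (X 0%N) (Y 0%N) m.
Hypothesis mM : forall x, `|m x| <= M.
Hypothesis Y_int : P.-integrable setT (EFin \o Y 0%N).

Variables (beta tau : R).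
Hypotheses (beta1 : 1 <= beta) (Mbeta : M <= beta).

Definition inside (y : R) : R := \1_(`[- beta, beta]%classic) y.
Definition tail (y : R) : R := 12 * y ^+ 2 * (1 - inside y).

Hypothesis tail_int : P.-integrable setT (EFin \o (fun t => tail (Y 0%N t))).
Hypothesis tail_tau : (\int[P]_t tail (Y 0%N t) <= tau)%R.

Definition excess (g : d.-tuple R -> R) (z : S) : R :=
  ((g z.1 - z.2) ^+ 2 - (m z.1 - z.2) ^+ 2) * inside z.2.

Definition L2dist (g : d.-tuple R -> R) : R :=
  (\int[P]_t ((g (X 0%N t) - m (X 0%N t)) ^+ 2))%R.

Lemma inside1 y : `|y| <= beta -> inside y = 1.
Proof. by rewrite /inside indicE ler_norml => yb; rewrite mem_set. Qed.

Lemma inside0 y : beta < `|y| -> inside y = 0.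
Proof.
move=> yb; rewrite /inside indicE memNset//= in_itv /= -ler_norml.
by apply/negP; rewrite -ltNge.
Qed.

Lemma measurable_inside : measurable_fun setT inside.
Proof. by apply: measurable_indic; exact: measurable_itv. Qed.

Let beta0 : 0 <= beta. Proof. by rewrite (le_trans _ beta1). Qed.

(** The first bound makes the mean of [- excess] at most [- L2dist] plus the tail, as the cross term
    is orthogonal; the second bounds the second moment by a multiple of the same [L2dist]; the third
    keeps the exponent in range. For [|y| > beta] the excess is 0, and the 12 in [tail] pays for
    [(g - m)^2 <= 4 y^2] and for twice a cross term of at most [4 y^2]. *)
Lemma excess_bounds g (z : S) : (forall x, `|g x| <= beta) ->
  [/\ - excess g z <= - (g z.1 - m z.1) ^+ 2
         - 2 * ((g z.1 - m z.1) * (m z.1 - z.2)) + tail z.2,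
      excess g z ^+ 2 <= (4 * beta) ^+ 2 * (g z.1 - m z.1) ^+ 2
    & `|excess g z| <= (4 * beta) ^+ 2].
Proof.
move=> gb; rewrite /excess /tail.
have mb : `|m z.1| <= beta by exact: le_trans Mbeta.
have gb' := gb z.1.
have [yb|yb] := leP `|z.2| beta.
  rewrite inside1//; set g1 := g _ in gb' *; set m1 := m _ in mb *.
  set y := z.2 in yb *; rewrite subrr !mulr0 mulr1 addr0.
  have -> : (g1 - y) ^+ 2 - (m1 - y) ^+ 2 = (g1 - m1) * (g1 + m1 - 2 * y) by ring.
  have a4 : `|g1 + m1 - 2 * y| <= 4 * beta.
    by rewrite ler_norml; move: gb' mb yb; rewrite !ler_norml; lra.
  have a2 : `|g1 - m1| <= 2 * beta.
    by rewrite ler_norml; move: gb' mb; rewrite !ler_norml; lra.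
  split.
  - by lra.
  - rewrite exprMn mulrC ler_wpM2r ?sqr_ge0//.
    by rewrite -real_normK ?num_real// lerXn2r ?nnegrE// mulr_ge0.
  - rewrite normrM (@le_trans _ _ (2 * beta * (4 * beta)))//.
      by rewrite ler_pM.
    by rewrite expr2 ler_wpM2r ?mulr_ge0// ler_wpM2r// ler_nat.
rewrite inside0// !mulr0 normr0 oppr0 addr0 mulr1 expr0n /=; split.
- set g1 := g _ in gb' *; set m1 := m _ in mb *; set y := z.2 in yb *.
  have y2 : `|y| ^+ 2 = y ^+ 2 by rewrite real_normK ?num_real.
  have a1 : `|g1 - m1| <= 2 * `|y|.
    by rewrite (le_trans (ler_normB _ _))//; lra.
  have a3 : `|m1 - y| <= 2 * `|y|.
    by rewrite (le_trans (ler_normB _ _))//; lra.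
  have : (g1 - m1) ^+ 2 <= 4 * y ^+ 2.
    rewrite -real_normK ?num_real// -y2 (_ : 4 * _ = (2 * `|y|) ^+ 2); last by ring.
    by rewrite lerXn2r ?nnegrE ?mulr_ge0.
  have : (g1 - m1) * (m1 - y) <= 4 * y ^+ 2.
    rewrite (le_trans (ler_norm _))// normrM -y2.
    by rewrite (_ : 4 * _ = 2 * `|y| * (2 * `|y|)) ?ler_pM//; ring.
  lra.
- by rewrite mulr_ge0 ?sqr_ge0.
- by rewrite sqr_ge0.
Qed.

Lemma measurable_excess (g : d.-tuple R -> R) : measurable_fun setT g ->
  measurable_fun setT (excess g).
Proof.
move=> mg; have mm := measurable_regression m_regression.
apply: measurable_funM; last exact: (measurableT_comp measurable_inside).
apply: measurable_funB; apply: measurable_funX; apply: measurable_funB => //.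
  exact: measurableT_comp.
exact: measurableT_comp.
Qed.

Variable n : nat.
Hypothesis n0 : (0 < n)%N.
Hypothesis ind : independent_along P Z (index_iota 1 n.+1).
(* Chosen so that [2 theta / n] times the bound [(4 beta)^2] on the excess is
   [1/4], a range where [expR_le_quadratic] absorbs the variance into the mean. *)
Let theta : R := n%:R / (8 * (4 * beta) ^+ 2).

Definition deviation g t : R :=
  L2dist g - 2 * avg n (fun i => excess g (Z i t)).

Lemma theta_gt0 : 0 < theta.
Proof.
by rewrite divr_gt0 ?ltr0n// mulr_gt0// exprn_gt0// mulr_gt0// (lt_le_trans _ beta1).
Qed.

(** Each factor has mean at most [1 - u D + 2 u^2 b2 D + u tau], and by [u * b2 = 1/4] the quadratic
    term takes back only half of [- u D]. Since [n * u = 2 * theta], the [n]-th power is at most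
    [exp (- theta D + 2 theta tau)], which cancels [exp (theta D)]. This is why [deviation] counts
    the empirical excess twice. *)
Lemma mgf_bound (g : d.-tuple R -> R) : measurable_fun setT g -> (forall x, `|g x| <= beta) ->
  (\int[P]_t (expR (theta * deviation g t))%:E <= (expR (2 * theta * tau))%:E)%E.
Proof.
move=> mg gb; have th0 := theta_gt0.
have mm := measurable_regression m_regression.
have n0' : 0 < n%:R :> R by rewrite ltr0n.
set b2 : R := (4 * beta) ^+ 2; have b20 : 0 < b2.
  by rewrite exprn_gt0// mulr_gt0// (lt_le_trans _ beta1).
pose u := 2 * theta / n%:R.
have u0 : 0 < u by rewrite divr_gt0// mulr_gt0.
have ub2 : u * b2 = 4^-1 by rewrite /u /theta -/b2; field; rewrite !gt_eqF.
pose h (z : S) := expR (- (u * excess g z)).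
have mh : measurable_fun setT h.
  apply: (measurableT_comp (@measurable_expR R)).
  apply: measurable_funN; apply: measurable_funM => //; exact: measurable_excess.
have h0 z : 0 <= h z by exact: expR_ge0.
have uz z : `|u * excess g z| <= 4^-1.
  have [_ _ H] := excess_bounds z gb.
  by rewrite normrM (gtr0_norm u0) -ub2 ler_wpM2l// ltW.
have hle z : h z <= 1 + - (u * excess g z) + 2 * (u * excess g z) ^+ 2.
  rewrite -(sqrrN (u * _)); apply: expR_le_quadratic.
  by have /ler_normlP[] := uz z; lra.
have mhZ : measurable_fun setT (fun t => h (Z 0%N t)).
  by apply: measurableT_comp => //; exact: measurable_pair_rv.
have hi : P.-integrable setT (EFin \o (fun t => h (Z 0%N t))).
  apply: (@bounded_integrable _ _ _ _ _ 2) => // t.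
  rewrite ger0_norm// (le_trans (hle _))//.
  have /ler_normlP[] := uz (Z 0%N t).
  set w := u * _ => w1 w2; have : 0 <= (4^-1 - w) * (4^-1 + w).
    by rewrite mulr_ge0; lra.
  by rewrite expr2; nra.
pose e := (\int[P]_t h (Z 0%N t))%R.
have he i : (\int[P]_t (h (Z i t))%:E = e%:E)%E.
  by rewrite (ge0_integral_ident XY_ident)// EFin_Rintegral.
pose a x := g x - m x.
have ma : measurable_fun setT a by exact: measurable_funB.
have aM x : `|a x| <= beta + M by rewrite (le_trans (ler_normB _ _))// lerD.
have mYi : P.-integrable setT (EFin \o (fun t => m (X 0%N t) - Y 0%N t)).
  rewrite (_ : _ \o _ = (EFin \o (fun t => m (X 0%N t))) \- (EFin \o Y 0%N))%E//.
  apply: integrableB => //; apply: (@bounded_integrable _ _ _ _ _ M) => //.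
  exact: measurableT_comp.
have ai : P.-integrable setT (EFin \o (fun t => a (X 0%N t) * (m (X 0%N t) - Y 0%N t))).
  exact: (bounded_mul_integrable X ma aM mYi).
have a2i : P.-integrable setT (EFin \o (fun t => (a (X 0%N t)) ^+ 2)).
  apply: (@bounded_integrable _ _ _ _ _ ((beta + M) ^+ 2)).
    by apply: measurable_funX; exact: measurableT_comp.
  by move=> t; rewrite normrX lerXn2r ?nnegrE// (le_trans _ (aM (X 0%N t))).
set D := L2dist g.
have e_le : e <= 1 - u * D + u * tau + 2 * u ^+ 2 * b2 * D.
  pose c1 := 2 * u ^+ 2 * b2 - u.
  have i1 : P.-integrable setT (EFin \o (fun t => 1 + c1 * (a (X 0%N t)) ^+ 2)).
    rewrite (_ : _ \o _ = (EFin \o cst 1%R) \+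
      (fun t => c1%:E * (EFin \o (fun t => (a (X 0%N t)) ^+ 2)%R) t))%E//.
    apply: integrableD => //; first exact: finite_measure_integrable_cst.
    exact: integrableZl.
  have i2 : P.-integrable setT (EFin \o (fun t => - (2 * u) *
      (a (X 0%N t) * (m (X 0%N t) - Y 0%N t)))).
    rewrite (_ : _ \o _ = (fun t => (- (2 * u))%:E * (EFin \o (fun t =>
      (a (X 0%N t) * (m (X 0%N t) - Y 0%N t)))%R) t))%E//.
    exact: integrableZl.
  have i3 : P.-integrable setT (EFin \o (fun t => u * tail (Y 0%N t))).
    rewrite (_ : _ \o _ = (fun t => u%:E * (EFin \o (fun t =>
      tail (Y 0%N t))%R) t))%E//.
    exact: integrableZl.
  have i12 : P.-integrable setT (EFin \o (fun t => 1 + c1 * (a (X 0%N t)) ^+ 2 +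
      - (2 * u) * (a (X 0%N t) * (m (X 0%N t) - Y 0%N t)))).
    rewrite (_ : _ \o _ = (EFin \o (fun t => 1 + c1 * (a (X 0%N t)) ^+ 2)%R) \+
      (EFin \o (fun t => - (2 * u) * (a (X 0%N t) * (m (X 0%N t) - Y 0%N t)))%R))%E//.
    exact: integrableD.
  have i123 : P.-integrable setT (EFin \o (fun t => 1 + c1 * (a (X 0%N t)) ^+ 2 +
      - (2 * u) * (a (X 0%N t) * (m (X 0%N t) - Y 0%N t)) + u * tail (Y 0%N t))).
    rewrite (_ : _ \o _ = (EFin \o (fun t => 1 + c1 * (a (X 0%N t)) ^+ 2 +
       - (2 * u) * (a (X 0%N t) * (m (X 0%N t) - Y 0%N t)))%R) \+
      (EFin \o (fun t => u * tail (Y 0%N t))%R))%E//.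
    exact: integrableD.
  have H : e <= (\int[P]_t (1 + c1 * (a (X 0%N t)) ^+ 2 +
      - (2 * u) * (a (X 0%N t) * (m (X 0%N t) - Y 0%N t)) + u * tail (Y 0%N t)))%R.
    apply: le_Rintegral => // t _; rewrite (le_trans (hle _))//.
    have [H1 H2 _] := excess_bounds (Z 0%N t) gb.
    rewrite [(Z 0%N t).1]/= [(Z 0%N t).2]/= -!/(a (X 0%N t)) in H1 H2.
    have := ler_wpM2l (ltW u0) H1.
    have : 2 * (u ^+ 2 * (excess g (Z 0%N t)) ^+ 2) <=
        2 * (u ^+ 2 * (b2 * (a (X 0%N t)) ^+ 2)).
      by rewrite ler_wpM2l// ler_wpM2l ?sqr_ge0.
    move: H1 H2; set w := excess _ _; set A := a _; set B := m _ - _.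
    by move=> H1 H2; rewrite /c1 (exprMn _ u w); lra.
  rewrite (le_trans H)// RintegralD// RintegralD//.
  rewrite RintegralD//; last 2 first.
  - exact: finite_measure_integrable_cst.
  - rewrite (_ : _ \o _ =
      (fun t => c1%:E * (EFin \o (fun t => (a (X 0%N t)) ^+ 2)%R) t))%E//.
    exact: integrableZl.
  rewrite Rintegral_cstT !RintegralZl//.
  rewrite (regression_orthogonal m_regression mM Y_int ma aM) mulr0 addr0.
  have := ler_wpM2l (ltW u0) tail_tau.
  by rewrite /c1 /D /L2dist /a; lra.
have D0 : 0 <= D by apply: Rintegral_ge0 => t _; exact: sqr_ge0.
have e0 : 0 <= e by apply: Rintegral_ge0 => t _.
have E t : expR (theta * deviation g t) =
    expR (theta * D) * \prod_(i <- index_iota 1 n.+1) h (Z i t).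
  rewrite -expR_sum -expRD; congr expR; rewrite /deviation mulrBr; congr (_ + _).
  rewrite sumrN /avg -mulr_sumr /u; field.
  by rewrite gt_eqF.
have mprod : measurable_fun setT (fun t => \prod_(i <- index_iota 1 n.+1) h (Z i t)).
  apply: measurable_prod => i _; apply: measurableT_comp => //.
  exact: measurable_pair_rv.
under eq_integral do rewrite E EFinM.
rewrite ge0_integralZl_EFin ?expR_ge0//; last 2 first.
- by move=> t _; rewrite lee_fin prodr_ge0.
- exact/measurable_EFinP.
rewrite (@integral_prod_independent _ _ _ P _ _ _ Z (measurable_pair_rv X Y)
  (index_iota 1 n.+1) (fun _ => h) (fun=> e))//; last exact: iota_uniq.
rewrite -EFinM lee_fin big_const_seq count_predT size_iota subn1 /= iter_mulr_1.
have : e ^+ n <= expR (n%:R * (- u * D + u * tau + 2 * u ^+ 2 * b2 * D)).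
  rewrite expRM_natl lerXn2r ?nnegrE ?expR_ge0// (le_trans e_le)//.
  by rewrite (le_trans _ (expR_ge1Dx _))//; lra.
move=> /(ler_wpM2l (expR_ge0 (theta * D))) /le_trans; apply.
rewrite -expRD ler_expR.
have -> : 2 * u ^+ 2 * b2 * D = 2 * u * (u * b2) * D by ring.
rewrite ub2.
have un : n%:R * u = 2 * theta by rewrite /u; field; rewrite gt_eqF.
rewrite (_ : n%:R * _ = n%:R * u * (- D / 2 + tau)); last by field.
by rewrite un; lra.
Qed.

Section cover.
Variables (I : finType) (G : I -> d.-tuple R -> R).
Hypothesis mG : forall i, measurable_fun setT (G i).
Hypothesis Gb : forall i x, `|G i x| <= beta.

(** A smooth substitute for the maximum: [y <= exp y] at [theta * deviation - ln #|I|] bounds every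
    deviation by it, its mean is linear in the exponential moments, and the size of the cover enters
    only through [ln #|I|]. *)
Definition max_deviation t : R := (ln #|I|%:R +
  #|I|%:R^-1 * \sum_i expR (theta * deviation (G i) t)) / theta.

Lemma measurable_deviation (g : d.-tuple R -> R) : measurable_fun setT g ->
  measurable_fun setT (deviation g).
Proof.
move=> mg; apply: measurable_funB => //; apply: measurable_funM => //.
apply: measurable_funM => //; apply: measurable_sum => i.
apply: measurableT_comp; last exact: measurable_pair_rv.
exact: measurable_excess.
Qed.

Lemma measurable_max_deviation : measurable_fun setT max_deviation.
Proof.
apply: measurable_funM => //; apply: measurable_funD => //.
apply: measurable_funM => //; apply: measurable_sum => i.
apply: (measurableT_comp (@measurable_expR R)); apply: measurable_funM => //.
exact: measurable_deviation.
Qed.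

Lemma max_deviation_ge0 t : (0 < #|I|)%N -> 0 <= max_deviation t.
Proof.
move=> I0; rewrite divr_ge0 ?(ltW theta_gt0)// addr_ge0//.
  by rewrite ln_ge0// ler1n.
by rewrite mulr_ge0 ?invr_ge0 ?sumr_ge0// => i _; exact: expR_ge0.
Qed.

Lemma deviation_le i t : deviation (G i) t <= max_deviation t.
Proof.
have th0 := theta_gt0.
have I0 : 0 < #|I|%:R :> R by rewrite ltr0n; apply/card_gt0P; exists i.
rewrite /max_deviation ler_pdivlMr// -lerBlDl mulrC.
rewrite (le_trans (le_expR _))// expRD expRN lnK ?posrE// [leLHS]mulrC.
rewrite ler_wpM2l ?invr_ge0 ?(ltW I0)// (bigD1 i)//= lerDl sumr_ge0//.
Qed.

Lemma integral_max_deviation_le : (0 < #|I|)%N ->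
  (\int[P]_t (max_deviation t)%:E <=
     ((ln #|I|%:R + expR (2 * theta * tau)) / theta)%:E)%E.
Proof.
move=> I0; have th0 := theta_gt0.
have I1 : 1 <= #|I|%:R :> R by rewrite ler1n.
have I0' : 0 < #|I|%:R :> R by rewrite ltr0n.
have ln0 : 0 <= ln #|I|%:R :> R by rewrite ln_ge0.
have md i : measurable_fun setT (fun t => expR (theta * deviation (G i) t)).
  apply: (measurableT_comp (@measurable_expR R)); apply: measurable_funM => //.
  exact: measurable_deviation.
have -> : (\int[P]_t (max_deviation t)%:E = \int[P]_t (theta^-1%:E *
    ((ln #|I|%:R)%:E + #|I|%:R^-1%:E * \sum_(i : I) (expR (theta * deviation (G i) t))%:E)))%E.
  apply: eq_integral => t _; rewrite sumEFin /max_deviation mulrC.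
  by rewrite EFinM EFinD EFinM.
have S0 t : (0 <= \sum_(i : I) (expR (theta * deviation (G i) t))%:E)%E.
  by apply: sume_ge0 => i _; rewrite lee_fin expR_ge0.
have mS : measurable_fun setT (fun t =>
    \sum_(i : I) (expR (theta * deviation (G i) t))%:E)%E.
  by apply: emeasurable_sum => i; exact/measurable_EFinP.
rewrite ge0_integralZl_EFin ?invr_ge0 ?(ltW th0)//; last 2 first.
- move=> t _; apply: adde_ge0; first by rewrite lee_fin.
  by apply: mule_ge0 => //; rewrite lee_fin invr_ge0 ltW.
- by apply: emeasurable_funD => //; apply: measurable_funeM.
rewrite ge0_integralD//; last 2 first.
- by move=> t _; apply: mule_ge0 => //; rewrite lee_fin invr_ge0 ltW.
- exact: measurable_funeM.
rewrite ge0_integralZl_EFin ?invr_ge0 ?(ltW I0')//.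
have IS : (\int[P]_t (\sum_(i : I) (expR (theta * deviation (G i) t))%:E) =
    \sum_(i : I) \int[P]_t (expR (theta * deviation (G i) t))%:E)%E.
  apply: ge0_integral_sum => // i.
  exact/measurable_EFinP.
rewrite integral_cstT IS.
rewrite mulrC EFinM; apply: lee_wpmul2l; first by rewrite lee_fin invr_ge0 ltW.
rewrite EFinD leeD2l//.
apply: (@le_trans _ _ (#|I|%:R^-1%:E * \sum_(i : I) (expR (2 * theta * tau))%:E)%E).
  apply: lee_wpmul2l; first by rewrite lee_fin invr_ge0 ltW.
  by apply: lee_sum => i _; exact: mgf_bound.
rewrite sumEFin -EFinM lee_fin sumr_const -[X in _ * X]mulr_natl mulKf//.
by rewrite gt_eqF.
Qed.

End cover.

End deviation.

(** * Truncation of the response *)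

Section support.
Context {R : realType} {dT : measure_display} {T : measurableType dT}.
Variable P : probability T R.
Context {d : nat}.
Variable X : {RV P >-> d.-tuple R}.

Lemma measurable_enormB (x : d.-tuple R) :
  measurable_fun setT (fun y : d.-tuple R => enorm (fun j => tnth y j - tnth x j)).
Proof.
apply: (measurableT_comp (_ : measurable_fun setT (@Num.sqrt R))).
  by apply: continuous_measurable_fun; exact: sqrt_continuous.
apply: measurable_sum => j; apply: measurable_funX; apply: measurable_funB => //.
exact: measurable_tnth.
Qed.

Lemma norm_tnth_le_enorm (v : 'I_d -> R) j : `|v j| <= enorm v.
Proof.
rewrite -(@ler_pXn2r _ 2) ?nnegrE ?sqrtr_ge0// real_normK ?num_real//.
rewrite /enorm sqr_sqrtr ?sumr_ge0// => [|i _]; last exact: sqr_ge0.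
by rewrite (bigD1 j)//= lerDl sumr_ge0// => i _; exact: sqr_ge0.
Qed.

(** Lindelof argument: a point outside the support has a null ball around it, and this ball contains
    a rational box around the point. Countably many null boxes therefore cover the complement of the
    support. *)
Lemma negligible_setC_support :
  (distribution P X).-negligible (~` rv_support X).
Proof.
pose box (qe : d.-tuple rat * rat) : set (d.-tuple R) :=
  [set y | forall j, `|tnth y j - ratr (tnth qe.1 j)| < ratr qe.2].
pose N qe : Prop := (distribution P X).-negligible (box qe).
(* Enumerates the null boxes; a number that codes no box, or a box that is not null, gives the empty
   set. *)
pose F n : set (d.-tuple R) :=
  if (choice.unpickle n : option (d.-tuple rat * rat)%type) is Some qe then
  if `[< N qe >] then box qe else set0 else set0.
apply: (@negligibleS _ _ _ _ (\bigcup_n F n)); last first.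
  apply: negligible_bigcup => n; rewrite /F; case: (choice.unpickle n : option (d.-tuple rat * rat)%type) => [qe|].
    by case: asboolP => // _; exact: negligible_set0.
  exact: negligible_set0.
move=> x /existsNP[e /not_implyP[e0 /negP]]; rewrite -leNgt => mu0.
pose B := [set y : d.-tuple R | enorm (fun j => tnth y j - tnth x j) < e].
have mB : measurable B.
  rewrite (_ : B = (fun y => enorm (fun j => tnth y j - tnth x j)) @^-1` `]-oo, e[).
    by rewrite -[X in measurable X]setTI; apply: measurable_enormB.
  by apply/seteqP; split => y /=; rewrite in_itv.
have B0 : (distribution P X).-negligible B.
  by apply/negligibleP => //; apply/eqP; rewrite eq_le mu0 measure_ge0.
(* In a box of radius below [h] whose centre is within that radius of [x], each coordinate differs
   from that of [x] by at most [2 * h], so the Euclidean distance is less than [e]. Taking [d + 1]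
   makes the bound strict and the denominator positive. *)
pose h := e / (2 * (d%:R + 1)).
have d1 : 0 < d%:R + 1 :> R by rewrite ltr_wpDl.
have h0 : 0 < h by rewrite divr_gt0// mulr_gt0.
have [p /andP[p0 ph]] : exists p : rat, 0 < (ratr p : R) < h.
  have [p] := @rat_in_itvoo R 0 h h0.
  by rewrite in_itv /= => ?; exists p.
have /choice[q Hq] : forall j : 'I_d, exists qj : rat, `|tnth x j - ratr qj| < ratr p :> R.
  move=> j; have : tnth x j - ratr p < tnth x j by rewrite ltrBlDr ltrDl.
  move=> /(@rat_in_itvoo R)[qj]; rewrite in_itv /= => /andP[q1 q2].
  by exists qj; rewrite ger0_norm; lra.
pose qe := ([tuple q j | j < d], p).
have Nqe : N qe.
  apply: negligibleS B0 => y /= yb; rewrite /B /=.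
  have yx j : `|tnth y j - tnth x j| <= 2 * h.
    have := yb j; rewrite tnth_mktuple => y1; have := Hq j => x1.
    rewrite -(subrKA (ratr (q j))) (le_trans (ler_normD _ _))//.
    by rewrite [X in _ + X]distrC; lra.
  rewrite -(@ltr_pXn2r _ 2) ?nnegrE ?sqrtr_ge0//; last exact: ltW.
  rewrite /enorm sqr_sqrtr ?sumr_ge0// => [|i _]; last exact: sqr_ge0.
  apply: (@le_lt_trans _ _ (\sum_(j < d) (2 * h) ^+ 2)).
    apply: ler_sum => j _; rewrite -real_normK ?num_real// lerXn2r ?nnegrE//.
    by rewrite mulr_ge0// ltW.
  rewrite sumr_const card_ord -[ltLHS]mulr_natl.
  have -> : 2 * h = e / (d%:R + 1) by rewrite /h; field; rewrite gt_eqF.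
  rewrite expr_div_n mulrA ltr_pdivrMr ?exprn_gt0// mulrC.
  rewrite ltr_pM2l ?exprn_gt0// expr2.
  by have : 0 <= d%:R :> R by []; nra.
exists (choice.pickle qe) => //; rewrite /F choice.pickleK; case: asboolP => // _ j /=.
by rewrite tnth_mktuple; exact: Hq.
Qed.

Definition outside_box (rho : R) : set (d.-tuple R) :=
  [set x | exists j, rho < `|tnth x j|].

Lemma measurable_outside_box rho : measurable (outside_box rho).
Proof.
rewrite (_ : outside_box rho = \bigcup_j [set x | rho < `|tnth x j|]).
  apply: fin_bigcup_measurable => // j _.
  rewrite (_ : [set x | _] = (fun x : d.-tuple R => `|tnth x j|) @^-1` `]rho, +oo[).
    rewrite -[X in measurable X]setTI; apply: measurableT_comp => //.
    exact: measurable_tnth.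
  by apply/seteqP; split => y /=; rewrite in_itv /= andbT.
by apply/seteqP; split => [x [j xj]|x [j _ xj]]; exists j.
Qed.

Lemma bounded_support_null rho :
  (forall x, rv_support X x -> enorm (tnth x) <= rho) ->
  P (X @^-1` outside_box rho) = 0%E.
Proof.
move=> H; have mB := measurable_outside_box rho.
suff /negligibleP : (distribution P X).-negligible (outside_box rho) by apply.
apply: negligibleS negligible_setC_support => x [j xj] /H.
by rewrite leNgt (lt_le_trans xj)// norm_tnth_le_enorm.
Qed.

Lemma uniform_null a b (U : {RV P >-> R}) : uniformly_distributed a b U ->
  P (U @^-1` (~` `[a, b])) = 0%E.
Proof.
move=> [ab H]; have mC : measurable (~` `[a, b] : set R).
  by apply: measurableC; exact: measurable_itv.
have := H _ mC; rewrite /distribution /pushforward => ->.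
rewrite /uniform_prob integral0_eq// => x; rewrite /= in_itv /= => /negP xab.
by rewrite /uniform_pdf (negbTE xab).
Qed.

End support.

(** * Consequences of the exponential moment *)

Section exponential_moment.
Context {R : realType} {dT : measure_display} {T : measurableType dT}.
Variable P : probability T R.
Variables (Y : {RV P >-> R}) (c : R).
Hypothesis c0 : 0 < c.
Hypothesis Yexp : ('E_P[fun t => expR (c * Y t ^+ 2)] < +oo)%E.

Definition exp_moment : R := (\int[P]_t expR (c * Y t ^+ 2))%R.

Lemma exp_moment_integrable :
  P.-integrable setT (EFin \o (fun t => expR (c * Y t ^+ 2))).
Proof.
apply: ge0_integrable_lty => [|t|].
- apply: (measurableT_comp (@measurable_expR R)); apply: measurable_funM => //.
  exact: measurable_funX.
- exact: expR_ge0.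
- by move: Yexp; rewrite unlock.
Qed.

Lemma exp_moment_ge0 : 0 <= exp_moment.
Proof. by apply: Rintegral_ge0 => t _; exact: expR_ge0. Qed.

Lemma scaled_exp_moment_integrable a :
  P.-integrable setT (EFin \o (fun t => a * expR (c * Y t ^+ 2))).
Proof.
rewrite (_ : _ \o _ = (fun t => a%:E * (EFin \o (fun t => expR (c * Y t ^+ 2))%R) t))%E//.
by apply: integrableZl => //; exact: exp_moment_integrable.
Qed.

Lemma exp_moment_dominated (f : R -> R) a : measurable_fun setT f ->
  (forall y, 0 <= f y) -> (forall y, f y <= a * expR (c * y ^+ 2)) ->
  P.-integrable setT (EFin \o (fun t => f (Y t))) /\
  (\int[P]_t f (Y t) <= a * exp_moment)%R.
Proof.
move=> mf f0 fa.
have fi : P.-integrable setT (EFin \o (fun t => f (Y t))).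
  apply: dominated_integrable (scaled_exp_moment_integrable a).
    exact: measurableT_comp.
  by move=> t; rewrite ger0_norm.
split => //; rewrite /exp_moment -RintegralZl//; last exact: exp_moment_integrable.
by apply: le_Rintegral => //; exact: scaled_exp_moment_integrable.
Qed.

Lemma sqr_le_exp y : y ^+ 2 <= c^-1 * expR (c * y ^+ 2).
Proof. by rewrite mulrC ler_pdivlMr// mulrC le_expR. Qed.

Lemma Y_integrable : P.-integrable setT (EFin \o Y).
Proof.
apply: dominated_integrable (scaled_exp_moment_integrable (1 + c^-1)) => // t.
apply: (@le_trans _ _ (1 + Y t ^+ 2)).
  by rewrite -(real_normK (num_real (Y t))); have := sqr_ge0 (`|Y t| - 1); nra.
rewrite mulrDl mul1r lerD// ?sqr_le_exp//.
by rewrite -expR0 ler_expR mulr_ge0 ?sqr_ge0// ltW.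
Qed.

Lemma Y4_integrable : P.-integrable setT (EFin \o (fun t => Y t ^+ 4)) /\
  (\int[P]_t (Y t ^+ 4) <= 4 / c ^+ 2 * exp_moment)%R.
Proof.
apply: (@exp_moment_dominated (fun y => y ^+ 4)).
- exact: measurable_funX.
- by move=> y; rewrite (exprM y 2 2) sqr_ge0.
- move=> y; have cy : 0 <= c * y ^+ 2 by rewrite mulr_ge0 ?sqr_ge0// ltW.
  have := sqr_le_expR cy; rewrite exprMn -exprM => H.
  by rewrite mulrAC ler_pdivlMr ?exprn_gt0// mulrC.
Qed.

Variable beta : R.
Hypothesis beta0 : 0 <= beta.

Lemma outside_integrable :
  P.-integrable setT (EFin \o (fun t => 1 - inside beta (Y t))) /\
  (\int[P]_t (1 - inside beta (Y t)) <= expR (- (c * beta ^+ 2)) * exp_moment)%R.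
Proof.
apply: (@exp_moment_dominated (fun y => 1 - inside beta y)).
- by apply: measurable_funB => //; exact: measurable_inside.
- by move=> y; rewrite subr_ge0 /inside indicE; case: (_ \in _).
- move=> y; rewrite -expRD; have [yb|yb] := leP `|y| beta.
    by rewrite inside1// subrr expR_ge0.
  rewrite inside0// subr0 -expR0 ler_expR addrC subr_ge0 ler_wpM2l ?(ltW c0)//.
  by rewrite -[leRHS]real_normK ?num_real// lerXn2r ?nnegrE// ltW.
Qed.

Lemma tail_integrable :
  P.-integrable setT (EFin \o (fun t => tail beta (Y t))) /\
  (\int[P]_t tail beta (Y t) <= 24 / c * expR (- (c * beta ^+ 2 / 2)) * exp_moment)%R.
Proof.
apply: (@exp_moment_dominated (fun y => tail beta y)).
- apply: measurable_funM; first by apply: measurable_funM => //; exact: measurable_funX.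
  by apply: measurable_funB => //; exact: measurable_inside.
- move=> y; apply: mulr_ge0; first by rewrite mulr_ge0// sqr_ge0.
  by rewrite subr_ge0 /inside indicE; case: (_ \in _).
- move=> y; rewrite /tail -[leRHS]mulrA -expRD; have [yb|yb] := leP `|y| beta.
    by rewrite inside1// subrr mulr0 mulr_ge0 ?expR_ge0// divr_ge0// ltW.
  rewrite inside0// subr0 mulr1.
  have yb2 : beta ^+ 2 <= y ^+ 2.
    by rewrite -[leRHS]real_normK ?num_real// lerXn2r ?nnegrE// ltW.
  (* The exponent is halved: one half absorbs the factor [12 * y ^+ 2], the other provides the decay
     in [beta], as [|y| > beta]. *)
  rewrite (@le_trans _ _ (24 / c * expR (c * y ^+ 2 / 2)))//.
    have := le_expR (c * y ^+ 2 / 2) => H.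
    rewrite mulrAC ler_pdivlMr//; lra.
  rewrite ler_wpM2l ?divr_ge0 ?(ltW c0)// ler_expR.
  by have := ler_wpM2l (ltW c0) yb2; lra.
Qed.

End exponential_moment.

(** * Expected risk for a fixed sample size *)

Section independent_event.
Context {R : realType} {dT : measure_display} {T : measurableType dT}.
Variable P : probability T R.
Context {d : nat}.
Variables (X : nat -> {RV P >-> d.-tuple R}) (Y : nat -> {RV P >-> R}).
Hypothesis XY_ident : forall i, identically_distributed P
  (fun t => (X i t, Y i t)) (fun t => (X 0%N t, Y 0%N t)).
Local Notation S := (d.-tuple R * R)%type.
Local Notation Z := (pair_rv X Y).

Variables (C : set T) (k : nat).
Hypothesis mC : measurable C.
Hypothesis CZ : forall A : set S, measurable A ->
  (P (C `&` Z k @^-1` A) = P C * P (Z k @^-1` A))%E.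

Lemma ge0_integral_indep (h : S -> R) : measurable_fun setT h ->
  (forall z, 0 <= h z) -> P.-integrable setT (EFin \o (fun t => h (Z 0%N t))) ->
  (\int[P]_t (\1_C t * h (Z k t))%:E =
     (fine (P C) * \int[P]_t h (Z 0%N t))%R%:E)%E.
Proof.
move=> mh h0 hi; have mZ := measurable_pair_rv X Y.
have PC0 : 0 <= fine (P C) by rewrite fine_ge0// measure_ge0.
have fPC : P C \is a fin_num by exact: fin_num_measure.
have : (\int[P]_t (h (Z k t) * \1_C t)%:E = \int[P]_t (h (Z k t) * fine (P C))%:E)%E.
  apply: (integral_weight_ext (mZ k)) => // A mA.
  have mA' : measurable (Z k @^-1` A) by rewrite -[X in measurable X]setTI; exact: mZ.
  transitivity (P (C `&` Z k @^-1` A)).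
    rewrite -[X in P X]setIT -integral_indic//; last exact: measurableI.
    apply: eq_integral => t _; congr (_%:E).
    by rewrite setIC indicI.
  rewrite CZ//; under eq_integral do rewrite mulrC EFinM.
  rewrite ge0_integralZl_EFin//.
  - rewrite (_ : (fun t => _) = EFin \o \1_(Z k @^-1` A)); last by [].
    by rewrite integral_indic// setIT fineK.
  - apply/measurable_EFinP; apply: measurableT_comp => //.
under eq_integral do rewrite mulrC; move=> ->.
under eq_integral do rewrite mulrC EFinM.
rewrite ge0_integralZl_EFin//.
- by rewrite (ge0_integral_ident XY_ident)// EFin_Rintegral.
- by move=> t _; rewrite lee_fin.
- apply/measurable_EFinP; exact: measurableT_comp.
Qed.

Lemma integral_indep (q : S -> R) : measurable_fun setT q ->
  P.-integrable setT (EFin \o (fun t => q (Z 0%N t))) ->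
  P.-integrable setT (EFin \o (fun t => \1_C t * q (Z k t))) /\
  (\int[P]_t (\1_C t * q (Z k t)) = fine (P C) * \int[P]_t q (Z 0%N t))%R.
Proof.
move=> mq qi; have mZ := measurable_pair_rv X Y.
have mnq : measurable_fun setT (fun z => `|q z|) by exact: measurableT_comp.
have nqi : P.-integrable setT (EFin \o (fun t => `|q (Z 0%N t)|)).
  exact: integrable_norm.
(* [q] is the difference of [q + |q|] and [|q|], and the nonnegative case applies to both. *)
have mpq : measurable_fun setT (fun z => q z + `|q z|) by exact: measurable_funD.
have pqi : P.-integrable setT (EFin \o (fun t => q (Z 0%N t) + `|q (Z 0%N t)|)).
  rewrite (_ : _ \o _ = (EFin \o (fun t => q (Z 0%N t))) \+
    (EFin \o (fun t => `|q (Z 0%N t)|%R)))%E//.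
  exact: integrableD.
have pq0 z : 0 <= q z + `|q z| by have := ler_norm (- q z); rewrite normrN; lra.
have H1 := ge0_integral_indep mpq pq0 pqi.
have H2 := ge0_integral_indep mnq (fun z => normr_ge0 (q z)) nqi.
have C0 t : 0 <= \1_C t :> R by rewrite indicE; case: (_ \in _).
have mh (h : S -> R) : measurable_fun setT h ->
    measurable_fun setT (fun t => \1_C t * h (Z k t)).
  by move=> mh; apply: measurable_funM => //; apply: measurableT_comp.
have I1 : P.-integrable setT (EFin \o (fun t => \1_C t * (q (Z k t) + `|q (Z k t)|))).
  apply: ge0_integrable_lty => [|t|]; last by rewrite H1 ltry.
    exact: (mh (fun z => q z + `|q z|)).
  by rewrite mulr_ge0.
have I2 : P.-integrable setT (EFin \o (fun t => \1_C t * `|q (Z k t)|)).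
  apply: ge0_integrable_lty => [|t|]; last by rewrite H2 ltry.
    exact: (mh (fun z => `|q z|)).
  by rewrite mulr_ge0.
have E t : \1_C t * q (Z k t) = \1_C t * (q (Z k t) + `|q (Z k t)|) -
    \1_C t * `|q (Z k t)| by ring.
have EE : (fun t => \1_C t * q (Z k t)) = (fun t =>
   \1_C t * (q (Z k t) + `|q (Z k t)|) - \1_C t * `|q (Z k t)|).
  by apply/funext => t; rewrite E.
split.
  rewrite EE (_ : _ \o _ = (EFin \o (fun t => \1_C t * (q (Z k t) + `|q (Z k t)|))%R)
    \- (EFin \o (fun t => \1_C t * `|q (Z k t)|)%R))%E//.
  exact: integrableB.
rewrite EE RintegralB// /Rintegral H1 H2 /=.
rewrite -mulrBr; congr (_ * _).
rewrite -[LHS](@RintegralB _ _ _ P setT)//; apply: eq_Rintegral => t _; ring.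
Qed.

End independent_event.

Section data_weights.
Context {R : realType} {dT : measure_display} {T : measurableType dT}.
Variable P : probability T R.
Context {d : nat} {A : finType}.
Variables (X : nat -> {RV P >-> d.-tuple R}) (Y : nat -> {RV P >-> R}).
Variable W : A -> {RV P >-> R}.
Hypothesis ind : mutually_independent P (data_and_weights_systems X Y W).
Local Notation S := (d.-tuple R * R)%type.
Local Notation Z := (pair_rv X Y).

Let E (B : nat -> set S) (D : A -> set R) (j : nat + A) : set T :=
  match j with inl i => Z i @^-1` B i | inr a => W a @^-1` D a end.

Let GE B D j : (forall i, measurable (B i)) -> (forall a, measurable (D a)) ->
  data_and_weights_systems X Y W j (E B D j).
Proof.
move=> mB mD; case: j => [i|a] /=.
  by exists (B i) => //; rewrite setTI.
by exists (D a) => //; rewrite setTI.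
Qed.

Lemma independent_along_data (s : seq nat) : uniq s -> independent_along P Z s.
Proof.
move=> us B mB.
have := @mutually_independent_seq _ _ _ P _ _ ind [seq inl i | i <- s]
  (E B (fun=> setT)).
rewrite map_inj_uniq => [/(_ us)|i j []//].
move=> H; rewrite big_map in H.
rewrite -[RHS]H; last by move=> j _; apply: GE => // a.
congr (P _); apply/seteqP; split => t /= Ht j /=.
  by move=> /mapP[i si ->]; exact: Ht.
by move=> js; apply: (Ht (inl j)); exact: map_f.
Qed.

Lemma independent_weights_data (D : A -> set R) k (B : set S) :
  (forall a, measurable (D a)) -> measurable B ->
  (P (\bigcap_a (W a @^-1` D a) `&` Z k @^-1` B) =
     P (\bigcap_a (W a @^-1` D a)) * P (Z k @^-1` B))%E.
Proof.
move=> mD mB; pose e := [seq inr a | a <- enum A] : seq (nat + A).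
have ue : uniq e by rewrite map_inj_uniq ?enum_uniq// => i j [].
have uke : uniq (inl k :: e).
  by rewrite /= ue andbT; apply/mapP => -[].
have H1 := @mutually_independent_seq _ _ _ P _ _ ind _ (E (fun=> B) D) ue
  (fun j _ => GE _ (fun=> mB) mD).
have H2 := @mutually_independent_seq _ _ _ P _ _ ind _ (E (fun=> B) D) uke
  (fun j _ => GE _ (fun=> mB) mD).
rewrite big_cons -H1 in H2.
have -> : \bigcap_a (W a @^-1` D a) = \bigcap_(j in [set` e]) E (fun=> B) D j.
  apply/seteqP; split => t /= Ht j /=; first by move=> /mapP[a _ ->]; exact: Ht.
  by move=> _; apply: (Ht (inr j)); apply: map_f; rewrite mem_enum.
rewrite muleC -[RHS]H2; congr (P _); apply/seteqP; split => t /=.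
  by move=> [Ht tB] j /=; rewrite inE => /predU1P[->//|/Ht].
move=> Ht; split => [j je|]; first by apply: Ht; rewrite /= inE je orbT.
by apply: (Ht (inl k)); rewrite /= inE eqxx.
Qed.

End data_weights.

(** * Risk bound for a single outcome *)

Section pointwise_bound.
Context {R : realType} {dT : measure_display} {T : measurableType dT}.
Variable P : probability T R.
Context {d L r K : nat}.
Variables (r0 : (0 < r)%N) (X : nat -> {RV P >-> d.-tuple R}) (Y : nat -> {RV P >-> R}).
Local Notation S := (d.-tuple R * R)%type.
Local Notation Z := (pair_rv X Y).
Variables (m : d.-tuple R -> R) (M beta : R).
Hypothesis m_regression : regression_function (X 0%N) (Y 0%N) m.
Hypothesis mM : forall x, `|m x| <= M.
Hypotheses (beta1 : 1 <= beta) (Mbeta : M <= beta).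

Definition excess_ub (f : d.-tuple R -> R) (z : S) : R :=
  2 * (f z.1 - m z.1) ^+ 2 + 2 * ((f z.1 - m z.1) * (m z.1 - z.2)).

(** Completing the square: twice [excess_ub] is [(2 a + (u - y))^2 - (u - y)^2] with [a = f - m] and
    [u = m]. The lower bound is uniform in [f]; it is needed where the oracle term may be negative
    without being controlled by the risk. *)
Lemma excess_ub_ge f z : - (2 * M ^+ 2 + 2 * z.2 ^+ 2) <= 2 * excess_ub f z.
Proof.
have mz : m z.1 ^+ 2 <= M ^+ 2.
  rewrite -real_normK ?num_real// lerXn2r ?nnegrE//.
  exact: le_trans (mM z.1).
rewrite /excess_ub; set a := f _ - _; set u := m _ in mz *; set y := z.2.
by have := sqr_ge0 (2 * a + (u - y)); have := sqr_ge0 (u + y); nra.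
Qed.

Variable rho : R.
Hypothesis rho1 : 1 <= rho.
Hypothesis X_rho : forall x, rv_support (X 0%N) x -> enorm (tnth x) <= rho.

Lemma L2_risk_le (f g : d.-tuple R -> R) dl :
  measurable_fun setT f -> measurable_fun setT g ->
  (forall x, `|f x| <= beta) -> (forall x, `|g x| <= beta) -> 0 <= dl ->
  (forall x, (forall j, `|tnth x j| <= rho) -> `|f x - g x| <= dl) ->
  (L2_risk (X 0%N) f m <= (L2dist X m g + 4 * beta * dl)%:E)%E.
Proof.
move=> mf mg fb gb dl0 fg; have mm := measurable_regression m_regression.
have beta0 : 0 <= beta by rewrite (le_trans _ beta1).
have mfm : measurable_fun setT (fun x => (`|f x - m x| ^+ 2)%:E).
  apply/measurable_EFinP; apply: measurable_funX; apply: measurableT_comp => //.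
  exact: measurable_funB.
have fm0 x : (0 <= (`|f x - m x| ^+ 2)%:E)%E by rewrite lee_fin exprn_ge0.
rewrite /L2_risk ge0_integral_distribution//.
have g2i : P.-integrable setT (EFin \o (fun t => (g (X 0%N t) - m (X 0%N t)) ^+ 2)).
  apply: (@bounded_integrable _ _ _ _ _ ((beta + M) ^+ 2)).
    apply: measurable_funX; apply: (@measurableT_comp _ _ _ _ _ _ (fun x => g x - m x)) => //.
    exact: measurable_funB.
  move=> t; rewrite normrX lerXn2r ?nnegrE ?addr_ge0//.
    by rewrite (le_trans _ (mM (X 0%N t))).
  by rewrite (le_trans (ler_normB _ _))// lerD.
have -> : ((L2dist X m g + 4 * beta * dl)%:E = \int[P]_t
   ((g (X 0%N t) - m (X 0%N t)) ^+ 2 + 4 * beta * dl)%:E)%E.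
  rewrite EFin_Rintegral.
    by rewrite RintegralD ?Rintegral_cstT//; exact: finite_measure_integrable_cst.
  rewrite (_ : _ \o _ = (EFin \o (fun t => (g (X 0%N t) - m (X 0%N t)) ^+ 2)%R) \+
     (EFin \o cst (4 * beta * dl)%R))%E//.
  by apply: integrableD => //; exact: finite_measure_integrable_cst.
have c0 : 0 <= 4 * beta * dl by rewrite !mulr_ge0.
have f10 t : setT t -> (0 <= (`|f (X 0%N t) - m (X 0%N t)| ^+ 2)%:E)%E.
  by rewrite lee_fin exprn_ge0.
have f20 t : setT t ->
    (0 <= ((g (X 0%N t) - m (X 0%N t)) ^+ 2 + 4 * beta * dl)%:E)%E.
  by rewrite lee_fin addr_ge0// sqr_ge0.
have mf1 : measurable_fun setT (fun t => (`|f (X 0%N t) - m (X 0%N t)| ^+ 2)%:E).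
  exact: measurableT_comp mfm _.
have mf2 : measurable_fun setT (fun t =>
    ((g (X 0%N t) - m (X 0%N t)) ^+ 2 + 4 * beta * dl)%:E).
  apply/measurable_EFinP; apply: measurable_funD => //; apply: measurable_funX.
  apply: (@measurableT_comp _ _ _ _ _ _ (fun x => g x - m x)) => //.
  exact: measurable_funB.
apply: (ae_ge0_le_integral measurableT f10 mf1 f20 mf2).
exists (X 0%N @^-1` outside_box rho); split.
- rewrite -[X in measurable X]setTI.
  by apply: measurable_funPT => //; exact: measurable_outside_box.
- exact: bounded_support_null.
move=> t /= H; apply: contrapT => nb; apply: H => _.
have xr j : `|tnth (X 0%N t) j| <= rho.
  by rewrite leNgt; apply/negP => xj; apply: nb; exists j.
rewrite lee_fin real_normK ?num_real//.
have := fg _ xr; have := fb (X 0%N t); have := gb (X 0%N t); have := le_trans (mM (X 0%N t)) Mbeta.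
set u := f _; set v := g _; set z := m _ => zM vb ub uv.
have : (u - v) * (u + v - 2 * z) <= dl * (4 * beta).
  rewrite (le_trans (ler_norm _))// normrM ler_pM//.
  by rewrite ler_norml; move: zM vb ub; rewrite !ler_norml; lra.
by rewrite !expr2; lra.
Qed.

Variables (n : nat) (c8 c9 : R) (tmin : nat) (A b : R).
Hypotheses (n1 : (1 < n)%N) (K0 : (0 < K)%N) (tmin0 : (0 < tmin)%N) (c90 : 0 < c9).
Hypotheses (b0 : 0 <= b) (c80 : 0 <= c8) (ln1 : 1 <= ln (n%:R : R)).
Local Notation q := (#|{: nidx d L r}|%:R : R).
Local Notation Lam := (@lipc R L r (b + 1) rho).
Hypothesis Qn : 2 / n%:R * (q * Lam ^+ 2 * (beta ^+ 2 + 1 + 2) ^+ 2) <= 1.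
Hypothesis c9n : c9 * ln n%:R / n%:R <= 1.

Variables (I : finType) (G : I -> d.-tuple R -> R) (dl0 : R).
Hypothesis mG : forall i, measurable_fun setT (G i).
Hypothesis Gb : forall i x, `|G i x| <= beta.
Hypothesis dl00 : 0 <= dl0.
Hypothesis GP : forall w : wvec R d L r K, inner_le (A + 1) w ->
  hidden_le (b + 1) w -> \sum_k `|wt w (outer k)| <= K%:R ->
  exists i, forall x, (forall j, `|tnth x j| <= rho) ->
    `|truncate beta (network r0 w x) - G i x| <= dl0.

(** The remainder of [final_weights_oracle] at [D = 2 * beta], which bounds [|m(X) - Y|] when
    [|Y| <= beta]. *)
Definition descent_err : R :=
  let pe := @path_err R d L r n c9 b beta rho in
  let dl := Lam * (pe + (q + 1) * (2 / n%:R) ^+ 2 / 2) in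
  2 * pe + (2 * n%:R + tmin%:R) * 2 / n%:R ^+ 2 + 2 * dl ^+ 2 + 2 * dl * (2 * beta).

(** The estimate is replaced by its neighbour [G i] in the cover, at cost [4 * beta * dl0] in the
    true risk and twice that through the doubled empirical excess, hence the 12. Truncation only
    lowers the empirical risk, as all responses lie within [beta], so the oracle inequality for the
    untruncated network applies. *)
Lemma risk_pointwise_le t (w0 w : wvec R d L r K) :
  (forall i, (1 <= i <= n)%N -> forall j, `|tnth (X i t) j| <= rho) ->
  (forall i, (1 <= i <= n)%N -> `|Y i t| <= beta) ->
  (forall k, outw w0 k = 0) -> hidden_le b w0 -> inner_le A w0 ->
  sqdist w w0 <= (2 / n%:R) ^+ 2 ->
  (L2_risk (X 0%N) (estimator r0 n (fun i => X i t) (fun i => Y i t) c8 c9 tmin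
     w0 beta) m <=
   (max_deviation X Y m beta n G t +
    2 * avg n (fun i => excess_ub (network r0 w) (Z i t)) +
    (12 * beta * dl0 + 2 * descent_err))%:E)%E.
Proof.
move=> Xt Yt w00 w0h w0i ww0; have n0 : (0 < n)%N by exact: ltnW.
have beta0 : 0 <= beta by rewrite (le_trans _ beta1).
have [h1 h2 h3 h4] := final_weights_oracle (x := fun i => X i t) (y := fun i => Y i t) r0
  n1 K0 tmin0 c90 rho1 b0 Xt Yt w00 w0h w0i c80 ln1 Qn c9n.
set w' := final_weights _ _ _ _ _ _ _ _ in h1 h2 h3 h4.
have w'K : \sum_k `|wt w' (outer k)| <= K%:R.
  rewrite -[X in _ <= X%:R]card_ord -sum1_card natr_sum; apply: ler_sum => k _.
  rewrite -(@expr_le1 _ 2)// real_normK ?num_real// (le_trans _ h3)//.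
  by rewrite (bigD1 k)//= lerDl sumr_ge0// => ? _; exact: sqr_ge0.
have [i Gi] := GP h1 h2 w'K.
pose f := truncate beta \o network r0 w'.
have H1 : (L2_risk (X 0%N) f m <= (L2dist X m (G i) + 4 * beta * dl0)%:E)%E.
  apply: L2_risk_le => //; last by move=> x; exact: truncate_le.
  apply: measurableT_comp; first exact: measurable_truncate.
  exact: measurable_network.
apply: (le_trans H1); rewrite lee_fin.
have := deviation_le X Y m beta1 n0 G i t; rewrite /deviation => H2.
have H3 : avg n (fun k => excess m beta (G i) (Z k t)) <=
    emp_risk r0 n (fun i => X i t) (fun i => Y i t) w' -
    lsq n (fun i => Y i t) (fun i => m (X i t)) + 4 * beta * dl0.
  rewrite /emp_risk -/(avg n _) /lsq -(avg_cst (4 * beta * dl0) n0) -avgB -avgD.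
  apply: ler_avg => k nk; rewrite /excess /= inside1 ?Yt// mulr1.
  have := Gi _ (Xt _ nk); have := Gb i (X k t); have := Yt _ nk.
  rewrite real_normK ?num_real//; set y := Y k t; set fx := network _ _ _.
  have := truncate_le fx beta0; have := truncate_lipschitz beta fx y.
  set u := truncate _ fx; set v := G _ _ => uy ub yb vb uv.
  rewrite (truncate_id yb) in uy.
  have uy2 : (u - y) ^+ 2 <= (fx - y) ^+ 2.
    by rewrite -real_normK ?num_real// -[leRHS]real_normK ?num_real// lerXn2r ?nnegrE.
  have : (v - u) * (v + u - 2 * y) <= dl0 * (4 * beta).
    rewrite (le_trans (ler_norm _))// normrM ler_pM//; first by rewrite distrC.
    by rewrite ler_norml; move: ub yb vb; rewrite !ler_norml; lra.
  by move: uy2; rewrite !expr2; lra.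
have H4 := h4 w (fun i => m (X i t)) (2 * beta) ww0.
have mY k : (1 <= k <= n)%N -> `|m (X k t) - Y k t| <= 2 * beta.
  move=> nk; rewrite (le_trans (ler_normB _ _))//.
  by have := le_trans (mM (X k t)) Mbeta; have := Yt _ nk; lra.
have := H4 mY; rewrite /descent_err /excess_ub /=.
move: H2 H3; set a1 := avg n _; set a2 := avg n _; set e := emp_risk _ _ _ _ _.
by set l := lsq _ _ _; set D := L2dist _ _ _; set md := max_deviation _ _ _ _ _ _ _;
  lra.
Qed.

End pointwise_bound.

Section Rintegral_tools.
Context {R : realType} {dT : measure_display} {T : measurableType dT}.
Variable P : probability T R.
Implicit Types f g : T -> R.

Definition has_Rintegral f (v : R) : Prop :=
  P.-integrable setT (EFin \o f) /\ (\int[P]_t f t = v)%R.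

Lemma has_RintegralD f g u v : has_Rintegral f u -> has_Rintegral g v ->
  has_Rintegral (fun t => f t + g t) (u + v).
Proof.
move=> [fi <-] [gi <-]; split; last exact: RintegralD.
rewrite (_ : _ \o _ = (EFin \o f) \+ (EFin \o g))%E//.
exact: integrableD.
Qed.

Lemma has_RintegralZ a f u : has_Rintegral f u ->
  has_Rintegral (fun t => a * f t) (a * u).
Proof.
move=> [fi <-]; split; last exact: RintegralZl.
rewrite (_ : _ \o _ = (fun t => a%:E * (EFin \o f) t)%E)//.
exact: integrableZl.
Qed.

Lemma has_Rintegral_cst c : has_Rintegral (fun=> c) c.
Proof.
split; last exact: Rintegral_cstT.
exact: finite_measure_integrable_cst.
Qed.

Lemma has_Rintegral_sum (J : Type) (s : seq J) (F : J -> T -> R) (v : J -> R) :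
  (forall j, has_Rintegral (F j) (v j)) ->
  has_Rintegral (fun t => \sum_(j <- s) F j t) (\sum_(j <- s) v j).
Proof.
move=> Fv; elim: s => [|j s IH].
  rewrite big_nil (_ : (fun t => _) = fun=> 0); first exact: has_Rintegral_cst.
  by apply/funext => t; rewrite big_nil.
rewrite big_cons (_ : (fun t => _) = fun t => F j t + \sum_(j <- s) F j t).
  exact: has_RintegralD.
by apply/funext => t; rewrite big_cons.
Qed.

Lemma has_Rintegral_avg n (F : nat -> T -> R) (v : nat -> R) :
  (forall j, has_Rintegral (F j) (v j)) ->
  has_Rintegral (fun t => avg n (fun i => F i t)) (avg n v).
Proof. by move=> Fv; apply: has_RintegralZ; exact: has_Rintegral_sum. Qed.

Lemma has_Rintegral_indic (A : set T) : measurable A ->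
  has_Rintegral (fun t => \1_A t) (fine (P A)).
Proof.
move=> mA; split; last by rewrite /Rintegral integral_indic// setIT.
apply: (@bounded_integrable _ _ _ _ _ 1) => [|t]; first exact: measurable_indic.
by rewrite indicE; case: (_ \in _); rewrite ?normr1 ?normr0.
Qed.

Lemma has_Rintegral_EFin f v : has_Rintegral f v -> (\int[P]_t (f t)%:E = v%:E)%E.
Proof. by move=> [fi <-]; exact: EFin_Rintegral. Qed.

End Rintegral_tools.

(** * Risk bound in expectation *)

Section expected_risk.
Context {R : realType} {dT : measure_display} {T : measurableType dT}.
Variable P : probability T R.
Context {d L r K : nat}.
Variables (r0 : (0 < r)%N) (X : nat -> {RV P >-> d.-tuple R}) (Y : nat -> {RV P >-> R}).
Variable W : widx d L r K -> {RV P >-> R}.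
Local Notation S := (d.-tuple R * R)%type.
Local Notation Z := (pair_rv X Y).
Hypothesis XY_ident : forall i, identically_distributed P
  (fun t => (X i t, Y i t)) (fun t => (X 0%N t, Y 0%N t)).
Hypothesis ind : mutually_independent P (data_and_weights_systems X Y W).
Variables (m : d.-tuple R -> R) (M beta : R).
Hypothesis m_regression : regression_function (X 0%N) (Y 0%N) m.
Hypothesis mM : forall x, `|m x| <= M.
Hypothesis Y_int : P.-integrable setT (EFin \o Y 0%N).
Hypotheses (beta1 : 1 <= beta) (Mbeta : M <= beta).
Variable rho : R.
Hypothesis rho1 : 1 <= rho.
Hypothesis X_rho : forall x, rv_support (X 0%N) x -> enorm (tnth x) <= rho.
Variables (n : nat) (c8 c9 : R) (tmin : nat) (A b : R).
Hypotheses (n1 : (1 < n)%N) (K0 : (0 < K)%N) (tmin0 : (0 < tmin)%N) (c90 : 0 < c9).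
Hypotheses (A0 : 0 <= A) (b0 : 0 <= b) (c80 : 0 <= c8) (ln1 : 1 <= ln (n%:R : R)).
Hypothesis W_init : initial_distribution A b W.
Local Notation q := (#|{: nidx d L r}|%:R : R).
Local Notation Lam := (@lipc R L r (b + 1) rho).
Hypothesis Qn : 2 / n%:R * (q * Lam ^+ 2 * (beta ^+ 2 + 1 + 2) ^+ 2) <= 1.
Hypothesis c9n : c9 * ln n%:R / n%:R <= 1.
Variables (I : finType) (G : I -> d.-tuple R -> R) (dl0 : R).
Hypothesis I0 : (0 < #|I|)%N.
Hypothesis mG : forall i, measurable_fun setT (G i).
Hypothesis Gb : forall i x, `|G i x| <= beta.
Hypothesis dl00 : 0 <= dl0.
Hypothesis GP : forall w : wvec R d L r K, inner_le (A + 1) w ->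
  hidden_le (b + 1) w -> \sum_k `|wt w (outer k)| <= K%:R ->
  exists i, forall x, (forall j, `|tnth x j| <= rho) ->
    `|truncate beta (network r0 w x) - G i x| <= dl0.
Variables (tau pY y4 : R).
Hypothesis tail_int : P.-integrable setT (EFin \o (fun t => tail beta (Y 0%N t))).
Hypothesis tail_tau : (\int[P]_t tail beta (Y 0%N t) <= tau)%R.
Hypothesis out_int : P.-integrable setT (EFin \o (fun t => 1 - inside beta (Y 0%N t))).
Hypothesis out_le : (\int[P]_t (1 - inside beta (Y 0%N t)) <= pY)%R.
Hypothesis Y4_int : P.-integrable setT (EFin \o (fun t => Y 0%N t ^+ 4)).
Hypothesis Y4_le : (\int[P]_t (Y 0%N t ^+ 4) <= y4)%R.

Let theta : R := n%:R / (8 * (4 * beta) ^+ 2).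
Let n0 : (0 < n)%N. Proof. exact: ltnW. Qed.
Let nR : 0 < n%:R :> R. Proof. by rewrite ltr0n. Qed.
Let mm : measurable_fun setT m. Proof. exact: measurable_regression m_regression. Qed.
Let mZ := measurable_pair_rv X Y.

Local Notation w0 t := (random_wvec W t).
Local Notation derr := (@descent_err R d L r beta rho n c9 tmin b).

Lemma wt_random a t : wt (w0 t) a = W a t.
Proof. by rewrite /wt mxE enum_rankK. Qed.

Lemma has_Rintegral_pair (h : S -> R) v k : measurable_fun setT h ->
  (forall z, 0 <= h z) -> has_Rintegral P (fun t => h (Z 0%N t)) v ->
  has_Rintegral P (fun t => h (Z k t)) v.
Proof.
move=> mh h0 hv; have E := ge0_integral_ident XY_ident k mh h0.
rewrite (has_Rintegral_EFin hv) in E; split; last by rewrite /Rintegral E.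
apply: ge0_integrable_lty => //; last by rewrite E ltry.
exact: measurableT_comp.
Qed.

(** The initial outer weights are 0; the value 1 just gives an interval containing 0. *)
Definition wbound (a : widx d L r K) : R :=
  match a with inl _ => 1 | inr (inl _) => A | inr (inr _) => b end.

(* Counts the ways of leaving the event on which [risk_pointwise_le] applies. *)
Definition bad (t : T) : R :=
  \sum_a \1_(~` `[- wbound a, wbound a]%classic) (W a t) +
  \sum_(1 <= k < n.+1) \1_(outside_box rho) (X k t) +
  \sum_(1 <= k < n.+1) (1 - inside beta (Y k t)).

(* Both are picked up by [//] below. *)
Let indic_ge0' (U : Type) (B : set U) (u : U) : 0 <= \1_B u :> R.
Proof. by rewrite indicE; case: (_ \in _). Qed.

Let outside_ge0 y : 0 <= 1 - inside beta y.
Proof. by rewrite subr_ge0 /inside indicE; case: (_ \in _). Qed.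

Lemma bad_ge0 t : 0 <= bad t.
Proof. by rewrite !addr_ge0// sumr_ge0. Qed.

(** Only the responses contribute: the initial weights lie in their intervals and the inputs in the
    box almost surely, so the first two sums integrate to 0. *)
Lemma has_Rintegral_bad :
  has_Rintegral P bad (n%:R * (\int[P]_t (1 - inside beta (Y 0%N t)))%R).
Proof.
have mC (c : R) : measurable (~` `[- c, c] : set R).
  by apply: measurableC; exact: measurable_itv.
rewrite -[X in has_Rintegral _ _ X]add0r -[X in _ _ _ (X + _)](addr0 0).
apply: has_RintegralD; [apply: has_RintegralD|].
- have z : \sum_(a : widx d L r K) 0 = 0 :> R by rewrite big1.
  rewrite -[X in has_Rintegral _ _ X]z.
  apply: has_Rintegral_sum => a.
  have H : P (W a @^-1` (~` `[- wbound a, wbound a])) = 0%E.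
    case: W_init => Wo Wh Wi; case: a => [k|[[[k i] j]|[[[l k] i] j]]] /=.
    - rewrite (_ : _ @^-1` _ = set0) ?measure0//.
      apply/seteqP; split => t //=; have := Wo k t; rewrite /outer => ->.
      by rewrite in_itv /= oppr_le0 !ler01.
    - exact: uniform_null (Wi k i j).
    - exact: uniform_null (Wh l k i j).
  have := @has_Rintegral_indic _ _ _ P (W a @^-1` (~` `[- wbound a, wbound a])).
  rewrite H; apply; rewrite -[X in measurable X]setTI.
  by apply: measurable_funPT => //; exact: mC.
- have z : \sum_(1 <= k < n.+1) 0 = 0 :> R by rewrite big1.
  rewrite -[X in has_Rintegral _ _ X]z.
  apply: has_Rintegral_sum => k.
  apply: (@has_Rintegral_pair (fun z => \1_(outside_box rho) z.1)) => //.
    apply: measurableT_comp => //; apply: measurable_indic.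
    exact: measurable_outside_box.
  have := @has_Rintegral_indic _ _ _ P (X 0%N @^-1` outside_box rho).
  rewrite (bounded_support_null X_rho); apply.
  rewrite -[X in measurable X]setTI.
  by apply: measurable_funPT => //; exact: measurable_outside_box.
- set c := (\int[P]_t _)%R.
  have z : \sum_(1 <= k < n.+1) c = n%:R * c.
    by rewrite sumr_const_nat subSS subn0 mulr_natl.
  rewrite -[X in has_Rintegral _ _ X]z.
  apply: has_Rintegral_sum => k.
  apply: (@has_Rintegral_pair (fun z => 1 - inside beta z.2)) => //.
  apply: measurable_funB => //; apply: measurableT_comp => //.
  exact: measurable_inside.
Qed.

Lemma L2_riskE (f : d.-tuple R -> R) c : measurable_fun setT f -> (forall x, `|f x| <= c) ->
  L2_risk (X 0%N) f m = (L2dist X m f)%:E.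
Proof.
move=> mf fc.
have mfm : measurable_fun setT (fun x => (`|f x - m x| ^+ 2)%:E).
  apply/measurable_EFinP; apply: measurable_funX; apply: measurableT_comp => //.
  exact: measurable_funB.
have fm0 x : (0 <= (`|f x - m x| ^+ 2)%:E)%E by rewrite lee_fin exprn_ge0.
rewrite /L2_risk ge0_integral_distribution//=.
under eq_integral do rewrite real_normK ?num_real//.
rewrite EFin_Rintegral//; apply: (@bounded_integrable _ _ _ _ _ ((c + M) ^+ 2)).
  apply: measurable_funX; apply: (@measurableT_comp _ _ _ _ _ _ (fun x => f x - m x)) => //.
  exact: measurable_funB.
move=> t; have fm : `|f (X 0%N t) - m (X 0%N t)| <= c + M.
  by rewrite (le_trans (ler_normB _ _))// lerD.
by rewrite normrX lerXn2r ?nnegrE// (le_trans _ fm).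
Qed.

Lemma network_bounded (w : wvec R d L r K) x :
  `|network r0 w x| <= \sum_k `|wt w (outer k)|.
Proof.
rewrite /network (le_trans (ler_norm_sum _ _ _))//; apply: ler_sum => k _.
by rewrite normrM ler_piMr// norm_neuron_le1.
Qed.

Lemma L2_risk_network (w : wvec R d L r K) :
  L2_risk (X 0%N) (network r0 w) m = (L2dist X m (network r0 w))%:E.
Proof. exact: L2_riskE (measurable_network r0 w) (network_bounded w). Qed.

Lemma L2dist_ge0 f : 0 <= L2dist X m f.
Proof. by apply: Rintegral_ge0 => t _; exact: sqr_ge0. Qed.

Lemma has_Rintegral_excess_ub (f : d.-tuple R -> R) c : measurable_fun setT f ->
  (forall x, `|f x| <= c) ->
  has_Rintegral P (fun t => excess_ub m f (Z 0%N t)) (2 * L2dist X m f).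
Proof.
move=> mf fc.
have mfm : measurable_fun setT (fun x => f x - m x) by exact: measurable_funB.
have fm x : `|f x - m x| <= c + M by rewrite (le_trans (ler_normB _ _))// lerD.
rewrite -[X in has_Rintegral _ _ X]addr0 -[X in _ _ _ (_ + X)](mulr0 2).
apply: has_RintegralD; apply: has_RintegralZ; split => //.
- apply: (@bounded_integrable _ _ _ _ _ ((c + M) ^+ 2)).
    by apply: measurable_funX; exact: (@measurableT_comp _ _ _ _ _ _ (fun x => f x - m x)).
  by move=> t; rewrite normrX lerXn2r ?nnegrE// (le_trans _ (fm (X 0%N t))).
- apply: (bounded_mul_integrable X mfm fm (U := fun t => m (X 0%N t) - Y 0%N t)).
  rewrite (_ : _ \o _ = (EFin \o (fun t => m (X 0%N t))) \- (EFin \o Y 0%N))%E//.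
  apply: integrableB => //; apply: (@bounded_integrable _ _ _ _ _ M) => //.
  exact: measurableT_comp.
- exact: (regression_orthogonal m_regression mM Y_int mfm fm).
Qed.

Lemma measurable_excess_ub (f : d.-tuple R -> R) : measurable_fun setT f ->
  measurable_fun setT (excess_ub m f).
Proof.
move=> mf; have mf1 : measurable_fun setT (fun z : S => f z.1 - m z.1).
  by apply: measurable_funB; apply: measurableT_comp.
apply: measurable_funD; apply: measurable_funM => //; first exact: measurable_funX.
apply: measurable_funM => //; apply: measurable_funB => //.
exact: measurableT_comp.
Qed.

(* The choice of [h] gives the cells diameter at most [1/n]. *)
Let N : R := #|{: widx d L r K}|%:R.
Let h : R := (2 * n%:R * (N + 1))^-1.
Let H : nat := (Num.truncn ((A + b) / h)).+1.
Let J := {ffun widx d L r K -> 'I_H}.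
Let C (j : J) : set T := \bigcap_a (W a @^-1` cell (A + b) h (j a)).

Let N0 : 0 <= N. Proof. by []. Qed.
Let h0 : 0 < h.
Proof. by rewrite invr_gt0 !mulr_gt0// ltr_wpDl. Qed.

Let mC j : measurable (C j).
Proof.
apply: fin_bigcap_measurable => // a _; rewrite -[X in measurable X]setTI.
by apply: measurable_funPT => //; exact: measurable_cell.
Qed.

Let C_inj i j t : C i t -> C j t -> i = j.
Proof.
move=> Ci Cj; apply/ffunP => a; apply: val_inj.
exact: (cell_inj h0 (Ci a Logic.I) (Cj a Logic.I)).
Qed.

Let C_dist j t t' : C j t -> C j t' -> sqdist (w0 t) (w0 t') <= n%:R^-1 ^+ 2.
Proof.
move=> Ct Ct'; apply: (@le_trans _ _ (\sum_(a : widx d L r K) (2 * h) ^+ 2)).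
  apply: ler_sum => a _; rewrite !wt_random.
  have := cell_dist h0 (Ct a Logic.I); have := cell_dist h0 (Ct' a Logic.I).
  rewrite !normrM normfV (gtr0_norm h0) !ler_pdivrMr// !mul1r.
  set c := cell_center _ _ _ => h1 h2.
  rewrite -[leLHS]real_normK ?num_real// lerXn2r ?nnegrE//.
    by rewrite mulr_ge0// ltW.
  rewrite -(subrKA c) (le_trans (ler_normD _ _))// [X in _ + X]distrC; lra.
rewrite sumr_const -[leLHS]mulr_natl -/N.
have -> : 2 * h = n%:R^-1 / (N + 1).
  by rewrite /h; field; rewrite !gt_eqF// ltr_wpDl.
rewrite expr_div_n mulrCA ler_piMr ?sqr_ge0//.
rewrite ler_pdivrMr ?exprn_gt0 ?ltr_wpDl// mul1r expr2.
by have := N0; nra.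
Qed.

(* One weight vector serves for all initial weights in the cell, so that its
   choice depends neither on the data nor on a measurable selection. *)
Let near_min j : exists w : wvec R d L r K, forall t, C j t ->
  sqdist w (w0 t) <= (2 / n%:R) ^+ 2 /\
  forall w', enorm ((w' - w0 t) 0) <= n%:R^-1 ->
    L2dist X m (network r0 w) <= L2dist X m (network r0 w') + n%:R^-1.
Proof.
have [[t0 Ct0]|nC] := pselect (exists t, C j t); last first.
  by exists 0 => t Ct; exfalso; apply: nC; exists t.
have ni0 : 0 < n%:R^-1 :> R by rewrite invr_gt0.
(* Weights within [1/n] of the initial weights of some outcome in the cell. As the cell has diameter
   at most [1/n], each of them is within [2/n] of the initial weights of every outcome in the cell;
   this is the origin of the radius [2/n]. *)
pose D := [set w : wvec R d L r K | exists2 t, C j t &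
  enorm ((w - w0 t) 0) <= n%:R^-1].
pose E := [set L2dist X m (network r0 w) | w in D].
have lbE : lbound E 0 by move=> _ [w _ <-]; exact: L2dist_ge0.
have hE : has_inf E.
  split; last by exists 0.
  exists (L2dist X m (network r0 (w0 t0))), (w0 t0) => //; exists t0 => //.
  by rewrite subrr /enorm big1 ?sqrtr0 ?ltW// => i _; rewrite mxE expr0n.
have [_ [w [t1 Ct1 wt1] <-] wE] := inf_adherent ni0 hE.
exists w => t Ct; split.
  have e1 : sqdist w (w0 t1) <= n%:R^-1 ^+ 2.
    by rewrite -enormB_sq lerXn2r ?nnegrE ?sqrtr_ge0// ltW.
  have e2 := C_dist Ct1 Ct.
  apply: (@le_trans _ _ (2 * sqdist w (w0 t1) + 2 * sqdist (w0 t1) (w0 t))).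
    rewrite /sqdist !mulr_sumr -big_split /=; apply: ler_sum => a _.
    set u := wt w a; set v := wt (w0 t1) a; set z := wt (w0 t) a.
    by have := sqr_ge0 ((u - v) - (v - z)); rewrite !expr2; lra.
  rewrite expr_div_n -[in leRHS]exprVn; lra.
move=> w' w't; rewrite (le_trans (ltW wE))// lerD2r.
apply: ge_inf; first by exists 0.
by exists w' => //; exists t.
Qed.

Lemma expected_risk_le :
  (\int[P]_t L2_risk (X 0%N)
     (estimator r0 n (fun i => X i t) (fun i => Y i t) c8 c9 tmin (w0 t) beta) m <=
   4%:E * \int[P]_t ereal_inf [set L2_risk (X 0%N) (network r0 w) m
      | w in [set w | enorm ((w - w0 t) 0) <= n%:R^-1]%R] +
   ((ln #|I|%:R + expR (2 * theta * tau)) / theta + 4 / n%:R +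
    (12 * beta * dl0 + 2 * derr) + (6 * beta ^+ 2 + n%:R) * (n%:R * pY) +
    y4 / n%:R)%:E)%E.
Proof.
have [ws Hws] := choice near_min.
have beta0 : 0 <= beta by rewrite (le_trans _ beta1).
pose f j := network r0 (ws j).
pose phi j := L2dist X m (f j).
(* [C j] is an event of the initial weights alone, so each summand factors in expectation into
   [P (C j)] and the mean of [excess_ub] for a fixed network, which is [2 * phi j]. *)
pose Qv t := \sum_(j : J) \1_(C j) t * avg n (fun k => excess_ub m (f j) (Z k t)).
pose cn := 12 * beta * dl0 + 2 * derr.
(* Where [bad >= 1], the risk of the truncated estimate is at most [4 * beta ^+ 2], and [2 * Qv] is
   at least [-(2 * M ^+ 2 + n)] minus the fourth-moment term of [Bd]. As [M <= beta], the product
   [cJ * bad] covers both. *)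
pose cJ := 6 * beta ^+ 2 + n%:R.
pose Bd t := max_deviation X Y m beta n G t + 2 * Qv t + cn + cJ * bad t +
  n%:R^-1 * avg n (fun k => Y k t ^+ 4).
have cn0 : 0 <= cn.
  have B0 : 0 <= b + 1 by rewrite addr_ge0.
  have L0 : 0 <= Lam by rewrite (le_trans _ (lipc_ge1 rho1 B0)).
  have pe0 : 0 <= @path_err R d L r n c9 b beta rho by exact: path_err_ge0.
  have t1 : 0 <= (2 * n%:R + tmin%:R) * 2 / n%:R ^+ 2 :> R.
    by rewrite divr_ge0 ?exprn_ge0// mulr_ge0// addr_ge0// mulr_ge0.
  rewrite /cn /descent_err; set dl := Lam * _.
  have dl0' : 0 <= dl.
    by rewrite mulr_ge0// addr_ge0// divr_ge0// mulr_ge0 ?sqr_ge0// addr_ge0.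
  have t2 : 0 <= dl * beta by rewrite mulr_ge0.
  have t3 : 0 <= beta * dl0 by rewrite mulr_ge0.
  by have := sqr_ge0 dl; lra.
have cJ0 : 0 <= cJ by rewrite addr_ge0 ?mulr_ge0 ?sqr_ge0.
have QvE j t : C j t -> Qv t = avg n (fun k => excess_ub m (f j) (Z k t)).
  move=> Cj; rewrite /Qv (bigD1 j)//= indicE mem_set// mul1r big1 ?addr0//.
  move=> i ij; rewrite indicE memNset ?mul0r// => Ci.
  by move: ij; rewrite (C_inj Ci Cj) eqxx.
have md0 t : 0 <= max_deviation X Y m beta n G t by exact: max_deviation_ge0.
have avg4 t : 0 <= n%:R^-1 * avg n (fun k => Y k t ^+ 4).
  rewrite mulr_ge0 ?invr_ge0// avg_ge0// => k.
  by rewrite (exprM _ 2 2) sqr_ge0.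
have Qv_ge t : - (2 * M ^+ 2 + n%:R + n%:R^-1 * avg n (fun k => Y k t ^+ 4)) <= 2 * Qv t.
  have [[j Cj]|nC] := pselect (exists j, C j t); last first.
    rewrite /Qv big1 ?mulr0.
      have := sqr_ge0 M; have := avg4 t; have := ltW nR; lra.
    move=> j _; rewrite indicE memNset ?mul0r// => Cj; apply: nC; by exists j.
  rewrite (QvE j)// -avgZ -avgZ -{1}(avg_cst (2 * M ^+ 2 + n%:R) n0) -avgD.
  rewrite -mulN1r -avgZ; apply: ler_avg => k _.
  have := excess_ub_ge mM (f j) (Z k t); rewrite mulN1r /=.
  set y := Y k t; set e := 2 * excess_ub _ _ _.
  (* Trades the second moment for a constant [n], which is charged only through [bad], and a fourth
     moment with weight [1/n], which can be charged for every outcome. *)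
  have : 2 * y ^+ 2 <= n%:R + n%:R^-1 * y ^+ 4.
    have := mulr_ge0 (_ : 0 <= n%:R^-1) (sqr_ge0 (y ^+ 2 - n%:R)).
    move=> /(_ _); rewrite invr_ge0 => /(_ (ltW nR)).
    rewrite (_ : n%:R^-1 * (y ^+ 2 - n%:R) ^+ 2 =
      n%:R^-1 * y ^+ 4 - 2 * y ^+ 2 + n%:R); first lra.
    by field; rewrite gt_eqF.
  lra.
have est_le t : (L2_risk (X 0%N) (estimator r0 n (fun i => X i t) (fun i => Y i t)
    c8 c9 tmin (w0 t) beta) m <= (Bd t)%:E)%E.
  have [good|] := pselect [/\ forall a, (`[- wbound a, wbound a]%classic) (W a t),
      forall k, (1 <= k <= n)%N -> ~ outside_box rho (X k t) &
      forall k, (1 <= k <= n)%N -> `|Y k t| <= beta].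
    have [gW gX gY] := good.
    have rH : A + b < h * H%:R.
      rewrite mulrC -ltr_pdivrMr// /H.
      have Ab0 : 0 <= (A + b) / h by rewrite divr_ge0 ?addr_ge0// ltW.
      by have /andP[_] := Num.Theory.truncn_itv Ab0.
    have Wb a : `|W a t| <= wbound a.
      by have := gW a; rewrite /= in_itv /= -ler_norml.
    have [Wo _ _] := W_init.
    have WAb a : `|W a t| <= A + b.
      case: a (Wb a) => [k _|[a|a]] /=.
      - by have := Wo k t; rewrite /outer => ->; rewrite normr0 addr_ge0.
      - by move/le_trans; apply; rewrite lerDl.
      - by move/le_trans; apply; rewrite lerDr.
    have /choice[jf Hjf] := fun a => cell_ex h0 rH (WAb a).
    pose j : J := finfun jf.
    have Cj : C j t by move=> a _; rewrite /= ffunE; exact: Hjf.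
    have [H1 _] := Hws j t Cj.
    have H2 := @risk_pointwise_le _ _ _ P _ _ _ _ r0 X Y m M beta m_regression mM
      beta1 Mbeta rho rho1 X_rho n c8 c9 tmin A b n1 K0 tmin0 c90 b0 c80 ln1 Qn
      c9n I G dl0 mG Gb dl00 GP t (w0 t) (ws j).
    apply: (le_trans (H2 _ _ _ _ _ H1)).
    - move=> k nk i; rewrite leNgt; apply/negP => xi; apply: (gX k nk).
      by exists i.
    - exact: gY.
    - by move=> k; rewrite /outw wt_random Wo.
    - by move=> l k i i'; rewrite wt_random; exact: (Wb (hidden l k i i')).
    - by move=> k i i'; rewrite wt_random; exact: (Wb (inner k i i')).
    rewrite lee_fin /Bd (QvE j)// -/cn.
    by have := mulr_ge0 cJ0 (bad_ge0 t); have := avg4 t; lra.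
  move=> ngood; have bad1 : 1 <= bad t.
    rewrite leNgt; apply/negP => b1; apply: ngood; split.
    - move=> a; apply: contrapT => Wa; move: b1; rewrite ltNge => /negP; apply.
      rewrite /bad -addrA (bigD1 a)//= indicE mem_set// -addrA lerDl.
      by rewrite !addr_ge0// sumr_ge0.
    - move=> k nk Xk; move: b1; rewrite ltNge => /negP; apply.
      have kn : k \in index_iota 1 n.+1 by rewrite mem_index_iota ltnS.
      rewrite /bad (addrC (\sum_a _)) (big_rem _ kn)/= indicE mem_set// -!addrA lerDl.
      by rewrite !addr_ge0// sumr_ge0.
    - move=> k nk; rewrite leNgt; apply/negP => Yk.
      move: b1; rewrite ltNge => /negP; apply.
      have kn : k \in index_iota 1 n.+1 by rewrite mem_index_iota ltnS.
      rewrite /bad addrC [X in X + _](big_rem _ kn)/= inside0// subr0 -addrA lerDl.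
      by rewrite !addr_ge0// sumr_ge0.
  apply: (@le_trans _ _ ((2 * beta) ^+ 2)%:E).
    rewrite -(integral_cstT (distribution P (X 0%N))).
    apply: ge0_le_integralT => x; rewrite lee_fin ?exprn_ge0//.
    rewrite lerXn2r ?nnegrE ?mulr_ge0// (le_trans (ler_normB _ _))//.
    have := truncate_le (network r0 (final_weights r0 n (fun i => X i t)
      (fun i => Y i t) c8 c9 tmin (w0 t)) x) beta0.
    by have := le_trans (mM x) Mbeta; rewrite /estimator; lra.
  rewrite lee_fin /Bd; have := Qv_ge t; have := md0 t.
  have := ler_wpM2l cJ0 bad1.
  have : M ^+ 2 <= beta ^+ 2.
    have M0 : 0 <= M by rewrite (le_trans _ (mM [tuple 0 | _ < d])).
    by rewrite lerXn2r ?nnegrE.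
  rewrite mulr1 {1}/cJ exprMn; lra.
have intBd : exists2 v, has_Rintegral P Bd v & v <=
    (ln #|I|%:R + expR (2 * theta * tau)) / theta + 2 * \sum_j fine (P (C j)) * (2 * phi j)
     + cn + cJ * (n%:R * pY) + y4 / n%:R.
  have HQ : has_Rintegral P Qv (\sum_j fine (P (C j)) * (2 * phi j)).
    apply: has_Rintegral_sum => j.
    rewrite -(avg_cst (fine (P (C j)) * (2 * phi j)) n0).
    rewrite (_ : (fun t => _) = fun t => avg n (fun k =>
      \1_(C j) t * excess_ub m (f j) (Z k t))); last first.
      by apply/funext => t; rewrite avgZ.
    apply: has_Rintegral_avg => k.
    have [qi qv] := has_Rintegral_excess_ub (measurable_network r0 (ws j))
      (network_bounded (ws j)).
    have CZ (B : set S) : measurable B ->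
        (P (C j `&` Z k @^-1` B) = P (C j) * P (Z k @^-1` B))%E.
      move=> mB; exact: (@independent_weights_data _ _ _ P _ _ X Y W ind
        (fun a => cell (A + b) h (j a)) k B (fun a => measurable_cell _ _ _) mB).
    have [H1 H2] := integral_indep XY_ident (mC j) CZ
      (measurable_excess_ub (measurable_network r0 (ws j))) qi.
    by split; rewrite // H2 qv.
  have mdm : measurable_fun setT (max_deviation X Y m beta n G).
    exact: (measurable_max_deviation m_regression).
  have th0 : 0 < theta by exact: theta_gt0.
  have indn : independent_along P Z (index_iota 1 n.+1).
    by apply: independent_along_data ind _ _; exact: iota_uniq.
  have mdI := integral_max_deviation_le XY_ident m_regression mM Y_int beta1 Mbeta
    tail_int tail_tau n0 indn mG Gb I0.
  have Hmd : has_Rintegral P (max_deviation X Y m beta n G)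
      (\int[P]_t max_deviation X Y m beta n G t)%R.
    split=> //; apply: ge0_integrable_lty => //.
    by apply: le_lt_trans mdI _; rewrite ltry.
  rewrite (has_Rintegral_EFin Hmd) lee_fin in mdI.
  have HY4 : has_Rintegral P (fun t => avg n (fun k => Y k t ^+ 4))
      (\int[P]_t (Y 0%N t ^+ 4))%R.
    rewrite -[X in has_Rintegral _ _ X](avg_cst _ n0).
    apply: has_Rintegral_avg => k.
    apply: (@has_Rintegral_pair (fun z => z.2 ^+ 4)) => //.
      exact: measurable_funX.
    by move=> z; rewrite (exprM _ 2 2) sqr_ge0.
  eexists.
    apply: has_RintegralD; last exact: has_RintegralZ HY4.
    apply: has_RintegralD; last exact: has_RintegralZ has_Rintegral_bad.
    apply: has_RintegralD; last exact: has_Rintegral_cst.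
    apply: has_RintegralD Hmd _; exact: has_RintegralZ HQ.
  apply: lerD; last by rewrite mulrC ler_pM2r ?invr_gt0.
  apply: lerD; last first.
    by rewrite ler_wpM2l ?addr_ge0 ?mulr_ge0 ?sqr_ge0// ler_wpM2l.
  by rewrite lerD2r lerD2r.
(* A nonnegative measurable function below the infimum, constant on each cell; its integral bounds
   that of the infimum from below. *)
pose psi t := \sum_(j : J) \1_(C j) t * Num.max (phi j - n%:R^-1) 0.
have psiE j t : C j t -> psi t = Num.max (phi j - n%:R^-1) 0.
  move=> Cj; rewrite /psi (bigD1 j)//= indicE mem_set// mul1r big1 ?addr0//.
  move=> i ij; rewrite indicE memNset ?mul0r// => Ci.
  by move: ij; rewrite (C_inj Ci Cj) eqxx.
have psi0 t : 0 <= psi t.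
  by apply: sumr_ge0 => j _; rewrite mulr_ge0// le_max lexx orbT.
have psi_le t : ((psi t)%:E <= ereal_inf [set L2_risk (X 0%N) (network r0 w) m
      | w in [set w | enorm ((w - w0 t) 0) <= n%:R^-1]%R])%E.
  apply: le_ereal_inf_tmp => _ [w wt <-]; rewrite L2_risk_network lee_fin.
  have [[j Cj]|nC] := pselect (exists j, C j t); last first.
    rewrite /psi big1 ?L2dist_ge0// => j _; rewrite indicE memNset ?mul0r// => Cj.
    by apply: nC; exists j.
  rewrite (psiE j)// ge_max L2dist_ge0 andbT lerBlDr.
  by have [_ H1] := Hws j t Cj; exact: H1.
have psi_int : has_Rintegral P psi (\sum_j fine (P (C j)) * Num.max (phi j - n%:R^-1) 0).
  apply: has_Rintegral_sum => j.
  rewrite (_ : (fun t => _) = fun t => Num.max (phi j - n%:R^-1) 0 * \1_(C j) t).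
    by rewrite mulrC; apply: has_RintegralZ; exact: has_Rintegral_indic.
  by apply/funext => t; rewrite mulrC.
have sumC : \sum_j fine (P (C j)) <= 1.
  have [H1 <-] := has_Rintegral_sum (index_enum J) (fun j => has_Rintegral_indic P (mC j)).
  rewrite -[leRHS](Rintegral_cstT P 1); apply: le_Rintegral => //.
    exact: finite_measure_integrable_cst.
  move=> t _; have [[j Cj]|nC] := pselect (exists j, C j t); last first.
    by rewrite big1// => j _; rewrite indicE memNset// => Cj; apply: nC; exists j.
  rewrite (bigD1 j)//= indicE mem_set// big1 ?addr0//.
  move=> i ij; rewrite indicE memNset// => Ci.
  by move: ij; rewrite (C_inj Ci Cj) eqxx.
have [v Hv vle] := intBd.
apply: (@le_trans _ _ (\int[P]_t (Bd t)%:E)%E).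
  apply: ge0_le_integralT => // t; apply: integral_ge0 => x _.
  by rewrite lee_fin exprn_ge0.
rewrite (has_Rintegral_EFin Hv).
pose s := \sum_j fine (P (C j)) * Num.max (phi j - n%:R^-1) 0.
have ps : (s%:E <= \int[P]_t ereal_inf [set L2_risk (X 0%N) (network r0 w) m
      | w in [set w | enorm ((w - w0 t) 0) <= n%:R^-1]%R])%E.
  rewrite -(has_Rintegral_EFin psi_int).
  by apply: ge0_le_integralT => // t; rewrite lee_fin.
(* One factor 2 of the constant 4 comes from [excess_ub], the other from [deviation]. Near
   minimality costs [1/n] on each cell, and the cells have total probability at most 1. *)
have sphi : \sum_j fine (P (C j)) * (2 * phi j) <= 2 * s + 2 / n%:R.
  have : \sum_j fine (P (C j)) * (2 * phi j) <=
      \sum_j (2 * (fine (P (C j)) * Num.max (phi j - n%:R^-1) 0) +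
        2 / n%:R * fine (P (C j))).
    apply: ler_sum => j _; have PC0 : 0 <= fine (P (C j)).
      by rewrite fine_ge0// measure_ge0.
    have : phi j - n%:R^-1 <= Num.max (phi j - n%:R^-1) 0 by rewrite le_max lexx.
    set x := Num.max _ _ => xm; have := ler_wpM2l PC0 xm; lra.
  rewrite big_split /= -!mulr_sumr -/s => /le_trans; apply; rewrite lerD2l.
  by rewrite ler_piMr// divr_ge0.
apply: (@le_trans _ _ (4%:E * s%:E + ((ln #|I|%:R + expR (2 * theta * tau)) / theta +
   4 / n%:R + cn + cJ * (n%:R * pY) + y4 / n%:R)%:E)%E); last first.
  by apply: leeD => //; apply: lee_wpmul2l => //; rewrite lee_fin.
rewrite -EFinM -EFinD lee_fin (le_trans vle)//; lra.
Qed.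

End expected_risk.

(** * Rates *)

Section asymptotics.
Context {R : realType}.

Lemma near_le_powR (C a : R) : 0 < a ->
  \forall n \near \oo, C <= (n%:R : R) `^ a.
Proof.
move=> a0; near=> n.
have n0 : 0 <= n%:R :> R by [].
have [C0|C0] := leP C 0; first by rewrite (le_trans C0)// powR_ge0.
have Cn : C `^ a^-1 <= n%:R by near: n; exact: nbhs_infty_ger.
rewrite (_ : C = (C `^ a^-1) `^ a); last first.
  by rewrite -powRrM mulVf ?gt_eqF// powRr1// ltW.
by apply: ge0_ler_powR => //; rewrite ?nnegrE ?powR_ge0// ltW.
Unshelve. all: by end_near. Qed.

(** [n^a] is split into [k + 1] equal powers [n^s]: [k] of them absorb the logarithms by
    [ln n <= n^s / s], the last one absorbs the constants. *)
Lemma near_ln_powR (C a : R) k : 0 < a ->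
  \forall n \near \oo, C * ln (n%:R : R) ^+ k <= n%:R `^ a.
Proof.
move=> a0; pose s := a / k.+1%:R.
have s0 : 0 < s by rewrite divr_gt0.
near=> n.
have n1 : (0 < n)%N by near: n; exists 1%N.
have nR : 0 < n%:R :> R by rewrite ltr0n.
have l0 : 0 <= ln (n%:R : R) by rewrite ln_ge0// ler1n.
have ns0 : 0 < (n%:R : R) `^ s by exact: powR_gt0.
have ln_le : ln (n%:R : R) <= n%:R `^ s / s.
  rewrite ler_pdivlMr// mulrC -ln_powR.
  by rewrite (le_trans (le_expR _))// lnK.
have -> : (n%:R : R) `^ a = (n%:R `^ s) * (n%:R `^ s) ^+ k.
  rewrite -exprS -powR_mulrn ?powR_ge0// -powRrM /s divfK//.
have Cs : `|C| / s ^+ k <= (n%:R : R) `^ s by near: n; exact: near_le_powR.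
apply: (@le_trans _ _ (`|C| * (n%:R `^ s / s) ^+ k)).
  apply: (@le_trans _ _ (`|C| * ln (n%:R : R) ^+ k)).
    by rewrite ler_wpM2r ?exprn_ge0// ler_norm.
  by rewrite ler_wpM2l// lerXn2r// nnegrE// divr_ge0// ltW.
rewrite expr_div_n mulrCA mulrC; apply: ler_wpM2r => //.
Unshelve. all: by end_near. Qed.

Lemma near_ln_ge (C : R) : \forall n \near \oo, C <= ln (n%:R : R).
Proof.
near=> n; rewrite -(expRK C) ler_ln ?posrE ?expR_gt0//.
  by near: n; exact: nbhs_infty_ger.
by rewrite ltr0n; near: n; exists 1%N.
Unshelve. all: by end_near. Qed.

End asymptotics.

(** * Order of the descent error *)

Section rate.
Context {R : realType} {d L r : nat} (r0 : (0 < r)%N).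
Variables (n : nat) (x c9 b beta rho : R) (tmin : nat).
Hypotheses (n0 : (0 < n)%N) (x2 : 2 <= x) (xn : x ^+ 14 <= n%:R).
Hypotheses (c90 : 0 <= c9) (beta0 : 0 <= beta) (beta_x : beta <= x).
Hypotheses (ln_x : ln (n%:R : R) <= x).
Local Notation q := (#|{: nidx d L r}|%:R : R).
Local Notation Lam := (@lipc R L r (b + 1) rho).
Hypotheses (Lam0 : 0 <= Lam) (Lam_x : Lam <= x).

Let nR : 0 < n%:R :> R. Proof. by rewrite ltr0n. Qed.
Let x1 : 1 <= x. Proof. by rewrite (le_trans _ x2)// ler1n. Qed.
Let x0 : 0 <= x. Proof. by rewrite (le_trans _ x1). Qed.

Lemma monotone_gap_le :
  q * Lam ^+ 2 * (beta ^+ 2 + 1 + 2) ^+ 2 <= 4 * q * x ^+ 6.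
Proof.
have h1 : Lam ^+ 2 <= x ^+ 2 by rewrite lerXn2r ?nnegrE.
have h2 : (beta ^+ 2 + 1 + 2) ^+ 2 <= (2 * x ^+ 2) ^+ 2.
  have : beta ^+ 2 <= x ^+ 2 by rewrite lerXn2r ?nnegrE.
  have : 2 ^+ 2 <= x ^+ 2 by rewrite lerXn2r ?nnegrE.
  move=> h3 h4; rewrite lerXn2r ?nnegrE ?mulr_ge0 ?exprn_ge0//; last lra.
  by rewrite addr_ge0// addr_ge0// sqr_ge0.
have -> : 4 * q * x ^+ 6 = q * x ^+ 2 * (2 * x ^+ 2) ^+ 2 by ring.
apply: ler_pM h2; rewrite ?sqr_ge0//; first exact: mulr_ge0 (sqr_ge0 _).
exact: ler_wpM2l h1.
Qed.

Lemma path_err_le : @path_err R d L r n c9 b beta rho <=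
  (2 * c9 + 12 * q + 4) * x ^+ 6 / n%:R.
Proof.
have Qle := monotone_gap_le.
have n1 : 1 <= n%:R :> R by rewrite ler1n.
have ni1 : n%:R^-1 <= 1 :> R by rewrite invf_le1.
have x61 : 1 <= x ^+ 6 by rewrite exprn_ege1.
have xx6 : x <= x ^+ 6 by rewrite -[leLHS]expr1 ler_weXn2l.
have x46 : x ^+ 4 <= x ^+ 6 by rewrite ler_weXn2l.
have F2 : (beta ^+ 2 + 1 + 1) ^+ 2 <= 4 * x ^+ 4.
  have -> : 4 * x ^+ 4 = (2 * x ^+ 2) ^+ 2 by ring.
  have : beta ^+ 2 <= x ^+ 2 by rewrite lerXn2r ?nnegrE.
  have : 2 ^+ 2 <= x ^+ 2 by rewrite lerXn2r ?nnegrE.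
  move=> h3 h4; rewrite lerXn2r ?nnegrE ?mulr_ge0 ?exprn_ge0//; last lra.
  by rewrite addr_ge0// addr_ge0// sqr_ge0.
set Q := q * _ * _ in Qle.
have -> : @path_err R d L r n c9 b beta rho = (c9 + q * 4 * n%:R^-1 + c9 * ln n%:R + 2 * Q +
    (beta ^+ 2 + 1 + 1) ^+ 2) / n%:R.
  by rewrite /path_err -/Q; field; rewrite gt_eqF.
rewrite ler_pM2r ?invr_gt0//.
have t1 : c9 * ln n%:R <= c9 * x ^+ 6.
  by rewrite ler_wpM2l// (le_trans ln_x).
have t2 : q * 4 * n%:R^-1 <= q * 4 * x ^+ 6.
  by rewrite ler_wpM2l ?mulr_ge0// (le_trans ni1).
have t3 : c9 <= c9 * x ^+ 6 by rewrite ler_peMr.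
lra.
Qed.

Definition descent_cst : R :=
  let c1 := 2 * c9 + 12 * q + 4 in
  let c2 := c1 + 2 * q + 2 in 2 * c1 + 4 + 2 * tmin%:R + 2 * c2 ^+ 2 + 4 * c2.

Lemma descent_err_le : 0 <= @path_err R d L r n c9 b beta rho ->
  @descent_err R d L r beta rho n c9 tmin b <= descent_cst * x ^+ 8 / n%:R.
Proof.
move=> pe0; have pe1 := path_err_le.
rewrite /descent_err /descent_cst.
set pe := path_err _ _ _ _ _ in pe0 pe1 *.
set c1 := 2 * c9 + _ + _ in pe1 *; set c2 := c1 + _ + _.
have c10 : 0 <= c1 by rewrite !addr_ge0// mulr_ge0.
have c20 : 0 <= c2 by rewrite /c2 !addr_ge0// mulr_ge0.
have n1 : 1 <= n%:R :> R by rewrite ler1n.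
have ni0 : 0 < n%:R^-1 :> R by rewrite invr_gt0.
have ni1 : n%:R^-1 <= 1 :> R by rewrite invf_le1.
have x61 : 1 <= x ^+ 6 by rewrite exprn_ege1.
have x81 : 1 <= x ^+ 8 by rewrite exprn_ege1.
have x68 : x ^+ 6 <= x ^+ 8 by rewrite ler_weXn2l.
set dl := Lam * _.
have dl_le : dl <= c2 * x ^+ 7 / n%:R.
  have -> : c2 * x ^+ 7 / n%:R = x * (c2 * x ^+ 6 / n%:R) by ring.
  rewrite ler_pM//.
    by rewrite addr_ge0// divr_ge0// mulr_ge0 ?sqr_ge0// addr_ge0.
  have -> : c2 * x ^+ 6 / n%:R = c1 * x ^+ 6 / n%:R + (2 * q + 2) * x ^+ 6 / n%:R.
    by rewrite /c2; ring.
  rewrite lerD//.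
  have -> : (q + 1) * (2 / n%:R) ^+ 2 / 2 = (2 * q + 2) * n%:R^-1 / n%:R.
    by field; rewrite gt_eqF.
  rewrite ler_pM2r//; apply: ler_wpM2l; last exact: le_trans x61.
  by rewrite addr_ge0// mulr_ge0.
have dl0 : 0 <= dl.
  by rewrite mulr_ge0// addr_ge0// divr_ge0// mulr_ge0 ?sqr_ge0// addr_ge0.
(* [dl] is of order [x^7 / n]; of its square, a factor [x^14 / n] is bounded by 1. This is the
   origin of the exponent 14 in [xn]. *)
have d2 : dl ^+ 2 <= c2 ^+ 2 * x ^+ 8 / n%:R.
  apply: (@le_trans _ _ ((c2 * x ^+ 7 / n%:R) ^+ 2)).
    by rewrite lerXn2r ?nnegrE// (le_trans dl0).
  have -> : (c2 * x ^+ 7 / n%:R) ^+ 2 = c2 ^+ 2 / n%:R * (x ^+ 14 / n%:R) by ring.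
  have -> : c2 ^+ 2 * x ^+ 8 / n%:R = c2 ^+ 2 / n%:R * x ^+ 8 by ring.
  rewrite ler_wpM2l ?divr_ge0 ?sqr_ge0//.
  by rewrite (@le_trans _ _ 1)// ler_pdivrMr// mul1r.
have d3 : dl * beta <= c2 * x ^+ 8 / n%:R.
  have -> : c2 * x ^+ 8 / n%:R = c2 * x ^+ 7 / n%:R * x by ring.
  by rewrite ler_pM.
have t1 : pe <= c1 * x ^+ 8 / n%:R.
  by rewrite (le_trans pe1)// ler_pM2r// ler_wpM2l.
have t2 : (2 * n%:R + tmin%:R) * 2 / n%:R ^+ 2 <= (4 + 2 * tmin%:R) * x ^+ 8 / n%:R.
  have -> : (2 * n%:R + tmin%:R) * 2 / n%:R ^+ 2 =
      (4 + 2 * tmin%:R * n%:R^-1) / n%:R :> R by field; rewrite gt_eqF.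
  rewrite ler_pM2r// [leRHS]mulrDl; apply: lerD; first by rewrite ler_peMr.
  by rewrite ler_wpM2l ?mulr_ge0// (le_trans ni1).
have -> : (2 * c1 + 4 + 2 * tmin%:R + 2 * c2 ^+ 2 + 4 * c2) * x ^+ 8 / n%:R =
  2 * (c1 * x ^+ 8 / n%:R) + (4 + 2 * tmin%:R) * x ^+ 8 / n%:R +
  2 * (c2 ^+ 2 * x ^+ 8 / n%:R) + 4 * (c2 * x ^+ 8 / n%:R) by ring.
lra.
Qed.

End rate.

(** All factors are at least 1, so [A + 1 <= 2 A], [b + 1 <= 2 b] and rounding up together cost only
    the constants 4 and [2^l]. *)
Lemma cell_count_le {R : realType} (l : nat) (A b x rho e u v : R) :
  1 <= A -> 1 <= b -> 1 <= x -> 1 <= rho -> 1 <= e -> 1 <= u -> 1 <= v ->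
  (Num.truncn (rho * (x * ((u * (b + 1) * v) ^+ l * (e * (A + 1)))))).+1%:R <=
  4 * rho * e * (2 * u * v) ^+ l * (A * b ^+ l * x).
Proof.
move=> A1 b1 x1 rho1 e1 u1 v1.
have b11 : 1 <= b + 1 by lra.
have A11 : 1 <= A + 1 by lra.
set g := _ ^+ l * _; set s := rho * (x * g).
have g1 : 1 <= g by rewrite !mulr_ege1// exprn_ege1// !mulr_ege1.
have s1 : 1 <= s by apply: mulr_ege1 => //; exact: mulr_ege1.
have /andP[s_trunc _] := Num.Theory.truncn_itv (le_trans ler01 s1).
rewrite -natr1; apply: (@le_trans _ _ (2 * s)); first by lra.
have uvl : (u * (b + 1) * v) ^+ l <= (2 * u * v) ^+ l * b ^+ l.
  have uv1 : 1 <= u * v by rewrite mulr_ege1.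
  have hb : (b + 1) * (u * v) <= 2 * b * (u * v) by apply: ler_wpM2r; lra.
  have h0 : 0 <= (b + 1) * (u * v) by apply: mulr_ge0; lra.
  rewrite -exprMn; apply: lerXn2r; rewrite ?nnegrE; lra.
have e0 : 0 <= e by lra.
have eA1 : e <= e * A by exact: ler_peMr.
have eA : e * (A + 1) <= 2 * (e * A) by lra.
have gle : g <= (2 * u * v) ^+ l * b ^+ l * (2 * (e * A)).
  apply: ler_pM => //; last by apply: mulr_ge0; lra.
  by apply: exprn_ge0; apply: mulr_ge0; [apply: mulr_ge0|]; lra.
have -> : 4 * rho * e * (2 * u * v) ^+ l * (A * b ^+ l * x) =
  2 * (rho * (x * ((2 * u * v) ^+ l * b ^+ l * (2 * (e * A))))) by ring.
by rewrite ler_pM2l// ler_pM2l ?ler_pM2l//; lra.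
Qed.

(** * Size of the cover *)

Section cover_size.
Context {R : realType} {d L r : nat} (d0 : (0 < d)%N) (r0 : (0 < r)%N).
Variables (p : nat) (C : R).
Hypotheses (p0 : (0 < p)%N) (C1 : 1 <= C).
Hypothesis taylorC : forall v : R, exists a : nat -> R,
    [/\ a 0%N = sigmoid v, forall k, `|a k| <= C
      & forall s, `|sigmoid (v + s) - \sum_(k < p.+1) a k * s ^+ k|
                  <= C * `|s| ^+ p.+1].
Local Notation qw := (#|{: {bseq (p ^ L.-1.+1) of 'I_d}}|).

Lemma cover_exists (n K : nat) (x A b beta rho : R) :
  (0 < n)%N -> 1 <= x -> 1 <= A -> 1 <= b -> 0 <= beta -> 1 <= rho ->
  K%:R * (C * (1 + r%:R * (b + 1)) ^+ L.-1 * x^-1 ^+ p.+1) <= (2 * n%:R)^-1 ->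
  exists (I : finType) (G : I -> d.-tuple R -> R),
    [/\ (0 < #|I|)%N,
        ln #|I|%:R <= qw%:R * (4 * rho * d%:R * (2 * r%:R * (p%:R * C)) ^+ L.-1 *
          (A * b ^+ L.-1 * x)) ^+ d *
          ln (4 * n%:R * qw%:R * (K%:R * (1 + p%:R * C)) + 3),
        (forall i, measurable_fun setT (G i)) /\ (forall i z, `|G i z| <= beta)
      & forall (w : wvec R d L r K), inner_le (A + 1) w -> hidden_le (b + 1) w ->
        \sum_k `|wt w (outer k)| <= K%:R ->
        exists i, forall z, (forall j, `|tnth z j| <= rho) ->
          `|truncate beta (network r0 w z) - G i z| <= n%:R^-1].
Proof.
move=> n0 x1 A1 b1 beta0 rho1 Hp.
have nR : 0 < n%:R :> R by rewrite ltr0n.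
have C0 : 0 <= C by rewrite (le_trans _ C1).
have x0 : 0 < x by lra.
have q1 : 1 <= qw%:R :> R by rewrite ler1n; apply/card_gt0P; exists [bseq].
have q0 : 0 < qw%:R :> R by lra.
have d1 : 1 <= d%:R :> R by rewrite ler1n.
have r1 : 1 <= r%:R :> R by rewrite ler1n.
have p1 : 1 <= p%:R :> R by rewrite ler1n.
have pC1 : 1 <= p%:R * C by rewrite mulr_ege1.
pose g := (r%:R * (b + 1) * (p%:R * C)) ^+ L.-1 * (d%:R * (A + 1)).
have g1 : 1 <= g.
  rewrite mulr_ege1// ?exprn_ege1//; last by rewrite mulr_ege1//; lra.
  by rewrite mulr_ege1// mulr_ege1//; lra.
have g0 : 0 < g by lra.
(* The cell size for which the increment, propagated through all levels, is exactly [x^-1], the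
   value of [eta] in the cover. *)
pose h := (x * g)^-1.
have h0 : 0 < h by rewrite invr_gt0 mulr_gt0.
(* Rounding all [qw] coefficients costs [1 / (2 n)]; the other half of [1/n] is left to the Taylor
   remainder. *)
pose tol := (2 * n%:R * qw%:R)^-1 : R.
have tol0 : 0 < tol by rewrite invr_gt0 !mulr_gt0.
pose H := (Num.truncn (rho / h)).+1.
pose Sx := K%:R * (1 + p%:R * C).
have Sx0 : 0 <= Sx by rewrite mulr_ge0// addr_ge0// mulr_ge0.
pose J := (Num.truncn (Sx / tol)).+1.
have rhoh0 : 0 <= rho / h by rewrite divr_ge0//; lra.
have St0 : 0 <= Sx / tol by rewrite divr_ge0// ltW.
have /andP[H1 H2] := Num.Theory.truncn_itv rhoh0.
have /andP[J1 J2] := Num.Theory.truncn_itv St0.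
have rH : rho < h * H%:R by rewrite mulrC -ltr_pdivrMr.
have SJ : Sx <= tol * J%:R by rewrite mulrC -ler_pdivrMr// ltW.
have le_eta : (r%:R * (b + 1) * (p%:R * C)) ^+ L.-1 * (d%:R * (A + 1) * h) <= x^-1.
  by rewrite mulrA -/g /h invfM mulrCA divff ?gt_eqF// mulr1.
have xi1 : x^-1 <= 1 by rewrite invf_le1.
have A10 : 0 <= A + 1 by lra.
have b11 : 1 <= b + 1 by lra.
have [I [G [cI mG Gb GP]]] := network_cover (L := L) r0 p0 C1 taylorC
  A10 b11 h0 xi1 beta0 tol0 le_eta rH SJ.
exists I, G; split => //.
- by rewrite cI expn_gt0.
- rewrite cI natrX lnXn ?ltr0n// -[leLHS]mulr_natl natrM natrX.
  have J3 : J.*2.+1%:R <= 4 * n%:R * qw%:R * Sx + 3 :> R.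
    rewrite -addnn -natr1 natrD /J -natr1.
    have -> : 4 * n%:R * qw%:R * Sx = 2 * (Sx / tol).
      by rewrite /tol invrK; ring.
    by lra.
  have H3 : H%:R <= 4 * rho * d%:R * (2 * r%:R * (p%:R * C)) ^+ L.-1 *
          (A * b ^+ L.-1 * x).
    by rewrite /H /h invrK; exact: cell_count_le.
  rewrite ler_pM//.
  + by rewrite ln_ge0// ler1n.
  + by rewrite ler_wpM2l// lerXn2r ?nnegrE// (le_trans _ H3).
  + by rewrite ler_ln ?posrE ?ltr0n// (lt_le_trans _ J3)// ltr0n.
- move=> w wA wB wS; have [i Hi] := GP _ w wA wB wS.
  exists i => z zr; rewrite (le_trans (Hi z zr))//.
  have -> : qw%:R * tol = (2 * n%:R)^-1 :> R.
    by rewrite /tol; field; rewrite !gt_eqF.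
  have -> : n%:R^-1 = (2 * n%:R)^-1 + (2 * n%:R)^-1 :> R by field; rewrite gt_eqF.
  by rewrite lerD.
Qed.

End cover_size.

(** * Risk bound for large samples *)

Section large_sample.
Context {R : realType} {dT : measure_display} {T : measurableType dT}.
Variable P : probability T R.
Context {d L r K : nat}.
Variables (d0 : (0 < d)%N) (r0 : (0 < r)%N).
Variables (X : nat -> {RV P >-> d.-tuple R}) (Y : nat -> {RV P >-> R}).
Variable W : widx d L r K -> {RV P >-> R}.
Hypothesis XY_ident : forall i, identically_distributed P
  (fun t => (X i t, Y i t)) (fun t => (X 0%N t, Y 0%N t)).
Hypothesis ind : mutually_independent P (data_and_weights_systems X Y W).
Variables (m : d.-tuple R -> R) (M rho c7 c8 c9 : R) (tmin p k1 : nat) (C : R).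
Hypothesis m_regression : regression_function (X 0%N) (Y 0%N) m.
Hypothesis mM : forall x, `|m x| <= M.
Hypothesis c70 : 0 < c7.
Hypothesis Yexp : ('E_P[fun t => expR (c7 * Y 0%N t ^+ 2)] < +oo)%E.
Hypothesis rho1 : 1 <= rho.
Hypothesis X_rho : forall x, rv_support (X 0%N) x -> enorm (tnth x) <= rho.
Hypotheses (c80 : 0 <= c8) (c90 : 0 < c9) (tmin0 : (0 < tmin)%N).
Hypotheses (p0 : (0 < p)%N) (C1 : 1 <= C).
Hypothesis taylorC : forall v : R, exists a : nat -> R,
    [/\ a 0%N = sigmoid v, forall k, `|a k| <= C
      & forall s, `|sigmoid (v + s) - \sum_(k < p.+1) a k * s ^+ k|
                  <= C * `|s| ^+ p.+1].
Local Notation qw := (#|{: {bseq (p ^ L.-1.+1) of 'I_d}}|).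
Local Notation q := (#|{: nidx d L r}|%:R : R).
Let CE : R := exp_moment (Y 0%N) c7.

Definition cover_cst : R :=
  qw%:R * (4 * rho * d%:R * (2 * r%:R * (p%:R * C)) ^+ L.-1) ^+ d.

(** Collects the error terms of [expected_risk_le]: the deviation, then 16 from [4 / n] and the
    cover radius, the descent error, the outcomes counted by [bad], and the fourth moment. *)
Definition rate_cst : R :=
  128 * (cover_cst * k1%:R + expR (24 / c7 * CE)) + 16 +
  2 * @descent_cst R d L r c9 tmin + 7 * CE + 4 / c7 ^+ 2 * CE.

Lemma cover_cst_ge0 : 0 <= cover_cst.
Proof.
have C0 : 0 <= C by rewrite (le_trans _ C1).
by rewrite mulr_ge0// exprn_ge0// !mulr_ge0 ?exprn_ge0 ?mulr_ge0//
  (le_trans _ rho1).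
Qed.

Lemma descent_cst_ge0 : 0 <= @descent_cst R d L r c9 tmin.
Proof.
have c90' := ltW c90.
by rewrite /descent_cst !addr_ge0 ?mulr_ge0 ?sqr_ge0 ?addr_ge0 ?mulr_ge0.
Qed.

Lemma rate_cst_ge0 : 0 <= rate_cst.
Proof.
have cc0 := cover_cst_ge0; have dc0 := descent_cst_ge0.
have CE0 : 0 <= CE by exact: exp_moment_ge0.
have h1 : 0 <= 128 * (cover_cst * k1%:R + expR (24 / c7 * CE)).
  by rewrite mulr_ge0// addr_ge0 ?expR_ge0// mulr_ge0.
have h2 : 0 <= 4 / c7 ^+ 2 * CE by rewrite mulr_ge0// divr_ge0// sqr_ge0.
by rewrite /rate_cst !addr_ge0// mulr_ge0.
Qed.

Variables (n : nat) (x A b beta : R).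
Local Notation Lam := (@lipc R L r (b + 1) rho).
Hypotheses (n1 : (1 < n)%N) (K0 : (0 < K)%N) (A1 : 1 <= A) (b1 : 1 <= b).
Hypothesis W_init : initial_distribution A b W.
Hypotheses (beta1 : 1 <= beta) (Mbeta : M <= beta) (beta_x : beta <= x).
Hypotheses (ln1 : 1 <= ln (n%:R : R)) (ln_x : ln (n%:R : R) <= x).
Hypotheses (ln_beta : 3 * ln (n%:R : R) <= c7 * beta ^+ 2).
Hypotheses (x2 : 2 <= x) (xn : x ^+ 14 <= n%:R) (Lam_x : Lam <= x).
Hypotheses (q_x : 8 * q <= x) (c9_x : c9 <= x).
Hypothesis cover_n :
  K%:R * (C * (1 + r%:R * (b + 1)) ^+ L.-1 * x^-1 ^+ p.+1) <= (2 * n%:R)^-1.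
Hypothesis count_n :
  4 * n%:R * qw%:R * (K%:R * (1 + p%:R * C)) + 3 <= n%:R ^+ k1 :> R.

Lemma large_sample_risk :
  (\int[P]_t
      L2_risk (X 0%N)
        (estimator r0 n (fun i => X i t) (fun i => Y i t) c8 c9 tmin
           (random_wvec W t) beta)
        m
   <= 4%:E *
      \int[P]_t
          ereal_inf [set L2_risk (X 0%N) (network r0 w) m
            | w in [set w | enorm ((w - random_wvec W t) 0)
                              <= n%:R^-1]%R]
       + (rate_cst * (A ^+ d * b ^+ (L.-1 * d) * x ^+ (d + 8) / n%:R))%:E)%E.
Proof.
have n0 : (0 < n)%N by exact: ltnW.
have nR : 0 < n%:R :> R by rewrite ltr0n.
have nR1 : 1 <= n%:R :> R by rewrite ler1n.
have ni0 : 0 < n%:R^-1 :> R by rewrite invr_gt0.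
have x1 : 1 <= x by rewrite (le_trans _ x2)// ler1n.
have x0 : 0 <= x by rewrite (le_trans _ x1).
have be0 : 0 <= beta by rewrite (le_trans _ beta1).
have A0 : 0 <= A by rewrite (le_trans _ A1).
have b0 : 0 <= b by rewrite (le_trans _ b1).
have b10 : 0 <= b + 1 by rewrite addr_ge0.
have C0 : 0 <= C by rewrite (le_trans _ C1).
have CE0 : 0 <= CE by exact: exp_moment_ge0.
have Lam1 : 1 <= Lam by exact: lipc_ge1.
have Lam0 : 0 <= Lam by rewrite (le_trans _ Lam1).
have [I [G [I0 lnI [mG Gb] GP]]] := cover_exists d0 r0 p0 C1 taylorC n0 x1 A1 b1
  be0 rho1 cover_n.
(* Three powers of [n] are spent: one on the number of responses that may exceed [beta], one on the
   penalty for such outcomes, of order [n], and one on the rate. *)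
have expl : expR (- (c7 * beta ^+ 2)) <= n%:R^-1 ^+ 3.
  rewrite (@le_trans _ _ (expR (- (3 * ln n%:R))))// ?ler_expR ?lerN2//.
  by rewrite expRN -[3]/(3%:R) expRM_natl lnK ?posrE// exprVn.
have expl2 : expR (- (c7 * beta ^+ 2 / 2)) <= n%:R^-1.
  rewrite (@le_trans _ _ (expR (- ln n%:R)))//; last by rewrite expRN lnK.
  by rewrite ler_expR lerN2; have := ln_beta; have := ln1; lra.
have [ti tl] := tail_integrable c70 Yexp be0.
have [oi ol] := outside_integrable c70 Yexp be0.
have [yi yl] := Y4_integrable c70 Yexp.
have tl' : (\int[P]_t tail beta (Y 0%N t) <= 24 / c7 * n%:R^-1 * CE)%R.
  rewrite (le_trans tl)// ler_wpM2r// ler_wpM2l// divr_ge0//; exact: ltW.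
have ol' : (\int[P]_t (1 - inside beta (Y 0%N t)) <= n%:R^-1 ^+ 3 * CE)%R.
  by rewrite (le_trans ol)// ler_wpM2r.
have x7n : x ^+ 7 <= n%:R by rewrite (le_trans _ xn)// ler_weXn2l.
have Qn : 2 / n%:R * (q * Lam ^+ 2 * (beta ^+ 2 + 1 + 2) ^+ 2) <= 1.
  rewrite mulrAC ler_pdivrMr// mul1r (le_trans _ x7n)//.
  have gap := @monotone_gap_le R d L r x b beta rho x2 be0 beta_x Lam0 Lam_x.
  apply: (@le_trans _ _ (2 * (4 * q * x ^+ 6))); first by rewrite ler_wpM2l.
  have -> : 2 * (4 * q * x ^+ 6) = 8 * q * x ^+ 6 by ring.
  by rewrite [leRHS]exprS ler_wpM2r ?exprn_ge0.
have c9n : c9 * ln n%:R / n%:R <= 1.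
  rewrite ler_pdivrMr// mul1r (le_trans _ x7n)//.
  have x27 : x * x <= x ^+ 7 by rewrite -expr2; exact: ler_weXn2l.
  apply: le_trans x27; apply: ler_pM => //; first exact: ltW.
  exact: le_trans ln1.
have := expected_risk_le XY_ident ind m_regression mM (Y_integrable c70 Yexp)
  beta1 Mbeta rho1 X_rho n1 K0 tmin0 c90 A0 b0 c80 ln1 W_init Qn c9n I0 mG Gb
  (ltW ni0) GP ti tl' oi ol' yi yl.
move=> /le_trans; apply; rewrite leeD2l// lee_fin.
have derr_le := descent_err_le (d := d) tmin n0 x2 xn (ltW c90) be0 beta_x ln_x Lam0 Lam_x
  (path_err_ge0 b beta rho c90 ln1).
set derr := descent_err _ _ _ _ _ _ in derr_le *.
set S := A ^+ d * _.
have S1 : 1 <= S by rewrite mulr_ege1// exprn_ege1.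
have lnI' : ln #|I|%:R <= cover_cst * k1%:R * (S * x ^+ d.+1).
  have E : ln (4 * n%:R * qw%:R * (K%:R * (1 + p%:R * C)) + 3) <= k1%:R * x :> R.
    apply: (@le_trans _ _ (k1%:R * ln n%:R)); last by rewrite ler_wpM2l.
    rewrite [leRHS]mulr_natl -lnXn// ler_ln ?posrE ?exprn_gt0//.
    by rewrite ltr_wpDl// !mulr_ge0// addr_ge0// mulr_ge0.
  apply: (le_trans lnI); apply: le_trans (ler_wpM2l _ E) _.
    by rewrite mulr_ge0// exprn_ge0// !mulr_ge0 ?exprn_ge0 ?mulr_ge0//
      (le_trans _ rho1).
  rewrite le_eqVlt; apply/orP; left; apply/eqP.
  rewrite exprMn (exprMn d (A * _)) (exprMn d A) -exprM [x ^+ d.+1]exprS.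
  by rewrite /cover_cst /S; ring.
pose z := S * x ^+ (d + 8) / n%:R.
have xS k : (k <= d + 8)%N -> x ^+ k / n%:R <= z.
  move=> kd; rewrite ler_pM2r//.
  by rewrite -[leLHS]mul1r ler_pM ?exprn_ge0// ler_weXn2l.
have xS0 : n%:R^-1 <= z by have := xS 0%N isT; rewrite expr0 mul1r.
have z0 : 0 <= z by rewrite (le_trans (ltW ni0)).
have be2 : beta ^+ 2 <= x ^+ 2 by rewrite lerXn2r ?nnegrE.
set theta := n%:R / _.
have bee : 0 < 8 * (4 * beta) ^+ 2 by rewrite mulr_gt0// exprn_gt0// mulr_gt0// (lt_le_trans _ beta1).
have th0 : 0 < theta by rewrite divr_gt0.
(* [theta] is [n / (128 * beta ^+ 2)] and the bound on the tail is of order [1/n], so the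
   exponential is bounded uniformly in [n]. *)
have expb : expR (2 * theta * (24 / c7 * n%:R^-1 * CE)) <= expR (24 / c7 * CE).
  rewrite ler_expR.
  have -> : 2 * theta * (24 / c7 * n%:R^-1 * CE) = (beta ^+ 2)^-1 / 64 * (24 / c7 * CE).
    by rewrite /theta; field; rewrite !gt_eqF// (lt_le_trans _ beta1).
  rewrite ler_piMl//; first by rewrite mulr_ge0// divr_ge0// ltW.
  have be2i : (beta ^+ 2)^-1 <= 1.
    by rewrite invf_le1 ?exprn_ege1// exprn_gt0// (lt_le_trans _ beta1).
  apply: le_trans be2i; apply: ler_piMr; first by rewrite invr_ge0 sqr_ge0.
  by rewrite invf_le1// ler1n.
have t1 : (ln #|I|%:R + expR (2 * theta * (24 / c7 * n%:R^-1 * CE))) / theta <=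
    128 * (cover_cst * k1%:R + expR (24 / c7 * CE)) * z.
  have cc0 := cover_cst_ge0.
  have Sx : 1 <= S * x ^+ d.+1 by rewrite mulr_ege1// exprn_ege1.
  apply: (@le_trans _ _ ((cover_cst * k1%:R + expR (24 / c7 * CE)) *
      (S * x ^+ d.+1) * (128 * x ^+ 2 / n%:R))).
    apply: ler_pM.
    - by rewrite addr_ge0 ?expR_ge0// ln_ge0// ler1n.
    - by rewrite invr_ge0 ltW.
    - rewrite [leRHS]mulrDl lerD// (le_trans expb)// ler_peMr// expR_ge0.
    - rewrite /theta invf_div ler_pM2r//.
      have -> : 8 * (4 * beta) ^+ 2 = 128 * beta ^+ 2 by ring.
      by rewrite ler_wpM2l.
  have -> : (cover_cst * k1%:R + expR (24 / c7 * CE)) *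
      (S * x ^+ d.+1) * (128 * x ^+ 2 / n%:R) =
      128 * (cover_cst * k1%:R + expR (24 / c7 * CE)) *
      (S * (x ^+ d.+1 * x ^+ 2) / n%:R) by ring.
  rewrite -exprD ler_wpM2l//.
    by rewrite mulr_ge0// addr_ge0 ?expR_ge0// mulr_ge0.
  rewrite /z ler_pM2r// ler_wpM2l ?(le_trans _ S1)//.
  (* [d] powers of [x] come from the number of cells, one from the logarithm of the number of
     coefficient values, and two from [beta ^+ 2] in [theta]. The exponent [d + 8] covers these as
     well as the 8 of the descent error. *)
  by rewrite ler_weXn2l// addSn -addnS leq_add2l.
have t2 : 12 * beta * n%:R^-1 <= 12 * z.
  have := xS 1%N (leq_trans (isT : (1 <= 8)%N) (leq_addl d 8)); rewrite expr1 => h.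
  by rewrite -mulrA ler_wpM2l// (le_trans _ h)// ler_pM2r.
have t3 : derr <= @descent_cst R d L r c9 tmin * z.
  rewrite (le_trans derr_le)// -mulrA; apply: ler_wpM2l; last exact: xS (leq_addl _ _).
  exact: descent_cst_ge0.
have t4 : (6 * beta ^+ 2 + n%:R) * (n%:R * (n%:R^-1 ^+ 3 * CE)) <= 7 * CE * z.
  have -> : (6 * beta ^+ 2 + n%:R) * (n%:R * (n%:R^-1 ^+ 3 * CE)) =
    CE * (6 * (beta ^+ 2 / n%:R * n%:R^-1) + n%:R^-1) by field; rewrite gt_eqF.
  have -> : 7 * CE * z = CE * (6 * z + z) by ring.
  rewrite ler_wpM2l// lerD// ler_wpM2l//.
  have h := xS 2%N (leq_trans (isT : (2 <= 8)%N) (leq_addl d 8)).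
  rewrite (le_trans _ h)// (@le_trans _ _ (beta ^+ 2 / n%:R))//; last by rewrite ler_pM2r.
  by rewrite ler_piMr ?divr_ge0 ?sqr_ge0// invf_le1.
have t5 : 4 / c7 ^+ 2 * CE / n%:R <= 4 / c7 ^+ 2 * CE * z.
  by rewrite ler_wpM2l// mulr_ge0// divr_ge0// sqr_ge0.
have t6 : 4 / n%:R <= 4 * z by rewrite ler_wpM2l.
rewrite -/z; apply: le_trans (lerD (lerD (lerD (lerD t1 t6)
  (lerD t2 (ler_wpM2l (ler0n _ 2) t3))) t4) t5) _.
by rewrite le_eqVlt /rate_cst; apply/orP; left; apply/eqP; ring.
Qed.

End large_sample.

Section trivial_risk.
Context {R : realType} {dT : measure_display} {T : measurableType dT}.
Variable P : probability T R.
Context {d : nat}.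
Variables (X : {RV P >-> d.-tuple R}) (m : d.-tuple R -> R) (M : R).
Hypothesis mM : forall x, `|m x| <= M.

Lemma L2_risk_ge0 f : (0 <= L2_risk X f m)%E.
Proof. by apply: integral_ge0 => x _; rewrite lee_fin exprn_ge0. Qed.

Lemma L2_risk_bounded f beta : (forall x, `|f x| <= beta) ->
  (L2_risk X f m <= ((beta + M) ^+ 2)%:E)%E.
Proof.
move=> fb; rewrite -(integral_cstT (distribution P X) ((beta + M) ^+ 2)).
apply: ge0_le_integralT => x; first by rewrite lee_fin exprn_ge0.
rewrite lee_fin lerXn2r ?nnegrE ?(le_trans _ (ler_normB _ _)) ?lerD//.
  by rewrite addr_ge0// ?(le_trans _ (fb x)) ?(le_trans _ (mM x)).
by rewrite (le_trans (ler_normB _ _))// lerD.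
Qed.

End trivial_risk.

Section growth.
Context {R : realType}.

Lemma near_poly_growth (K : nat -> nat) (kappa : R) :
  (K n)%:R / (n%:R `^ kappa) @[n --> \oo] --> (0 : R) ->
  exists k, \forall n \near \oo, (K n)%:R <= n%:R ^+ k :> R.
Proof.
move=> /cvgr0_norm_lt /(_ 1 ltr01) Kk.
exists (Num.truncn kappa).+1; near=> n.
have n1 : (0 < n)%N by near: n; exists 1%N.
have nR : 1 <= n%:R :> R by rewrite ler1n.
have : `|(K n)%:R / (n%:R `^ kappa)| < 1 :> R by near: n; exact: Kk.
rewrite ger0_norm ?divr_ge0 ?powR_ge0// ltr_pdivrMr ?powR_gt0 ?ltr0n// mul1r.
move=> /ltW /le_trans; apply; rewrite -powR_mulrn//; apply: ler_powR => //.
by rewrite ltW// Num.Theory.truncnS_gt.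
Unshelve. all: by end_near. Qed.

Lemma powR_power_le (n : nat) (a s : R) k : (0 < n)%N -> a * k%:R <= s ->
  (n%:R `^ a) ^+ k <= n%:R `^ s :> R.
Proof.
move=> n0 aks; rewrite -powR_mulrn ?powR_ge0// -powRrM.
by apply: ler_powR => //; rewrite ler1n.
Qed.

End growth.

Section cover_growth.
Context {R : realType}.

(** Of the [p + 1] powers of [x^-1], one pays for the layer constants [u]; the other [p] pay for
    [K <= n^k], for the accuracy [1/n] and for [2 C <= n]. *)
Lemma cover_radius_le (n K k p : nat) (C x u : R) : (0 < n)%N -> 0 < x -> 0 <= C ->
  0 <= u -> u <= x -> K%:R <= n%:R ^+ k :> R -> n%:R ^+ k.+2 <= x ^+ p ->
  2 * C <= n%:R -> K%:R * (C * u * x^-1 ^+ p.+1) <= (2 * n%:R)^-1.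
Proof.
move=> n0 x0 C0 u0 ux Kn xp Cn.
have nR : 0 < n%:R :> R by rewrite ltr0n.
rewrite -[leLHS]mulr1 -[leRHS]mul1r ler_pdivlMr ?mulr_gt0// mulr1.
apply: (@le_trans _ _ (n%:R ^+ k * (C * x * x^-1 ^+ p.+1) * (2 * n%:R))).
  rewrite ler_wpM2r// ?mulr_ge0// ler_pM// ?mulr_ge0 ?exprn_ge0 ?invr_ge0 ?(ltW x0)//.
  by rewrite ler_wpM2r ?exprn_ge0 ?invr_ge0 ?(ltW x0)// ler_wpM2l.
have -> : n%:R ^+ k * (C * x * x^-1 ^+ p.+1) * (2 * n%:R) =
    (2 * C) * n%:R ^+ k.+1 / x ^+ p.
  by rewrite -exprVn !exprS; field; rewrite gt_eqF.
rewrite ler_pdivrMr ?exprn_gt0// mul1r (le_trans _ xp)// [leRHS]exprS.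
by rewrite ler_wpM2r// exprn_ge0.
Qed.

Lemma cover_count_le (n K k : nat) (e c : R) : (0 < n)%N -> 0 <= e -> 0 <= c ->
  K%:R <= n%:R ^+ k :> R -> 4 * e * c + 3 <= n%:R ->
  4 * n%:R * e * (K%:R * c) + 3 <= n%:R ^+ k.+2 :> R.
Proof.
move=> n0 e0 c0 Kn ecn.
have nR : 1 <= n%:R :> R by rewrite ler1n.
apply: (@le_trans _ _ ((4 * e * c + 3) * n%:R ^+ k.+1)).
  rewrite [leRHS]mulrDl lerD//; last by rewrite ler_peMr// exprn_ege1.
  have -> : 4 * n%:R * e * (K%:R * c) = 4 * e * c * (n%:R * K%:R) :> R by ring.
  by rewrite ler_wpM2l ?mulr_ge0// exprS ler_wpM2l.
by rewrite [leRHS]exprS ler_wpM2r// exprn_ge0.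
Qed.

End cover_growth.

(* (X 0, Y 0) is the generic pair (X, Y); the sample is (X i, Y i), i >= 1. *)
Theorem theorem1
  (R : realType) (disp : measure_display) (T : measurableType disp)
  (P : probability T R)
  (d L r : nat) (d_gt0 : (0 < d)%N) (L_gt0 : (0 < L)%N) (r_gt0 : (0 < r)%N)
  (X : nat -> {RV P >-> d.-tuple R}) (Y : nat -> {RV P >-> R})
  (m : d.-tuple R -> R)
  (c7 c8 c9 c12 c13 kappa : R) (tmin : nat)
  (K : nat -> nat) (A B : nat -> R)
  (W : forall n : nat, widx d L r (K n) -> {RV P >-> R})
  (XY_ident : forall i : nat,
     identically_distributed P (fun t => (X i t, Y i t))
                               (fun t => (X 0%N t, Y 0%N t)))
  (suppX_bounded : bounded_tuples (rv_support (X 0%N)))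
  (m_regression : regression_function (X 0%N) (Y 0%N) m)
  (m_bounded : exists M : R, forall x, `|m x| <= M)
  (c7_gt0 : 0 < c7)
  (Y_exp_moment : ('E_P[fun t => expR (c7 * Y 0%N t ^+ 2)] < +oo)%E)
  (K_gt0 : forall n, (2 <= n)%N -> (0 < K n)%N)
  (kappa_gt0 : 0 < kappa)
  (K_growth : (K n)%:R / (n%:R `^ kappa) @[n --> \oo] --> (0 : R))
  (A_bounds : forall n, (2 <= n)%N -> 1 <= A n <= n%:R)
  (c13_gt0 : 0 < c13)
  (B_bounds : forall n, (2 <= n)%N -> 1 <= B n <= c13 * ln n%:R)
  (c12_gt0 : 0 < c12) (c7_c12 : 3 <= c7 * c12)
  (c8_gt : 2 * L%:R < c8) (c9_gt0 : 0 < c9) (tmin_gt0 : (0 < tmin)%N)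
  (W_initial : forall n, (2 <= n)%N -> initial_distribution (A n) (B n) (W n))
  (independence : forall n, (2 <= n)%N ->
     mutually_independent P (data_and_weights_systems X Y (W n))) :
  forall eps : R, 0 < eps ->
  exists c14 : R, 0 < c14 /\
  forall n : nat, (2 <= n)%N ->
  (\int[P]_t
      L2_risk (X 0%N)
        (estimator r_gt0 n (fun i => X i t) (fun i => Y i t) c8 c9 tmin
           (random_wvec (W n) t) (c12 * ln n%:R))
        m
   <= c14%:E *
      (\int[P]_t
          ereal_inf [set L2_risk (X 0%N) (network r_gt0 w) m
            | w in [set w | enorm ((w - random_wvec (W n) t) 0)
                              <= n%:R^-1]%R]
       + (A n ^+ d * B n ^+ ((L - 1) * d)%N / n%:R `^ (1 - eps))%:E))%E.
Proof.
move=> eps eps0.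
have [M mM] := m_bounded; have [rho0 X_rho0] := suppX_bounded.
have M0 : 0 <= M by rewrite (le_trans _ (mM [tuple 0 | _ < d])).
pose rho := Num.max rho0 1.
have rho1 : 1 <= rho by rewrite le_max lexx orbT.
have X_rho x : rv_support (X 0%N) x -> enorm (tnth x) <= rho.
  by move=> /X_rho0; rewrite le_max => ->.
(* [d + 16] exceeds both [d + 8], the power of [x = n^a] in the final rate, and 14, the power of [x]
   that must stay below [n]. *)
pose a : R := Num.min eps 1 / (d + 16)%:R.
have a0 : 0 < a by rewrite divr_gt0 ?lt_min ?eps0 ?ltr01// ltr0n addn_gt0 orbT.
have a_eps : a * (d + 8)%:R <= eps.
  apply: (@le_trans _ _ (a * (d + 16)%:R)).
    by rewrite ler_wpM2l ?(ltW a0)// ler_nat leq_add2l.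
  by rewrite divfK ?pnatr_eq0 ?addn_eq0 ?andbF// ge_min lexx.
have a14 : a * 14%:R <= 1.
  apply: (@le_trans _ _ (a * (d + 16)%:R)).
    by rewrite ler_wpM2l ?(ltW a0)// ler_nat (leq_trans _ (leq_addl _ _)).
  by rewrite divfK ?pnatr_eq0 ?addn_eq0 ?andbF// ge_min lexx orbT.
have [k Kk] := near_poly_growth K_growth.
(* Chosen so that [x ^+ p >= n ^+ k.+2] for [x = n^a], as [cover_radius_le] asks when
   [K n <= n ^+ k]. *)
pose p := (Num.truncn (k.+2%:R / a)).+1.
have ap : k.+2%:R <= a * p%:R.
  by rewrite mulrC -ler_pdivrMr// ltW// Num.Theory.truncnS_gt.
have [C [C1 taylorC]] := @taylor_sigmoid R p.
pose S n := A n ^+ d * B n ^+ (L.-1 * d).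
have S1 n : (2 <= n)%N -> 1 <= S n.
  move=> n2; have /andP[A1 _] := A_bounds n n2; have /andP[B1 _] := B_bounds n n2.
  by rewrite mulr_ege1// exprn_ege1.
pose inf n t := ereal_inf [set L2_risk (X 0%N) (network r_gt0 w) m
            | w in [set w | enorm ((w - random_wvec (W n) t) 0) <= n%:R^-1]].
pose est n t := estimator r_gt0 n (fun i => X i t) (fun i => Y i t) c8 c9 tmin
           (random_wvec (W n) t) (c12 * ln n%:R).
have inf0 n : (0 <= \int[P]_t inf n t)%E.
  apply: integral_ge0 => t _; apply: le_ereal_inf_tmp => _ [w _ <-].
  exact: L2_risk_ge0.
have c8_ge0 : 0 <= c8 by rewrite (le_trans _ (ltW c8_gt))// mulr_ge0.
pose c := rate_cst (d := d) (L := L) (r := r) Y rho c7 c9 tmin p k.+2 C.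
have large : \forall n \near \oo, (2 <= n)%N ->
    (\int[P]_t L2_risk (X 0%N) (est n t) m <=
     4%:E * \int[P]_t inf n t + (c * (S n / n%:R `^ (1 - eps)))%:E)%E.
  near=> n => n2.
  have n1 : (0 < n)%N by exact: ltnW.
  have nR : 0 < n%:R :> R by rewrite ltr0n.
  have /andP[A1 _] := A_bounds n n2; have /andP[B1 Bn] := B_bounds n n2.
  pose x := (n%:R : R) `^ a.
  have ln1 : 1 <= ln (n%:R : R) by near: n; exact: near_ln_ge.
  have be1 : 1 <= c12 * ln (n%:R : R).
    by rewrite mulrC -ler_pdivrMr//; near: n; exact: near_ln_ge.
  have Mbe : M <= c12 * ln (n%:R : R).
    by rewrite mulrC -ler_pdivrMr//; near: n; exact: near_ln_ge.
  have be_x : c12 * ln (n%:R : R) <= x.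
    by rewrite -[ln _]expr1; rewrite /x; near: n; exact: near_ln_powR.
  have ln_x : ln (n%:R : R) <= x.
    by rewrite -[ln _]expr1 -[_ ^+ _]mul1r; rewrite /x; near: n; exact: near_ln_powR.
  (* Here [3 <= c7 * c12] enters, combined with [1 <= c12 * ln n]. *)
  have ln_be : 3 * ln (n%:R : R) <= c7 * (c12 * ln (n%:R : R)) ^+ 2.
    have -> : c7 * (c12 * ln (n%:R : R)) ^+ 2 =
      (c7 * c12) * (c12 * ln (n%:R : R)) * ln (n%:R : R) by ring.
    rewrite ler_wpM2r// ?(le_trans _ ln1)//.
    by rewrite -[leLHS]mulr1 ler_pM.
  have x2 : 2 <= x by rewrite /x; near: n; exact: near_le_powR.
  have xn : x ^+ 14 <= n%:R.
    by rewrite -[leRHS]powRr1//; exact: powR_power_le.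
  have layer_le : 1 + r%:R * (B n + 1) <= (1 + r%:R * (c13 + 1)) * ln (n%:R : R).
    rewrite mulrDl mul1r lerD// -mulrA ler_wpM2l// mulrDl mul1r lerD//.
  have layer0 : 0 <= 1 + r%:R * (B n + 1).
    by rewrite addr_ge0// mulr_ge0// addr_ge0// (le_trans _ B1).
  have Lam_x : @lipc R L r (B n + 1) rho <= x.
    rewrite /lipc (@le_trans _ _ (((1 + r%:R * (c13 + 1)) * ln (n%:R : R)) ^+ L.-1 * rho))//.
      rewrite ler_wpM2r ?(le_trans _ rho1)// lerXn2r ?nnegrE//.
      exact: le_trans layer_le.
    rewrite exprMn mulrAC; rewrite /x; near: n; exact: near_ln_powR.
  have q_x : 8 * #|{: nidx d L r}|%:R <= x by rewrite /x; near: n; exact: near_le_powR.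
  have c9_x : c9 <= x by rewrite /x; near: n; exact: near_le_powR.
  have Kn : (K n)%:R <= n%:R ^+ k :> R by near: n; exact: Kk.
  have C0 : 0 <= C by rewrite (le_trans _ C1).
  have xp : n%:R ^+ k.+2 <= x ^+ p.
    rewrite /x -[x in _ <= x]powR_mulrn ?powR_ge0// -powRrM -powR_mulrn//.
    by apply: ler_powR => //; rewrite ler1n.
  have Cn : 2 * C <= n%:R by near: n; exact: nbhs_infty_ger.
  have cover_n : (K n)%:R * (C * (1 + r%:R * (B n + 1)) ^+ L.-1 * x^-1 ^+ p.+1) <=
      (2 * n%:R)^-1.
    apply: cover_radius_le Kn xp Cn => //; first exact: lt_le_trans x2.
      by rewrite exprn_ge0.
    by rewrite (le_trans _ Lam_x)// /lipc ler_peMr// exprn_ge0.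
  have count_n : 4 * n%:R * #|{: {bseq (p ^ L.-1.+1) of 'I_d}}|%:R *
      ((K n)%:R * (1 + p%:R * C)) + 3 <= n%:R ^+ k.+2 :> R.
    apply: cover_count_le Kn _ => //; first by rewrite addr_ge0// mulr_ge0.
    by near: n; exact: nbhs_infty_ger.
  have := large_sample_risk d_gt0 r_gt0 XY_ident (independence n n2) m_regression mM
    c7_gt0 Y_exp_moment rho1 X_rho c8_ge0 c9_gt0 tmin_gt0 (ltn0Sn _) C1 taylorC n2
    (K_gt0 n n2) A1 B1 (W_initial n n2) be1 Mbe be_x ln1 ln_x ln_be x2 xn Lam_x q_x
    c9_x cover_n count_n.
  move=> /le_trans; apply; rewrite leeD2l// lee_fin ler_wpM2l//.
    exact: rate_cst_ge0.
  rewrite -/(S n) -mulrA ler_wpM2l ?(le_trans _ (S1 n n2))//.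
  have n1e : 0 < n%:R `^ (1 - eps) :> R by rewrite powR_gt0.
  rewrite ler_pdivrMr// mulrC ler_pdivlMr//.
  rewrite (@le_trans _ _ (n%:R `^ eps * n%:R `^ (1 - eps)))//.
    by rewrite ler_wpM2r ?powR_ge0//; exact: powR_power_le.
  rewrite -powRD; first by rewrite addrC subrK powRr1.
  by rewrite (gt_eqF nR) implybT.
have [N _ large_N] := large.
(* For the finitely many [n] below [N], the trivial risk bound is divided by [1 / n^(1 - eps)]. As
   [S n >= 1], the rate term of the conclusion with the sum of these values as constant suffices
   there. *)
pose small n := (c12 * ln n%:R + M) ^+ 2 * n%:R `^ (1 - eps).
have small0 n : 0 <= small n by rewrite mulr_ge0 ?sqr_ge0 ?powR_ge0.
have c0 : 0 <= c by exact: rate_cst_ge0.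
have sum0 : 0 <= \sum_(n < N) small n by rewrite sumr_ge0.
exists (4 + c + \sum_(n < N) small n); split; first by rewrite ltr_pwDl// ltr_pwDl.
move=> n n2; rewrite subn1 -/(S n); have J0 := inf0 n.
set J := (\int[P]_t inf n t)%E in J0; rewrite -/J.
have Sn0 : 0 <= S n / n%:R `^ (1 - eps).
  by rewrite divr_ge0 ?powR_ge0// (le_trans _ (S1 n n2)).
have nR : 0 < n%:R :> R by rewrite ltr0n ltnW.
rewrite ge0_muleDr ?lee_fin//; have [Nn|nN] := leqP N n.
  apply: le_trans (large_N n Nn n2) _.
  apply: leeD; first by rewrite lee_wpmul2r// lee_fin; lra.
  by rewrite -EFinM lee_fin ler_wpM2r//; lra.
apply: (@le_trans _ _ (small n / n%:R `^ (1 - eps))%:E).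
  rewrite mulfK ?gt_eqF ?powR_gt0// -(integral_cstT P ((c12 * ln n%:R + M) ^+ 2)).
  apply: ge0_le_integralT => t; first exact: L2_risk_ge0.
  apply: L2_risk_bounded => // z; apply: truncate_le.
  by rewrite mulr_ge0 ?(ltW c12_gt0)// ln_ge0// ler1n ltnW.
rewrite -[leLHS]add0e leeD//.
  have u0 : 0 <= 4 + c + \sum_(n0 < N) small n0 by rewrite addr_ge0// addr_ge0.
  exact: mule_ge0.
rewrite -EFinM lee_fin [leRHS]mulrA ler_wpM2r ?invr_ge0 ?powR_ge0//.
rewrite -[leLHS]mulr1 ler_pM// ?S1//.
apply: (@le_trans _ _ (\sum_(i < N) small i)); last by rewrite lerDr addr_ge0.
rewrite (bigD1 (Ordinal nN))//= lerDl.
by rewrite sumr_ge0.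
Unshelve. all: by end_near. Qed.
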